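(* Let $M$ be a minuscule poset, let $q$ be a positive integer, and let $T\in\mathrm{Inc}^q(M)$ be an increasing tableau of height $q$ on $M$. Then \[ \mathcal{DT}(T)=\mathcal{DT}\big(\psi^{q}(T)\big), \] where $\psi^q$ denotes $K$-promotion on $\mathrm{Inc}^q(M)$ applied $q$ times; that is, $T$ and $\psi^q(T)$ have the same restriction to the doubletree of $M$.
   Context: Let $[q]=\{1,\dots,q\}$. For a finite poset $P$, $\mathrm{Inc}^q(P)$ is the set of increasing tableaux of height $q$ on $P$, i.e. maps $T:P\to[q]$ with $T(x)<T(y)$ whenever $x<y$ in $P$. $K$-promotion $\psi:\mathrm{Inc}^q(P)\to\mathrm{Inc}^q(P)$ is defined as follows. Start with $T\in\mathrm{Inc}^q(P)$. For $i=2,3,\dots,q$ in succession: consider the elements of $P$ currently labeled $1$ or $i$, and the connected components of the subgraph of the Hasse diagram of $P$ induced on these elements; in each component with more than one element, swap the labels $1$ and $i$ (elements labeled $1$ become labeled $i$ and vice versa); leave one-element components unchanged. After step $i=q$, decrease every label by $1$, and replace every resulting label $0$ by $q$. The result is $\psi(T)\in\mathrm{Inc}^q(P)$. Doubletree: for a minuscule poset $M$, the bottom tree $\mathcal{BT}(M)$ is the set of $x\in M$ such that the principal order ideal $\{y: y\le x\}$ is a chain; the top tree $\mathcal{TT}(M)$ is the set of $x\in M$ such that the principal order filter $\{y: y\ge x\}$ is a chain; the doubletree is $\mathcal{DT}(M)=\mathcal{BT}(M)\cup\mathcal{TT}(M)$. For $T\in\mathrm{Inc}^q(M)$, $\mathcal{DT}(T)$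 is the restriction of $T$ to $\mathcal{DT}(M)$. Minuscule posets: let $\Phi^+$ be the positive roots of a complex connected reductive group $G$ (with respect to a choice of Borel subgroup and maximal torus), partially ordered by the order generated by $\alpha<\beta$ whenever $\beta-\alpha\in\Phi^+$. A simple root $\delta$ is minuscule if the coroot $\delta^\vee$ appears with multiplicity at most one in the simple coroot expansion of $\alpha^\vee$ for every $\alpha\in\Phi^+$. The minuscule poset $M_\delta$ is the subposet of $\Phi^+$ consisting of the positive roots whose simple root expansion involves $\delta$ with nonzero coefficient. By the known classification, the minuscule posets are, up to isomorphism, exactly the following, where $\mathbf{a}$ is an $a$-element chain and $J(Q)$ is the poset of order ideals of $Q$ under inclusion: (1) the rectangles $\mathbf{a}\times\mathbf{b}$, $a,b\ge 1$; (2) the shifted staircases $S_n=\{(x,y): 1\le x\le y\le n\}$, $n\geq 1$, with $(x,y)\le(x',y')$ iff $x\le x'$ and $y\le y'$; (3) the propellers $J^k(\mathbf{2}\times\mathbf{2})$, $k\ge 0$, where $J$ is iterated $k$ times; (4) the Cayley–Moufang poset $J^2(\mathbf{3}\times\mathbf{2})$; (5) the Freudenthal poset $J^3(\mathbf{3}\times\mathbf{2})$. *)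

(* Defs.v *)
From Stdlib Require Export Relation_Operators.
From mathcomp Require Export all_boot all_order all_algebra.

Set Implicit Arguments.
Unset Strict Implicit.
Unset Printing Implicit Defensive.

Import Order.TTheory GRing.Theory Num.Theory.
Local Open Scope ring_scope.

(** A triple (G, B, T), with G a complex connected reductive group, B a Borel
    subgroup and T a maximal torus of B, enters the definition of minuscule
    posets only through its based root datum.  The character lattice of T is
    identified with row vectors in Z^n and the cocharacter lattice with column
    vectors, the pairing being the matrix product.  Roots are indexed by the
    finite type [rd_idx]; the index carries the bijection between roots and
    coroots. *)

Definition pairing (n : nat) (x : 'rV[int]_n) (y : 'cV[int]_n) : int :=
  (x *m y) ord0 ord0.

Record based_root_datum := BasedRootDatum {
  rd_rank : nat;
  rd_idx : finType;
  rd_root : rd_idx -> 'rV[int]_rd_rank;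
  rd_coroot : rd_idx -> 'cV[int]_rd_rank;
  simples : {set rd_idx};
  rd_root_inj : injective rd_root;
  rd_coroot_inj : injective rd_coroot;
  pairing_root_coroot : forall a, pairing (rd_root a) (rd_coroot a) = 2;
  reflection_root : forall a b, exists g,
    rd_root g = rd_root b - pairing (rd_root b) (rd_coroot a) *: rd_root a;
  reflection_coroot : forall a b, exists g,
    rd_coroot g = rd_coroot b - pairing (rd_root a) (rd_coroot b) *: rd_coroot a;
  reduced : forall a b (k l : int), k != 0 ->
    k *: rd_root a = l *: rd_root b -> rd_root b = rd_root a \/ rd_root b = - rd_root a;
  simples_free : forall c : rd_idx -> int,
    \sum_(s in simples) c s *: rd_root s = 0 -> {in simples, forall s, c s = 0};
  simples_span : forall a, exists c : rd_idx -> nat,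
    rd_root a = \sum_(s in simples) rd_root s *+ c s \/
    rd_root a = - \sum_(s in simples) rd_root s *+ c s
}.

Section RootPoset.
Variable D : based_root_datum.
Implicit Types a b d : rd_idx D.

Definition root_expansion a (c : rd_idx D -> nat) : Prop :=
  rd_root a = \sum_(s in simples D) rd_root s *+ c s.

Definition coroot_expansion a (c : rd_idx D -> nat) : Prop :=
  rd_coroot a = \sum_(s in simples D) rd_coroot s *+ c s.

Definition positive_root a : Prop := exists c, root_expansion a c.

Definition root_step a b : Prop :=
  [/\ positive_root a, positive_root b &
      exists2 g, positive_root g & rd_root b - rd_root a = rd_root g].

Definition root_le : rd_idx D -> rd_idx D -> Prop := clos_refl_trans (rd_idx D) root_step.

Definition minuscule_root d : Prop :=
  d \in simples D /\
  forall a, positive_root a ->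
    exists2 c, coroot_expansion a c & (c d <= 1)%N.

Definition in_minuscule_poset d a : Prop :=
  exists2 c, root_expansion a c & c d != 0%N.

End RootPoset.

(** [M] is isomorphic to some [M_d]; [f] is injective because [<=%O] on [M] is
    antisymmetric. *)
Definition minuscule_poset (disp : Order.disp_t) (M : finPOrderType disp) : Prop :=
  exists (D : based_root_datum) (d : rd_idx D), minuscule_root d /\
  exists f : M -> rd_idx D,
    (forall a, in_minuscule_poset d a <-> exists x, f x = a) /\
    (forall x y, (x <= y)%O <-> root_le (f x) (f y)).

Section Tableaux.
Variables (disp : Order.disp_t) (P : finPOrderType disp).
Implicit Types (x y : P) (T : {ffun P -> nat}) (q i : nat).

Definition increasing_tableau q T : Prop :=
  (forall x, 1 <= T x <= q)%N /\ (forall x y, (x < y)%O -> (T x < T y)%N).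

Definition covers x y : bool := (x < y)%O && [forall z, ~~ (x < z < y)%O].

Definition hasse_adj : rel P := fun x y => covers x y || covers y x.

Definition labeled_1_or i T x : bool := (T x == 1%N) || (T x == i).

Definition swap_adj i T : rel P := fun x y =>
  [&& labeled_1_or i T x, labeled_1_or i T y & hasse_adj x y].

Definition component i T x : {set P} := [set y | connect (swap_adj i T) x y].

Definition swap_step T i : {ffun P -> nat} :=
  [ffun x => if labeled_1_or i T x && (1 < #|component i T x|)%N
             then if T x == 1%N then i else 1%N
             else T x].

Definition relabel q T : {ffun P -> nat} :=
  [ffun x => if (T x).-1 == 0%N then q else (T x).-1].

(** [iota 2 q.-1] is the list 2, 3, ..., q. *)
Definition Kpromotion q T : {ffun P -> nat} :=
  relabel q (foldl swap_step T (iota 2 q.-1)).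

Definition is_chain (A : {set P}) : bool :=
  [forall x in A, forall y in A, (x >=< y)%O].

Definition bottom_tree : {set P} := [set x | is_chain [set y | (y <= x)%O]].

Definition top_tree : {set P} := [set x | is_chain [set y | (x <= y)%O]].

Definition doubletree : {set P} := bottom_tree :|: top_tree.

End Tableaux.

Arguments doubletree {disp} P.

(* Main.v *)
(** Recording the sublevel sets of the successive promotions of [T], K-promotion
    becomes a local rule on squares of order ideals, symmetric under
    transposition.  Suppose first that [M] is the set of roots with coefficient
    1 at a simple root [d] and that the root system looks simply laced near [M].
    An ideal [l] of [M] defines a positive system, obtained from the standard
    one by negating the roots of [l].  Fix a coefficient functional and its
    orbit under the Levi Weyl group [W_d].  A "lift" of a chain of ideals
    attaches to each ideal a functional of this orbit, consecutive functionals
    being comparable in the Bruhat order of the corresponding positive systems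
    up to the reflections in the roots that separate the two ideals.  Every lift
    can be normalized, and a normalized lift of one side of a square is a lift of
    the opposite side; pushing a constant lift through a rectangle shows that
    the vanishing of a functional outside the initial ideal of the top row forces
    the vanishing of another one on the final ideal of the bottom row.
    The converse is the same statement for the dual poset, which is the poset of
    the root system twisted by the longest element of [W_d].  Two rectangles
    then compare [T] with its [q]-th promotion on the smallest roots whose
    support contains a given simple root, that is, on the bottom tree, and
    dually on the top tree.

    In a general minuscule poset the coefficients at [d] are 1 or 2.  If some
    root is long, then either two roots of coefficient 1 are non-orthogonal and
    [M] is a chain, where counting sublevel sets suffices, or all of them are
    orthogonal and [M] is also the minuscule poset of a half-spin node in
    type D. *)

Require Import Defs.
From Stdlib Require Import FunctionalExtensionality Operators_Properties.
From mathcomp Require Import all_boot all_order all_algebra.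
From mathcomp Require Import zify ring.

Set Implicit Arguments.
Unset Strict Implicit.
Unset Printing Implicit Defensive.

Import Order.TTheory.

(** * K-promotion and growth squares *)

(** The number [q] enters through rectangles whose extreme corners are forced. With [T] at the
    levels from [j] to [q] on one side and its [j]-th promotion at the levels from 0 to [q - j] on
    the opposite side, these corners are the empty ideal and all of [M]. Such a rectangle ties the
    elements of label at most [j] in [T] to those of label above [q - j] in the [j]-th promotion; a
    rectangle of height [q - j] ties the latter to the elements of label at most [j] in the [q]-th
    promotion.

    The functionals are the coefficients [co s]. Vanishing of [co s] on an ideal says that no root
    of the ideal has [s] in its support, so what the method sees of a tableau are the elements
    determined by a single simple root; this is where the doubletree comes from.

    The transport of positive systems by reflections relies on the coefficients at [d] being at most
    1, which is why long roots are treated apart. In the classification they occur at the spin node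
    of type B, where the short roots are orthogonal, and at the first node of type C in rank at
    least 3, where [M] is a chain; the proof extracts only these two consequences. *)

Section Growth.
Variables (disp : Order.disp_t) (P : finPOrderType disp).
Implicit Types (x y z : P) (A B S : {set P}) (T : {ffun P -> nat}).

Definition is_ideal S := forall x y, (x <= y)%O -> y \in S -> x \in S.

Definition is_antichain A := forall x y, x \in A -> y \in A -> ~~ (x < y)%O.

Definition isolated S x := forall y, y \in S -> ~~ hasse_adj x y.

(** In the sweep of promotion [a :\: l] carries the label 1, [n :\: a] the next label [i], and
    [b :\: l] is the set labeled [i] after the swap. An isolated element keeps its label, so it lies
    in exactly one of [a] and [b]; any other element is swapped, so it lies in both or in
    neither. *)
Record growth_square (l a b n : {set P}) : Prop := GrowthSquare {
  gs_l : is_ideal l; gs_a : is_ideal a; gs_b : is_ideal b; gs_n : is_ideal n;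
  gs_la : l \subset a; gs_lb : l \subset b; gs_an : a \subset n; gs_bn : b \subset n;
  gs_Ala : is_antichain (a :\: l); gs_Aan : is_antichain (n :\: a);
  gs_Alb : is_antichain (b :\: l); gs_Abn : is_antichain (n :\: b);
  gs_iso : forall x, x \in n :\: l -> isolated (n :\: l) x -> (x \in b) = (x \notin a);
  gs_niso : forall x, x \in n :\: l -> ~ isolated (n :\: l) x -> (x \in b) = (x \in a) }.

Lemma growth_squareC l a b n : growth_square l a b n -> growth_square l b a n.
Proof.
case=> h1 h2 h3 h4 h5 h6 h7 h8 h9 h10 h11 h12 hi hn; split=> // x xD sx.
  by rewrite hi // negbK.
by rewrite hn.
Qed.

Lemma hasse_adjC : symmetric (@hasse_adj disp P).
Proof. by move=> x y; rewrite /hasse_adj orbC. Qed.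

(** A chain in a union of two antichains has at most two elements, so nothing fits strictly between
    [x] and [y]. *)
Lemma hasse_adj_two_antichains (A B : {set P}) x y :
  is_antichain A -> is_antichain B -> (forall u v, u \in A -> v \in B -> ~~ (v < u)%O) ->
  (forall z, (x < z < y)%O -> z \in A :|: B) ->
  x \in A :|: B -> y \in A :|: B -> (x < y)%O -> [/\ x \in A, y \in B & hasse_adj x y].
Proof.
move=> hA hB hBA hc; rewrite !inE => hx hy xy.
have [xA|xA] := boolP (x \in A); last first.
  move: hx; rewrite (negbTE xA) /= => xB.
  have [yB|yB] := boolP (y \in B); first by have := hB _ _ xB yB; rewrite xy.
  by move: hy; rewrite (negbTE yB) orbF => yA; have := hBA _ _ yA xB; rewrite xy.
have [yA|yA] := boolP (y \in A); first by have := hA _ _ xA yA; rewrite xy.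
move: hy; rewrite (negbTE yA) /= => yB; split=> //.
rewrite /hasse_adj /covers xy /=; apply/orP; left; apply/forallP => z; apply/negP => xzy.
move: (hc z xzy); case/andP: xzy => xz zy; rewrite inE => /orP[zA|zB].
  by have := hA _ _ xA zA; rewrite xz.
by have := hB _ _ zB yB; rewrite zy.
Qed.

Section Next.
Variables (l a n : {set P}).
Hypotheses (il : is_ideal l) (ia : is_ideal a) (in_ : is_ideal n).
Hypotheses (la : l \subset a) (an : a \subset n).
Hypotheses (Ala : is_antichain (a :\: l)) (Aan : is_antichain (n :\: a)).
Variable b : {set P}.
Hypotheses (lb : l \subset b) (bn : b \subset n).
Hypothesis biso : forall x, x \in n :\: l -> isolated (n :\: l) x -> (x \in b) = (x \notin a).
Hypothesis bniso : forall x, x \in n :\: l -> ~ isolated (n :\: l) x -> (x \in b) = (x \in a).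

(** Comparability and adjacency thus coincide on [n :\: l]: an isolated element is incomparable to
    all the others. *)
Lemma square_lt x y : x \in n :\: l -> y \in n :\: l -> (x < y)%O ->
  [/\ x \in a, y \notin a & hasse_adj x y].
Proof.
have eD : n :\: l = (a :\: l) :|: (n :\: a).
  apply/setP => z; rewrite !inE; have := subsetP la z; have := subsetP an z.
  by case: (z \in a); case: (z \in l); case: (z \in n) => //= h1 h2;
    (try by have := h1 isT); (try by have := h2 isT).
move=> xD yD xy.
have := @hasse_adj_two_antichains _ _ x y Ala Aan; rewrite -eD => H.
have [||//|//|//|] := H.
- move=> u v; rewrite !inE => /andP[_ ua] /andP[va _]; apply/negP => vu.
  by move: va; rewrite (ia (ltW vu) ua).
- move=> z /andP[xz zy]; rewrite inE (in_ (ltW zy)) ?andbT; last by case/setDP: yD.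
  by apply/negP => zl; case/setDP: xD => _; rewrite (il (ltW xz) zl).
- by rewrite !inE => /andP[_ ?] /andP[? _] ?.
Qed.

Lemma square_niso x y : y \in n :\: l -> hasse_adj x y -> ~ isolated (n :\: l) x.
Proof. by move=> yD h /(_ y yD); rewrite h. Qed.

(** Neither member of a comparable pair of [n :\: l] is isolated, so [b] agrees with [a] on such
    pairs; this gives the ideal and antichain conditions for [b]. *)
Lemma growth_square_next : growth_square l a b n.
Proof.
have Dx x : x \in b :\: l -> x \in n :\: l.
  by rewrite !inE => /andP[-> /(subsetP bn)->].
have ib : is_ideal b.
  move=> x y; rewrite le_eqVlt => /orP[/eqP->//|xy] yb.
  have [yl|yl] := boolP (y \in l); first exact: (subsetP lb) _ (il (ltW xy) yl).
  have [xl|xl] := boolP (x \in l); first exact: (subsetP lb).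
  have yD : y \in n :\: l by rewrite inE yl (subsetP bn).
  have xD : x \in n :\: l by rewrite inE xl (in_ (ltW xy)) // (subsetP bn).
  have [xa ya h] := square_lt xD yD xy.
  have nx : ~ isolated (n :\: l) x by apply: square_niso yD h.
  by rewrite bniso.
have Alb : is_antichain (b :\: l).
  move=> x y xb yb; apply/negP => xy.
  have [xa ya h] := square_lt (Dx _ xb) (Dx _ yb) xy.
  have ny : ~ isolated (n :\: l) y by apply: (@square_niso y x (Dx _ xb)); rewrite hasse_adjC.
  by move: (yb); rewrite inE bniso ?(negbTE ya) ?andbF //; apply: Dx.
have Dx' x : x \in n :\: b -> x \in n :\: l.
  by rewrite !inE => /andP[xb ->]; rewrite andbT; apply: contra xb; apply: (subsetP lb).
have Abn : is_antichain (n :\: b).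
  move=> x y xb yb; apply/negP => xy.
  have [xa ya h] := square_lt (Dx' _ xb) (Dx' _ yb) xy.
  have nx : ~ isolated (n :\: l) x by apply: square_niso (Dx' _ yb) h.
  by move: (xb); rewrite inE bniso ?xa //; apply: Dx'.
by split.
Qed.

End Next.

Lemma growth_square_lt l a b n x y : growth_square l a b n ->
  x \in n :\: l -> y \in n :\: l -> (x < y)%O -> [/\ x \in a, y \notin a & hasse_adj x y].
Proof. by case=> *; apply: (@square_lt l a n). Qed.

End Growth.

(** * Growth squares in the dual poset *)

Section GrowthDual.
Variables (disp : Order.disp_t) (P : finPOrderType disp).

Lemma covers_dual (x y : P) : @covers _ P^d x y = covers y x.
Proof.
by rewrite /covers; congr (_ && _); apply: eq_forallb => z; rewrite andbC.
Qed.

Lemma hasse_adj_dual (x y : P) : @hasse_adj _ P^d x y = hasse_adj x y.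
Proof. by rewrite /hasse_adj !covers_dual orbC. Qed.

Lemma is_ideal_dual (S : {set P}) : is_ideal S -> @is_ideal _ P^d (~: S).
Proof. by move=> h x y xy; rewrite !inE; apply: contra; apply: h. Qed.

Lemma is_antichain_dual (S : {set P}) : is_antichain S -> @is_antichain _ P^d S.
Proof. by move=> h x y xS yS; apply: h. Qed.

Lemma growth_square_dual (l a b n : {set P}) : growth_square l a b n ->
  @growth_square _ P^d (~: n) (~: a) (~: b) (~: l).
Proof.
have eD (A B : {set P}) : ~: A :\: ~: B = B :\: A by apply/setP => x; rewrite !inE negbK andbC.
case=> h1 h2 h3 h4 h5 h6 h7 h8 h9 h10 h11 h12 hi hn.
split; rewrite ?eD; try exact: is_ideal_dual; try by rewrite setCS.
- exact: is_antichain_dual.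
- exact: is_antichain_dual.
- exact: is_antichain_dual.
- exact: is_antichain_dual.
- move=> x xD ix; rewrite !inE negbK hi ?negbK // => y yD.
  by rewrite -hasse_adj_dual; apply: ix.
- move=> x xD ix; rewrite !inE hn // => ix'; apply: ix => y yD.
  by rewrite hasse_adj_dual; apply: ix'.
Qed.

End GrowthDual.

(** * Sublevel sets of promotions and growth rectangles *)

Section Promotion.
Variables (disp : Order.disp_t) (P : finPOrderType disp).
Implicit Types (x y z : P) (T : {ffun P -> nat}) (q k : nat).

Definition sublevel T k : {set P} := [set x | T x <= k].

(** Only the existence of a labeled neighbour matters, so connected components disappear from the
    argument here. *)
Lemma component_gt1 i T x :
  labeled_1_or i T x ->
  1 < #|component i T x| <-> ~ isolated [set y | labeled_1_or i T y] x.
Proof.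
move=> lx; split=> [h1 ix|ni].
  have [y] : exists2 y, y \in component i T x & y != x.
    case: (pickP [pred y in component i T x | y != x]) => [y /andP[? ?]|h]; first by exists y.
    move: h1; rewrite ltnNge => /negP[]; rewrite -(cards1 x) subset_leq_card //.
    apply/subsetP => y yc; move: (h y); rewrite /= yc /= => /negbFE /eqP ->.
    by rewrite inE.
  rewrite inE => /connectP[[|z p] /=]; first by move=> _ -> /eqP.
  case/andP=> /and3P[_ lz h] _ _ _; move: (ix z); rewrite inE lz h => /(_ isT).
  by [].
have [y lyh] : exists y, labeled_1_or i T y && hasse_adj x y.
  apply/existsP; apply: contra_notT ni => /existsPn h y; rewrite inE => ly.
  by move: (h y); rewrite ly.
have {lyh}[ly h] := andP lyh.
have yx : x != y by apply: contraTneq h => ->; rewrite /hasse_adj /covers ltxx.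
have <- : #|[set x; y]| = 2 by rewrite cards2 yx.
apply: subset_leq_card; apply/subsetP => z; rewrite !inE => /orP[] /eqP ->.
  exact: connect0.
by apply: connect1; rewrite /swap_adj lx ly.
Qed.

Lemma swap_step_isolated T i x :
  isolated [set y | labeled_1_or i T y] x -> swap_step T i x = T x.
Proof.
move=> ix; rewrite ffunE; case: ifP => // /andP[lx /(component_gt1 lx)]; by case.
Qed.

Lemma swap_step_unlabeled T i x : ~~ labeled_1_or i T x -> swap_step T i x = T x.
Proof. by move=> /negbTE lx; rewrite ffunE lx. Qed.

Lemma swap_step_swap T i x : labeled_1_or i T x ->
  ~ isolated [set y | labeled_1_or i T y] x ->
  swap_step T i x = if T x == 1 then i else 1.
Proof. by move=> lx ix; rewrite ffunE lx; have /(component_gt1 lx)-> := ix. Qed.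

Definition swap_iter T k := foldl (@swap_step disp P) T (iota 2 k).

Lemma swap_iterS T k : swap_iter T k.+1 = swap_step (swap_iter T k) k.+2.
Proof. by rewrite /swap_iter -[k.+1]addn1 iotaD foldl_cat /= add2n addn1. Qed.

(** The labels from 2 to [k.+1] are final at this stage; for [k < q] these elements form the [k]-th
    sublevel set of the promotion. Label 1 is excluded because it ends up as [q]. *)
Definition swept T k : {set P} := [set x | 1 < swap_iter T k x <= k.+1].

Section Steps.
Variables (q : nat) (T : {ffun P -> nat}).
Hypothesis hT : increasing_tableau q T.

Lemma sublevel_ideal k : is_ideal (sublevel T k).
Proof.
move=> x y; rewrite !inE le_eqVlt => /orP[/eqP->//|xy] yk.
by case: hT => _ /(_ _ _ xy) h; apply: leq_trans yk; apply: ltnW.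
Qed.

Lemma sublevel_sub k m : k <= m -> sublevel T k \subset sublevel T m.
Proof. by move=> km; apply/subsetP => x; rewrite !inE => /leq_trans; apply. Qed.

Lemma sublevel_antichain k : is_antichain (sublevel T k.+1 :\: sublevel T k).
Proof.
move=> x y; rewrite !inE -!ltnNge => /andP[xk xk'] /andP[yk yk'].
by apply/negP => xy; case: hT => _ /(_ _ _ xy); lia.
Qed.

Lemma tableau_gt0 x : 0 < T x.
Proof. by case: hT => /(_ x) /andP[]. Qed.

Lemma tableau_le x : T x <= q.
Proof. by case: hT => /(_ x) /andP[]. Qed.

Lemma sublevel0 : sublevel T 0 = set0.
Proof. by apply/setP => x; rewrite !inE leqNgt tableau_gt0. Qed.

Lemma sublevel_height : sublevel T q = setT.
Proof. by apply/setP => x; rewrite !inE tableau_le. Qed.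

(** The unswept part of [sublevel T k.+1] still carries the label 1; its being an antichain is what
    makes the next step a growth square. *)
Definition swap_inv k : Prop :=
  [/\ is_ideal (swept T k), swept T k \subset sublevel T k.+1,
      is_antichain (sublevel T k.+1 :\: swept T k),
      forall x, k.+1 < T x -> swap_iter T k x = T x &
      forall x, x \in sublevel T k.+1 :\: swept T k -> swap_iter T k x = 1].

Lemma swept0 : swept T 0 = set0.
Proof. by apply/setP => x; rewrite !inE; apply/negP => /andP[]; lia. Qed.

Lemma swap_inv0 : swap_inv 0.
Proof.
rewrite /swap_inv swept0 setD0; split=> //.
- by move=> x y _; rewrite inE.
- exact: sub0set.
- by have := sublevel_antichain (k := 0); rewrite sublevel0 setD0.
- by move=> x; rewrite /swap_iter /= inE; have := tableau_gt0 x; lia.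
Qed.

Lemma swap_invS k : swap_inv k ->
  growth_square (swept T k) (sublevel T k.+1) (swept T k.+1) (sublevel T k.+2) /\ swap_inv k.+1.
Proof.
case=> h1 h2 h3 h4 h5.
pose U := swap_iter T k.
have lab x : labeled_1_or k.+2 U x = (x \in sublevel T k.+2 :\: swept T k).
  rewrite /labeled_1_or; have [xk|xk] := leqP (T x) k.+1; last first.
    rewrite /U h4 // !inE h4 //; lia.
  have [xs|xs] := boolP (x \in swept T k).
    rewrite inE xs /=; move: xs; rewrite inE -/U; lia.
  rewrite /U (h5 x) ?eqxx ?inE ?xk ?xs //=; last by move: xs; rewrite inE => ->.
  by move: xs; rewrite !inE => -> /=; lia.
have eL : [set y | labeled_1_or k.+2 U y] = sublevel T k.+2 :\: swept T k.
  by apply/setP => y; rewrite inE lab.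
have sw x : x \in swept T k -> swap_step U k.+2 x = U x.
  by move=> xs; apply: swap_step_unlabeled; rewrite lab inE xs.
have hi x : x \in sublevel T k.+2 :\: swept T k ->
    isolated (sublevel T k.+2 :\: swept T k) x -> (x \in swept T k.+1) = (x \notin sublevel T k.+1).
  move=> xD ix; rewrite inE swap_iterS swap_step_isolated ?eL // -/U inE.
  have [xk|xk] := leqP (T x) k.+1.
    by rewrite /U h5 // inE [x \in sublevel _ _]inE xk andbT; case/setDP: xD.
  by rewrite /U h4 //; case/setDP: xD; rewrite inE; lia.
have hn x : x \in sublevel T k.+2 :\: swept T k ->
    ~ isolated (sublevel T k.+2 :\: swept T k) x -> (x \in swept T k.+1) = (x \in sublevel T k.+1).
  move=> xD ix; rewrite inE swap_iterS swap_step_swap ?eL ?lab // -/U inE.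
  have [xk|xk] := leqP (T x) k.+1.
    rewrite /U h5 //; last by rewrite inE [x \in sublevel _ _]inE xk andbT; case/setDP: xD.
    by rewrite eqxx; lia.
  by rewrite {1}/U h4 //; case: eqP; lia.
have sub1 : swept T k \subset swept T k.+1.
  apply/subsetP => x xs; rewrite inE swap_iterS sw // /U; move: xs; rewrite inE; lia.
have sub2 : swept T k.+1 \subset sublevel T k.+2.
  apply/subsetP => x; apply: contraLR => xk.
  have xD : ~~ labeled_1_or k.+2 U x by rewrite lab inE (negbTE xk) andbF.
  rewrite inE swap_iterS swap_step_unlabeled // /U.
  have xk' : k.+2 < T x by move: xk; rewrite inE -ltnNge.
  by rewrite h4; lia.
have S := growth_square_next h1 (sublevel_ideal (k := k.+1)) (sublevel_ideal (k := k.+2)) h2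
  (sublevel_sub (leqnSn _)) h3 (sublevel_antichain (k := k.+1)) sub1 sub2 hi hn.
split=> //; split=> //.
- exact: gs_b S.
- exact: gs_Abn S.
- move=> x xk; rewrite swap_iterS swap_step_unlabeled ?h4 //; first by lia.
  by rewrite -/U lab !inE; lia.
- move=> x; rewrite inE => /andP[xs xk].
  have xD : x \in sublevel T k.+2 :\: swept T k.
    by rewrite inE xk andbT; apply: contra xs; apply: (subsetP sub1).
  have xl : labeled_1_or k.+2 U x by rewrite lab.
  move: xs; rewrite inE swap_iterS -/U.
  have [-> // | ->] : swap_step U k.+2 x = 1 \/ swap_step U k.+2 x = k.+2; last by lia.
  rewrite ffunE xl /=; have /orP[/eqP->|/eqP->] := xl; case: ifP => _ /=; by [left|right].
Qed.

Lemma swap_inv_all k : swap_inv k.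
Proof. by elim: k => [|k /swap_invS[]//]; apply: swap_inv0. Qed.

Lemma swept_square k :
  growth_square (swept T k) (sublevel T k.+1) (swept T k.+1) (sublevel T k.+2).
Proof. by have [] := swap_invS (swap_inv_all k). Qed.

(** Later steps exchange 1 only with labels larger than [j.+1]. *)
Lemma swept_stable j k x : j <= k -> (1 < swap_iter T k x <= j.+1) = (x \in swept T j).
Proof.
elim: k => [|k IH]; first by rewrite leqn0 => /eqP->; rewrite inE.
rewrite leq_eqVlt => /orP[/eqP->|jk]; first by rewrite inE.
rewrite -IH // swap_iterS ffunE; case: ifP => // /andP[/orP[] /eqP -> _] //=.
- by lia.
- by lia.
Qed.

Hypothesis q0 : 0 < q.

Lemma swap_iter_gt0 x : 0 < swap_iter T q.-1 x.
Proof.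
have [_ _ _ _ h] := swap_inv_all q.-1.
have [|xs] := boolP (x \in swept T q.-1); first by rewrite inE; lia.
by rewrite h // inE xs inE prednK // tableau_le.
Qed.

Lemma swap_iter_leq x : swap_iter T q.-1 x <= q.
Proof.
have [_ _ _ _ h] := swap_inv_all q.-1.
have [|xs] := boolP (x \in swept T q.-1); first by rewrite inE; lia.
by rewrite h // inE xs inE prednK // tableau_le.
Qed.

Lemma sublevel_Kpromotion j : j < q -> sublevel (Kpromotion q T) j = swept T j.
Proof.
move=> jq; apply/setP => x; rewrite -(@swept_stable j q.-1); last by lia.
rewrite inE ffunE -/(swap_iter T q.-1); have := swap_iter_gt0 x.
by case: ifP => /eqP; lia.
Qed.

Lemma sublevel_Kpromotion_height : sublevel (Kpromotion q T) q = setT.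
Proof.
apply/setP => x; rewrite !inE ffunE -/(swap_iter T q.-1).
by have := swap_iter_leq x; case: ifP => /eqP; lia.
Qed.

Lemma Kpromotion_square k : k.+1 < q ->
  growth_square (sublevel (Kpromotion q T) k) (sublevel T k.+1)
    (sublevel (Kpromotion q T) k.+1) (sublevel T k.+2).
Proof. by move=> kq; rewrite !sublevel_Kpromotion //; [exact: swept_square | lia]. Qed.

Lemma Kpromotion_column k : k < q ->
  sublevel (Kpromotion q T) k \subset sublevel T k.+1 /\
  is_antichain (sublevel T k.+1 :\: sublevel (Kpromotion q T) k).
Proof. by move=> kq; rewrite sublevel_Kpromotion //; have [] := swap_inv_all k. Qed.

Lemma Kpromotion_increasing : increasing_tableau q (Kpromotion q T).
Proof.
split=> [x|x y xy].
  have := swap_iter_leq x; have := swap_iter_gt0 x.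
  by rewrite ffunE -/(swap_iter T q.-1); case: ifP => /eqP; lia.
set U := Kpromotion q T.
have U0 z : 0 < U z.
  by rewrite ffunE -/(swap_iter T q.-1); have := swap_iter_gt0 z; case: ifP => /eqP; lia.
have Uq z : U z <= q.
  by have := in_setT z; rewrite -sublevel_Kpromotion_height inE.
(* The label [q] arises only from a leftover 1, and the elements carrying it lie in the last
   antichain of [swap_inv]. *)
have [Uy|Uy] := ltnP (U y) q; last first.
  have Uq1 : sublevel U q.-1 = swept T q.-1 by rewrite sublevel_Kpromotion //; lia.
  suff xs : x \in sublevel U q.-1 by move: xs Uy; rewrite inE; have := U0 x; lia.
  have [_ _ hA _ _] := swap_inv_all q.-1.
  rewrite Uq1; apply/negPn/negP => xs.
  have yD : y \in sublevel T q.-1.+1 :\: swept T q.-1.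
    by rewrite inE -Uq1 !inE prednK // tableau_le andbT -ltnNge; lia.
  by have := hA x y; rewrite xy inE xs yD inE prednK // tableau_le => /(_ isT isT).
have [k Uk] : exists k, U y = k.+1 by exists (U y).-1; have := U0 y; lia.
have S : growth_square (swept T k) (sublevel T k.+1) (swept T k.+1) (sublevel T k.+2).
  exact: swept_square.
have ek : sublevel U k.+1 = swept T k.+1 by rewrite sublevel_Kpromotion //; lia.
have ek' : sublevel U k = swept T k by rewrite sublevel_Kpromotion //; lia.
have yk : y \in sublevel U k.+1 by rewrite inE Uk.
have xk : x \in sublevel U k.+1 by move: yk; rewrite ek; apply: (gs_b S); apply: ltW.
suff : x \in sublevel U k by rewrite inE Uk.
apply/negPn/negP => xs; have := gs_Alb S (x := x) (y := y); rewrite xy -ek -ek' !inE => h.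
by have := h _ _; rewrite !inE in xk xs yk *; rewrite xk xs yk Uk ltnn => /(_ isT isT).
Qed.

End Steps.

Lemma iter_Kpromotion_increasing q T i : 0 < q -> increasing_tableau q T ->
  increasing_tableau q (iter i (Kpromotion q) T).
Proof. by move=> q0 hT; elim: i => //= i IH; apply: Kpromotion_increasing. Qed.

(** Row [i] holds the promotion number [j - i], shifted by [i] levels so that one promotion stays in
    its column. The corner at [0, 0] is empty, the one at [j, q - j] is everything; the other two
    are the level [j] of [T] and the level [q - j] of the [j]-th promotion. *)
Definition growth_rect q T j i c : {set P} := sublevel (iter (j - i) (Kpromotion q) T) (c + i).

Lemma growth_rect_square q T j i c : 0 < q -> increasing_tableau q T -> i < j -> c < q - j ->
  growth_square (growth_rect q T j i c) (growth_rect q T j i.+1 c)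
    (growth_rect q T j i c.+1) (growth_rect q T j i.+1 c.+1).
Proof.
move=> q0 hT ij cq; rewrite /growth_rect.
have -> : j - i = (j - i.+1).+1 by lia.
rewrite iterS !addnS !addSn; apply: Kpromotion_square => //; last by lia.
exact: iter_Kpromotion_increasing.
Qed.

End Promotion.

Import GRing.Theory Num.Theory.
Local Open Scope ring_scope.

(** * Root systems and Bruhat orders *)

(** [rn b a] stands for the pairing of the root [b] with the coroot of [a],
    [rr a b] for the reflection of [b] in [a], [co k b] for the coefficient of
    the simple root [sr k] in [b]. *)
Record root_frame := RootFrame {
  ri : finType;
  rk : finType;
  sr : rk -> ri;
  rn : ri -> ri -> int;
  rr : ri -> ri -> ri;
  co : rk -> ri -> int;
  co_inj : forall a b, (forall k, co k a = co k b) -> a = b;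
  co_rr : forall k a b, co k (rr a b) = co k b - rn b a * co k a;
  rn_rr : forall a b c, rn (rr c b) (rr c a) = rn b a;
  rnaa : forall a, rn a a = 2;
  rn_gt0_sym : forall a b, 0 < rn a b -> 0 < rn b a;
  rn_eq0_sym : forall a b, rn a b = 0 -> rn b a = 0;
  co_sr : forall k l, co k (sr l) = (k == l)%:R;
  co_sign : forall a, (forall k, 0 <= co k a) \/ (forall k, co k a <= 0);
  co_reduced : forall a k, (forall l, l != k -> co l a = 0) ->
    a = sr k \/ a = rr (sr k) (sr k);
  rn_expand : forall b a, rn b a = \sum_k co k b * rn (sr k) a }.

Section Frame.
Variable R : root_frame.
Local Notation I := (ri R).
Local Notation K := (rk R).
Implicit Types (a b c g x : I) (k l : K) (u v w : I -> int) (Q : pred I).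

Definition ropp a : I := rr a a.
Definition rpos a := [forall k, 0 <= co (r:=R) k a].

Lemma co_opp k a : co k (ropp a) = - co k a.
Proof. by rewrite co_rr rnaa; lia. Qed.

Lemma rn_add b c e a : (forall k, co k e = co k b + co k c) -> rn e a = rn b a + rn c a.
Proof.
move=> h; rewrite !(rn_expand _ a) -big_split /=; apply: eq_bigr => k _.
by rewrite h mulrDl.
Qed.

Lemma rn_rrl a b c : rn (rr c b) a = rn b a - rn b c * rn c a.
Proof.
rewrite [LHS]rn_expand [rn b a]rn_expand (rn_expand c a) mulr_sumr -sumrB.
by apply: eq_bigr => k _; rewrite co_rr; ring.
Qed.

Lemma rr_inv a b : rr a (rr a b) = b.
Proof. by apply: co_inj => k; rewrite !co_rr rn_rrl rnaa; ring. Qed.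

Lemma rr_inj a : injective (rr (r:=R) a).
Proof. by move=> b c /(congr1 (rr a)); rewrite !rr_inv. Qed.

Lemma rr_conj x g c : rr (rr x g) (rr x c) = rr x (rr g c).
Proof. by apply: co_inj => k; rewrite !co_rr rn_rr rn_rrl; ring. Qed.

Lemma oppK : involutive ropp.
Proof. by move=> a; apply: co_inj => k; rewrite !co_opp; lia. Qed.

Lemma rn_oppl b a : rn (ropp b) a = - rn b a.
Proof. by rewrite rn_rrl rnaa; lia. Qed.

Lemma rn_oppr b a : rn b (ropp a) = - rn b a.
Proof. by rewrite -[b in LHS](rr_inv a) rn_rr rn_rrl rnaa; lia. Qed.

Lemma rr_opp a b : rr a (ropp b) = ropp (rr a b).
Proof. by apply: co_inj => k; rewrite [LHS]co_rr rn_oppl !co_opp co_rr; lia. Qed.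

Lemma rr_fix a b : rn b a = 0 -> rr a b = b.
Proof. by move=> h; apply: co_inj => k; rewrite co_rr h; lia. Qed.

Lemma rn_lt0_sym a b : rn a b < 0 -> rn b a < 0.
Proof.
by move=> h; have := @rn_gt0_sym R (ropp a) b; rewrite rn_oppl rn_oppr; lia.
Qed.

Lemma posP a : reflect (forall k, 0 <= co k a) (rpos a).
Proof. exact: forallP. Qed.

Lemma co_neq0 a : exists k, co k a != 0.
Proof.
apply/existsP; apply: contraT => /existsPn h.
have := rnaa a; rewrite rn_expand big1 // => k _.
by move: (h k); rewrite negbK => /eqP ->; rewrite mul0r.
Qed.

Lemma pos_opp a : rpos (ropp a) = ~~ rpos a.
Proof.
have [k hk] := co_neq0 a; apply/idP/idP => [/posP h|].
  by apply/negP => /posP h'; move: (h k) (h' k) hk; rewrite co_opp; lia.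
move=> /negP h; apply/posP => l; rewrite co_opp; case: (co_sign a) => h'.
  by case: h; apply/posP.
by move: (h' l); lia.
Qed.

Lemma pos_witness a k : 0 < co k a -> rpos a.
Proof. by case: (co_sign a) => [h _|h]; [apply/posP | move: (h k); lia]. Qed.

Lemma pos_sr k : rpos (sr (r:=R) k).
Proof. by apply/posP => l; rewrite co_sr; case: eqP. Qed.

Lemma pos_simple_rr k b : rpos b -> b != sr k -> rpos (rr (sr k) b).
Proof.
move=> pb bk.
have [l /andP[lk lb]] : exists l, (l != k) && (0 < co l b).
  apply/existsP; apply: contraT => /existsPn h.
  have [l lk|e|e] := @co_reduced R b k.
  - by move: (h l) (posP b pb l); rewrite lk /=; lia.
  - by rewrite e eqxx in bk.
  - by have := pos_opp (sr k); rewrite /ropp -e pb pos_sr.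
by apply: (@pos_witness _ l); rewrite co_rr co_sr (negbTE lk) mulr0 subr0.
Qed.

(** Otherwise every term in the expansion of [rn b b] would be at most 0, while the sum is 2. *)
Lemma exists_pos_simple b : rpos b -> exists k, 0 < co k b /\ 0 < rn b (sr k).
Proof.
move=> /posP pb.
have [k /andP[h1 h2]] : exists k, (0 < co k b) && (0 < rn b (sr k)).
  apply/existsP; apply: contraT => /existsPn h.
  have := rnaa b; rewrite rn_expand => e.
  suff : \sum_k co k b * rn (sr k) b <= 0 by rewrite e.
  apply: sumr_le0 => k _; move: (pb k) (h k) (@rn_gt0_sym R (sr k) b).
  case: (ltrP 0 (co k b)) => c0 h1 h2 h3; last first.
    have -> : co k b = 0 by lia.
    by rewrite mul0r.
  by apply: mulr_ge0_le0 => //; lia.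
by exists k.
Qed.

Definition ht b : int := \sum_k co k b.

Lemma ht_rr a b : ht (rr a b) = ht b - rn b a * ht a.
Proof.
rewrite /ht mulr_sumr -sumrB; apply: eq_bigr => k _; exact: co_rr.
Qed.

Lemma ht_sr k : ht (sr k) = 1.
Proof.
rewrite /ht (bigD1 k) //= co_sr eqxx big1 ?addr0 // => l lk.
by rewrite co_sr (negbTE lk).
Qed.

Lemma ht_gt0 b : rpos b -> 0 < ht b.
Proof.
move=> /posP pb; have [k bk] := co_neq0 b.
rewrite /ht (bigD1 k) //=; apply: ltr_wpDr; first exact: sumr_ge0.
by move: (pb k); lia.
Qed.

(** Functionals are stored by their values on roots, and this says that such a function is the
    restriction of a linear one. On these, [ref a] is composition with the reflection in [a]. *)
Definition linf u := forall b, u b = \sum_k co k b * u (sr k).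
Definition ref a u : I -> int := fun b => u b - rn b a * u a.

Lemma linf_rr u a b : linf u -> u (rr a b) = ref a u b.
Proof.
move=> h; rewrite /ref !(h _) [in RHS]mulr_sumr -sumrB.
by apply: eq_bigr => k _; rewrite co_rr; ring.
Qed.

Lemma linf_ref u a : linf u -> linf (ref a u).
Proof.
move=> h b; rewrite /ref {1}(h b) {1}(rn_expand b a) mulr_suml -sumrB.
by apply: eq_bigr => k _; ring.
Qed.

Lemma linf_co k : linf (co k).
Proof.
move=> b; rewrite (bigD1 k) //= co_sr eqxx big1 ?addr0 ?mulr1 // => l lk.
by rewrite co_sr eq_sym (negbTE lk) mulr0.
Qed.

Lemma linf_opp u a : linf u -> u (ropp a) = - u a.
Proof. by move=> h; rewrite linf_rr // /ref rnaa; lia. Qed.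

Lemma refK u a : ref a (ref a u) = u.
Proof.
by apply: functional_extensionality => b; rewrite /ref rnaa; ring.
Qed.

Lemma ref_self u a : ref a u a = - u a.
Proof. by rewrite /ref rnaa; lia. Qed.

Lemma ref0 u a : u a = 0 -> ref a u = u.
Proof. by move=> h; apply: functional_extensionality => b; rewrite /ref h; lia. Qed.

Lemma ref_conj u g b : linf u -> ref (rr g b) (ref g u) = ref g (ref b u).
Proof.
move=> h; apply: functional_extensionality => c.
rewrite -[RHS]linf_rr; last exact: linf_ref.
have h' := linf_ref g h.
rewrite {1}/ref -(linf_rr _ _ h) -(linf_rr _ _ h) rr_inv /ref.
by rewrite -(rn_rr b (rr g c) g) rr_inv.
Qed.

Lemma ref_opp u a : linf u -> ref (ropp a) u = ref a u.
Proof.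
move=> h; apply: functional_extensionality => c.
by rewrite /ref rn_oppr linf_opp //; ring.
Qed.

(** The Bruhat order on an orbit of functionals, relative to the positive
    system [Q]. *)
Inductive br (Q : pred I) : (I -> int) -> (I -> int) -> Prop :=
| br_refl u : br Q u u
| br_step u b w : Q b -> u b <= 0 -> br Q (ref b u) w -> br Q u w.

Lemma br_trans Q u v w : br Q u v -> br Q v w -> br Q u w.
Proof. by elim=> [//|u1 b w1 Qb ub _ IH /IH]; apply: br_step. Qed.

Lemma br_one Q u b : Q b -> u b <= 0 -> br Q u (ref b u).
Proof. by move=> Qb ub; apply: (br_step Qb ub); apply: br_refl. Qed.

(** A dominant functional is maximal: steps are possible only along roots where it vanishes, and
    these fix it. *)
Lemma br_top Q u w : (forall b, Q b -> 0 <= u b) -> br Q u w -> w = u.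
Proof.
move=> h H; elim: H h => [//|u1 b w1 Qb ub _ IH h].
have u0 : u1 b = 0 by move: (h _ Qb); lia.
by rewrite ref0 // in IH; apply: IH.
Qed.

(** Simplicity is expressed by the reflection permuting the rest of [Q], so that no base of [Q] has
    to be produced. *)
Definition simple_in (Q : pred I) g :=
  Q g && [forall b, Q b ==> (b != g) ==> Q (rr g b)].

Lemma simple_inP (Q : pred I) g :
  reflect (Q g /\ forall b, Q b -> b <> g -> Q (rr g b)) (simple_in Q g).
Proof.
apply: (iffP andP) => [[Qg /forallP h]|[Qg h]]; split=> //.
  by move=> b Qb /eqP bg; move: (h b); rewrite Qb bg.
by apply/forallP => b; apply/implyP => Qb; apply/implyP => /eqP; apply: h.
Qed.

Lemma simple_in_pos k : simple_in rpos (sr k).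
Proof.
by apply/simple_inP; split=> [|b pb /eqP bk]; [apply: pos_sr | apply: pos_simple_rr].
Qed.

(** For [g] in the positive system, the larger of [u] and [ref g u] in its Bruhat order. *)
Definition raise g u := if u g <= 0 then ref g u else u.

Lemma raise_ge0 g u : 0 <= u g -> raise g u = u.
Proof. by rewrite /raise; case: ifP => // h1 h2; apply: ref0; lia. Qed.

Lemma raise_le0 g u : u g <= 0 -> raise g u = ref g u.
Proof. by rewrite /raise => ->. Qed.

(** The lifting property of the Bruhat order. *)
Lemma br_raise (Q : pred I) g u w : simple_in Q g -> linf u -> br Q u w ->
  br Q (raise g u) (raise g w).
Proof.
move=> /simple_inP[Qg hg] lu H; elim: H lu => [v _|{}u b {}w Qb ub _ IH lu].
  exact: br_refl.
have lu1 : linf (ref b u) by apply: linf_ref.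
apply: br_trans (IH lu1).
have [bg|bg] := eqVneq b g.
  rewrite -{}bg in hg Qg *.
  rewrite raise_le0 // raise_ge0 ?ref_self; [exact: br_refl | lia].
(* Since [g] is simple, the step along [b] becomes, after reflection in [g], a step along [rr g b],
   which is still in [Q]. *)
have Qb' : Q (rr g b) by apply: hg => //; apply/eqP.
have st : br Q (ref g u) (ref g (ref b u)).
  rewrite -ref_conj //; apply: br_one => //.
  by rewrite -linf_rr // rr_inv.
have [ug|ug] := lerP (u g) 0; have [vg|vg] := lerP (ref b u g) 0.
- by rewrite !raise_le0.
- rewrite raise_le0 // raise_ge0; last by lia.
  apply: br_trans st _; rewrite -[ref b u in X in br _ _ X](refK _ g).
  by apply: br_one; rewrite // ref_self; lia.
- rewrite raise_ge0 ?raise_le0 //; last by lia.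
  apply: br_step Qb ub _; exact: br_one.
- rewrite !raise_ge0; [exact: br_one | lia | lia].
Qed.

Lemma br_transport (Q Q' : pred I) x u w : (forall b, Q' (rr x b) = Q b) -> linf u ->
  br Q u w -> br Q' (ref x u) (ref x w).
Proof.
move=> hQ lu H; elim: H lu => [v _|{}u b {}w Qb ub _ IH lu]; first exact: br_refl.
apply: (@br_step _ _ (rr x b)); first by rewrite hQ.
  by rewrite -linf_rr // rr_inv.
by rewrite ref_conj //; apply: IH; apply: linf_ref.
Qed.

Lemma simple_in_transport (Q Q' : pred I) x g : (forall b, Q' (rr x b) = Q b) ->
  simple_in Q g -> simple_in Q' (rr x g).
Proof.
move=> hQ /simple_inP[Qg hg]; apply/simple_inP; rewrite hQ; split=> // b.
rewrite -[b](rr_inv x) hQ rr_conj hQ => Qb bg; apply: hg => // e; apply: bg.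
by rewrite e.
Qed.

End Frame.

(** * Positive systems attached to order ideals *)

Definition frame_step (R : root_frame) (M : Type) (f : M -> ri R) (x y : M) : Prop :=
  exists2 g, rpos g & forall k, co k (f y) = co k (f x) + co k g.

(** [tp_sl] says that the root system looks simply laced near [M]. *)
Record tight_poset (R : root_frame) (d : rk R) (disp : Order.disp_t)
    (M : finPOrderType disp) (f : M -> ri R) : Prop := TightPoset {
  tp_co : forall b, -1 <= co d b <= 1;
  tp_inj : injective f;
  tp_onto : forall b, co d b = 1 -> exists x, f x = b;
  tp_d : forall x, co d (f x) = 1;
  tp_sl : forall x b, b <> f x -> b <> ropp (f x) ->
    rn b (f x) = rn (f x) b /\ -1 <= rn b (f x) <= 1;
  tp_le : forall x y : M, (x <= y)%O <-> clos_refl_trans M (frame_step f) x y }.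

Section Tight.
Variables (R : root_frame) (d : rk R) (disp : Order.disp_t) (M : finPOrderType disp).
Variable f : M -> ri R.
Hypothesis H : tight_poset d f.
Local Notation I := (ri R).
Local Notation K := (rk R).
Implicit Types (x y z : M) (A B l : {set M}) (b c g : I) (u v w : I -> int).

Lemma tp_pos x : rpos (f x).
Proof. by apply: (@pos_witness _ _ d); rewrite (tp_d H). Qed.

Lemma step_lt x y g : rpos g -> (forall k, co k (f y) = co k (f x) + co k g) -> (x < y)%O.
Proof.
move=> pg h; rewrite lt_neqAle; apply/andP; split; last first.
  by apply/(tp_le H); apply: rt_step; exists g.
apply/eqP => e; have [k] := co_neq0 g; move: (h k); rewrite e; lia.
Qed.

Lemma tp_cases b : [\/ exists x, b = f x, exists x, b = ropp (f x) | co d b = 0].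
Proof.
have := tp_co H b; case: (ltrgtP (co d b) 0) => h h'.
- have [x e] : exists x, f x = ropp b by apply: (tp_onto H); rewrite co_opp; lia.
  by apply: Or32; exists x; rewrite e oppK.
- by have [x e] : exists x, f x = b; [apply: (tp_onto H); lia | apply: Or31; exists x].
- exact: Or33.
Qed.

Lemma f_neq_opp x y : f x <> ropp (f y).
Proof. by move/(congr1 (co d)); rewrite co_opp !(tp_d H). Qed.

Lemma rn_M x y : x <> y -> rn (f x) (f y) = rn (f y) (f x) /\ 0 <= rn (f x) (f y) <= 1.
Proof.
move=> xy; have [||e h] := tp_sl H (x := y) (b := f x).
- by move/(tp_inj H).
- exact: f_neq_opp.
split=> //; have := tp_co H (rr (f y) (f x)); rewrite co_rr !(tp_d H); lia.
Qed.

Lemma rn_L x b : co d b = 0 -> rn b (f x) = rn (f x) b /\ -1 <= rn b (f x) <= 1.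
Proof.
move=> hb; apply: (tp_sl H) => e; move: hb; rewrite e ?co_opp (tp_d H); lia.
Qed.

(** The difference [f y - f x] is then a root, and its sign decides the comparison. *)
Lemma rn1_lt x y : x <> y -> rn (f y) (f x) = 1 ->
  if rpos (rr (f x) (f y)) then (x < y)%O else (y < x)%O.
Proof.
move=> xy h; case: ifP => pg.
  by apply: (step_lt pg) => k; rewrite co_rr h; lia.
have pg' : rpos (ropp (rr (f x) (f y))) by rewrite pos_opp pg.
by apply: (step_lt pg') => k; rewrite co_opp co_rr h; lia.
Qed.

Lemma incomparable_rn x y : x <> y -> ~~ (x < y)%O -> ~~ (y < x)%O -> rn (f x) (f y) = 0.
Proof.
move=> xy h1 h2; have [e h] := rn_M xy.
apply/eqP; apply: contraT => h0; have h3 : rn (f y) (f x) = 1 by lia.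
by have := rn1_lt xy h3; rewrite (negbTE h1) (negbTE h2) if_same.
Qed.

Lemma covers_step x y : covers x y -> frame_step f x y.
Proof.
rewrite /covers => /andP[xy /forallP hc].
have h : clos_refl_trans_1n M (frame_step f) x y by apply/clos_rt_rt1n/(tp_le H)/ltW.
case: h xy hc => [|z y' sz zy]; first by rewrite ltxx.
move=> xy' hc.
have xz : (x < z)%O by case: sz => g pg hg; apply: step_lt pg hg.
have : (z <= y')%O by apply/(tp_le H)/clos_rt1n_rt.
rewrite le_eqVlt => /orP[/eqP <- //|zy']; by move: (hc z); rewrite xz zy'.
Qed.

Lemma step_rn x y : frame_step f x y -> rn (f y) (f x) = 1.
Proof.
case=> g pg h; have xy : y <> x by move=> e; have := step_lt pg h; rewrite e ltxx.
have hg : co d g = 0 by have := h d; rewrite !(tp_d H); lia.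
have [_ h1] := rn_L x hg; have [_ h2] := rn_M xy.
by have := rn_add (f x) h; rewrite rnaa; lia.
Qed.

Definition Qs l : pred I := fun b => (rpos b && (b \notin f @: l)) || (ropp b \in f @: l).

Lemma in_fl l x : (f x \in f @: l) = (x \in l).
Proof. exact: mem_imset (tp_inj H). Qed.

Lemma opp_notin_fl l x : (ropp (f x) \in f @: l) = false.
Proof. by apply/negP => /imsetP[y _ /esym]; apply: f_neq_opp. Qed.

Lemma L_notin_fl l b : co d b = 0 -> (b \in f @: l) = false.
Proof. by move=> h; apply/negP => /imsetP[y _ e]; move: h; rewrite e (tp_d H). Qed.

Lemma Qs_M l x : Qs l (f x) = (x \notin l).
Proof. by rewrite /Qs tp_pos in_fl opp_notin_fl orbF. Qed.

Lemma Qs_oppM l x : Qs l (ropp (f x)) = (x \in l).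
Proof. by rewrite /Qs pos_opp tp_pos oppK in_fl. Qed.

Lemma Qs_L l b : co d b = 0 -> Qs l b = rpos b.
Proof. by move=> h; rewrite /Qs !L_notin_fl ?co_opp ?h //= andbT orbF. Qed.

Lemma Qs_opp l b : Qs l (ropp b) = ~~ Qs l b.
Proof.
have [[x ->]|[x ->]|hb] := tp_cases b.
- by rewrite Qs_oppM Qs_M negbK.
- by rewrite oppK Qs_M Qs_oppM.
- by rewrite !Qs_L ?pos_opp // co_opp hb.
Qed.

Lemma Qs0 : Qs set0 = rpos (R:=R).
Proof.
apply: functional_extensionality => b; rewrite /Qs imset0 !inE andbT orbF //.
Qed.

Definition addable l x := x \notin l /\ forall z, (z < x)%O -> z \in l.

(** By [tp_sl] a root other than plus or minus [f x] is fixed by the reflection or changes by plus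
    or minus [f x]. If it changes, it passes between the roots of coefficient 0 and those of
    coefficient plus or minus 1, and the sign of the former records the side of [x]: what lies below
    [x] is in [l], what lies above is not. *)
Lemma Qs_transport1 l x b : is_ideal l -> addable l x -> Qs l b -> Qs (x |: l) (rr (f x) b).
Proof.
move=> il [xl hx].
have il' y : (x < y)%O -> y \notin l.
  by move=> xy; apply: contra xl; apply: il; apply: ltW.
have [[y ->]|[y ->]|hb] := tp_cases b.
- rewrite Qs_M => yl; have [->|/eqP yx] := eqVneq y x.
    by rewrite -/(ropp _) Qs_oppM setU11.
  have [_ h] := rn_M yx; have [h0|h1] : rn (f y) (f x) = 0 \/ rn (f y) (f x) = 1 by lia.
    by rewrite rr_fix // Qs_M !inE negb_or yl andbT; apply/eqP.
  rewrite Qs_L; last by rewrite co_rr h1 !(tp_d H); lia.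
  have /(_ (nesym yx) h1) := @rn1_lt x y; case: ifP => // _ /hx.
  by rewrite (negbTE yl).
- rewrite Qs_oppM => yl; have /eqP yx : y != x by apply: contraNneq xl => <-.
  have [_ h] := rn_M yx; have [h0|h1] : rn (f y) (f x) = 0 \/ rn (f y) (f x) = 1 by lia.
    by rewrite rr_opp rr_fix // Qs_oppM !inE yl orbT.
  rewrite rr_opp Qs_L; last by rewrite co_opp co_rr h1 !(tp_d H); lia.
  rewrite pos_opp.
  have /(_ (nesym yx) h1) := @rn1_lt x y; case: ifP => // _ /il'.
  by rewrite yl.
- rewrite Qs_L // => pb; have [_ h] := rn_L x hb.
  have [h0|[h1|h1]] : rn b (f x) = 0 \/ rn b (f x) = 1 \/ rn b (f x) = -1 by lia.
  + by rewrite rr_fix // Qs_L.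
  + have [z e] : exists z, f z = ropp (rr (f x) b).
      by apply: (tp_onto H); rewrite co_opp co_rr h1 (tp_d H) hb; lia.
    have zx : (z < x)%O by apply: (step_lt pb) => k; rewrite e co_opp co_rr h1; lia.
    by rewrite -[rr _ b]oppK -e Qs_oppM !inE (hx _ zx) orbT.
  + have [z e] : exists z, f z = rr (f x) b.
      by apply: (tp_onto H); rewrite co_rr h1 (tp_d H) hb; lia.
    have xz : (x < z)%O by apply: (step_lt pb) => k; rewrite e co_rr h1; lia.
    by rewrite -e Qs_M !inE negb_or il' // andbT gt_eqF.
Qed.

Lemma Qs_transport l x b : is_ideal l -> addable l x -> Qs (x |: l) (rr (f x) b) = Qs l b.
Proof.
move=> il hx; apply/idP/idP; last exact: Qs_transport1.
apply: contraLR; rewrite -!Qs_opp -rr_opp; exact: Qs_transport1.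
Qed.

Lemma Qs_transportV l x b : is_ideal l -> addable l x -> Qs l (rr (f x) b) = Qs (x |: l) b.
Proof. by move=> il hx; rewrite -(Qs_transport _ il hx) rr_inv. Qed.

Lemma Qs_add l x b : b <> f x -> b <> ropp (f x) -> Qs (x |: l) b = Qs l b.
Proof.
have [[y ->]|[y ->]|hb] := tp_cases b.
- move=> h _; rewrite !Qs_M !inE; case: eqP => // e; by case: h; rewrite e.
- move=> _ h; rewrite !Qs_oppM !inE; case: eqP => // e; by case: h; rewrite e.
- by rewrite !Qs_L.
Qed.

(** The reflection carries the system of [l] to that of [x |: l], and the two differ only at plus
    and minus [f x]. *)
Lemma simple_addable l x : is_ideal l -> addable l x -> simple_in (Qs l) (f x).
Proof.
move=> il hx; have [xl _] := hx; apply/simple_inP; rewrite Qs_M; split=> // b Qb bx.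
rewrite -(@Qs_add l x) ?Qs_transport // => e.
  apply: (f_neq_opp (x := x) (y := x)); move: Qb.
  by rewrite -[b](rr_inv (f x)) e -/(ropp _) Qs_oppM (negbTE xl).
by apply: bx; apply: (rr_inj (a := f x)); rewrite e.
Qed.

(** The product of the commuting reflections in an antichain. *)
Definition refs A u : I -> int := fun b => u b - \sum_(a in A) rn b (f a) * u (f a).

Lemma refs0 u : refs set0 u = u.
Proof. by apply: functional_extensionality => b; rewrite /refs big_set0 subr0. Qed.

Lemma linf_refs A u : linf u -> linf (refs A u).
Proof.
move=> h b; rewrite /refs {1}(h b) -[RHS]/(\sum_k _ * (_ - _)).
under [RHS]eq_bigr do rewrite mulrBr.
rewrite sumrB; congr (_ - _).
under [RHS]eq_bigr do rewrite mulr_sumr.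
rewrite exchange_big /=; apply: eq_bigr => a _.
by rewrite {1}rn_expand mulr_suml; apply: eq_bigr => k _; rewrite mulrA.
Qed.

Definition orth A B := forall x y, x \in A -> y \in B -> rn (f x) (f y) = 0.

Lemma orthC A B : orth A B -> orth B A.
Proof. by move=> h x y xB yA; apply: rn_eq0_sym; apply: h. Qed.

Lemma refs_orth A u x : (forall y, y \in A -> rn (f x) (f y) = 0) -> refs A u (f x) = u (f x).
Proof.
by move=> h; rewrite /refs big1 ?subr0 // => y yA; rewrite h // mul0r.
Qed.

Lemma refsU A B u : [disjoint A & B] -> orth A B -> refs (A :|: B) u = refs A (refs B u).
Proof.
move=> dAB oAB; apply: functional_extensionality => b.
rewrite [RHS]/refs /refs (eq_bigl [predU A & B]) => [|a]; last by rewrite inE.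
rewrite bigU //= [X in _ - X]addrC opprD addrA.
congr (_ - _); apply: eq_bigr => a aA; congr (_ * _).
by rewrite -/(refs B u (f a)) refs_orth // => y; apply: oAB.
Qed.

Lemma refs1 x u : refs [set x] u = ref (f x) u.
Proof. by apply: functional_extensionality => b; rewrite /refs big_set1. Qed.

Definition selforth A := forall x y, x \in A -> y \in A -> x <> y -> rn (f x) (f y) = 0.

Lemma refs_in A u x : selforth A -> x \in A -> refs A u (f x) = - u (f x).
Proof.
move=> oA xA; rewrite /refs (bigD1 x) //= rnaa big1 => [|y /andP[yA /eqP yx]]; first by lia.
by rewrite oA ?mul0r //; apply: nesym.
Qed.

Lemma refsK A u : selforth A -> refs A (refs A u) = u.
Proof.
move=> oA; apply: functional_extensionality => b; rewrite {1}/refs.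
under eq_bigr => a aA do rewrite (refs_in _ oA aA) mulrN.
by rewrite sumrN opprK /refs subrK.
Qed.

Lemma refsU1 x A u : x \notin A -> orth [set x] A -> refs (x |: A) u = ref (f x) (refs A u).
Proof. by move=> xA o; rewrite refsU ?refs1 // disjoints1. Qed.

Definition layer l A := is_ideal l /\ forall x, x \in A -> addable l x.

Lemma layer_selforth l A : layer l A -> selforth A.
Proof.
move=> [il hA] x y xA yA xy; apply: incomparable_rn => //; apply/negP => h.
  by have [_ /(_ _ h)] := hA _ yA; apply/negP; have [] := hA _ xA.
by have [_ /(_ _ h)] := hA _ xA; apply/negP; have [] := hA _ yA.
Qed.

Lemma selforthS A B : A \subset B -> selforth B -> selforth A.
Proof. by move=> /subsetP AB oB x y /AB xB /AB; apply: oB. Qed.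

Lemma layerS l A B : A \subset B -> layer l B -> layer l A.
Proof. by move=> /subsetP AB [il hB]; split=> // x /AB; apply: hB. Qed.

Lemma layer_ideal l A : layer l A -> is_ideal (l :|: A).
Proof.
move=> [il hA] x y; rewrite le_eqVlt => /orP[/eqP->//|xy]; rewrite !inE => /orP[yl|yA].
  by rewrite (il x y) // ltW.
by have [_ /(_ _ xy) ->] := hA _ yA.
Qed.

Lemma layer_addable l A x : layer l (x |: A) -> x \notin A -> addable (l :|: A) x.
Proof.
move=> [il hA] xA; have [xl hx] := hA _ (setU11 _ _); split=> [|z /hx zl].
  by rewrite !inE negb_or xl.
by rewrite inE zl.
Qed.

Lemma layer_orth1 l A x : layer l (x |: A) -> x \notin A -> orth [set x] A.
Proof.
move=> hl xA y z /set1P -> zA; apply: (layer_selforth hl).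
- exact: setU11.
- exact: setU1r.
- by move=> e; rewrite e zA in xA.
Qed.

Lemma set_ind (P : {set M} -> Prop) : P set0 ->
  (forall x A, x \notin A -> P A -> P (x |: A)) -> forall A, P A.
Proof.
move=> P0 P1 A; elim: #|A| {-2}A (erefl #|A|) => [|n IH] B hB.
  by rewrite (cards0_eq hB).
have [x xB] : exists x, x \in B by apply/set0Pn; rewrite -cards_eq0 hB.
rewrite -(setD1K xB); apply: P1; first by rewrite !inE eqxx.
by apply: IH; move: hB; rewrite (cardsD1 x B) xB; case.
Qed.

Lemma br_refsV l A u w : layer l A -> linf u ->
  br (Qs (l :|: A)) u w -> br (Qs l) (refs A u) (refs A w).
Proof.
elim/set_ind: A u w => [|x A xA IH] u w hl lu; first by rewrite setU0 !refs0.
have hl' := layerS (subsetUr [set x] A) hl.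
have o := layer_orth1 hl xA; rewrite setUCA => h.
rewrite setUC !refsU; first 1 last.
- by rewrite disjoint_sym disjoints1.
- exact: orthC.
- by rewrite disjoint_sym disjoints1.
- exact: orthC.
rewrite !refs1; apply: IH => //; first exact: linf_ref.
apply: br_transport h => // b.
apply: Qs_transportV; [exact: layer_ideal | exact: layer_addable].
Qed.

(** [g'] is the image of [g] under the product of the reflections in [A]; its values under all
    functionals describe it without introducing that product on roots. *)
Lemma simple_refs l A g : layer l A -> simple_in (Qs l) g ->
  exists2 g', simple_in (Qs (l :|: A)) g' & forall u, linf u -> u g' = refs A u g.
Proof.
move=> hl hg; elim/set_ind: A hl => [|x A xA IH] hl.
  by rewrite setU0; exists g => // u _; rewrite refs0.
have hl' := layerS (subsetUr [set x] A) hl; have o := layer_orth1 hl xA.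
have [g' hg' eg'] := IH hl'.
exists (rr (f x) g') => [|u lu].
  rewrite setUCA; apply: simple_in_transport hg' => b.
  apply: Qs_transport; [exact: layer_ideal | exact: layer_addable].
rewrite linf_rr // eg'; last exact: linf_ref.
rewrite setUC refsU ?refs1 //; last exact: orthC.
by rewrite disjoint_sym disjoints1.
Qed.

(** The lifting property is applied to the elements of [A] one by one. On the left, raising undoes
    the reflection because [u] is nonnegative on [A]; on the right it reflects at the elements of
    [S] and changes nothing at the others. *)
Lemma br_raise_set l A (S : {set M}) u w : layer l A -> S \subset A -> linf u -> linf w ->
  (forall a, a \in A -> 0 <= u (f a)) ->
  (forall a, a \in S -> w (f a) <= 0) -> (forall a, a \in A :\: S -> 0 <= w (f a)) ->
  br (Qs l) (refs A u) w -> br (Qs l) u (refs S w).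
Proof.
move=> hl SA lu lw uA wS wA h; have oA := layer_selforth hl.
suff: forall P : {set M}, P \subset A -> br (Qs l) (refs (A :\: P) u) (refs (P :&: S) w).
  by move=> /(_ A (subxx _)); rewrite setDv refs0 (setIidPr SA).
elim/set_ind => [_|x P xP IH]; first by rewrite setD0 set0I refs0.
rewrite subUset sub1set => /andP[xA PA]; have {IH}h1 := IH PA.
have xD : x \notin A :\: (x |: P) by rewrite !inE eqxx.
have eD : A :\: P = x |: (A :\: (x |: P)).
  by apply/setP => z; rewrite !inE; case: eqVneq => [->|] //=; rewrite xP xA.
have oD : orth [set x] (A :\: (x |: P)).
  move=> y z /set1P ->; rewrite !inE negb_or => /andP[/andP[/eqP zx _] zA].
  by apply: oA => // /esym.
have il := hl.1; have ax := hl.2 _ xA.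
have := br_raise (simple_addable il ax) (linf_refs _ lu) h1.
have -> : raise (f x) (refs (A :\: P) u) = refs (A :\: (x |: P)) u.
  rewrite eD refsU1 // raise_le0 ?refK // ref_self.
  rewrite refs_orth => [|y yD]; first by have := uA _ xA; lia.
  by apply: oD => //; rewrite inE.
have oP : orth [set x] (P :&: S).
  move=> y z /set1P ->; rewrite inE => /andP[zP _].
  by apply: oA => //; [apply: (subsetP PA) | move=> e; rewrite e zP in xP].
have eP : refs (P :&: S) w (f x) = w (f x).
  by apply: refs_orth => y yP; apply: oP => //; rewrite inE.
have [xS|xS] := boolP (x \in S).
  rewrite raise_le0 ?eP ?wS // -refsU1 ?inE ?(negbTE xP) //.
  suff -> : (x |: P) :&: S = x |: (P :&: S) by [].
  by apply/setP => z; rewrite !inE; case: eqVneq => [->|].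
rewrite raise_ge0 ?eP; last by apply: wA; rewrite inE xS.
suff -> : (x |: P) :&: S = P :&: S by [].
by apply/setP => z; rewrite !inE; case: eqVneq => [->|_] //=; rewrite (negbTE xS) andbF.
Qed.

Definition nonnegM u := forall x, 0 <= u (f x).
(** Only roots of coefficient 0 are tested: on [M] itself the functionals of the orbit turn out
    nonnegative anyway. *)
Definition normalized l u := forall g, simple_in (Qs l) g -> co d g = 0 -> 0 <= u g.

Lemma layer_square l (a b n : {set M}) : growth_square l a b n ->
  [/\ layer l (a :\: l), layer l (b :\: l), layer a (n :\: a) & layer b (n :\: b)].
Proof.
have ly (s t : {set M}) : is_ideal s -> is_ideal t -> is_antichain (t :\: s) -> layer s (t :\: s).
  move=> is_ it ha; split=> // x xD; case/setDP: (xD) => xt xs; split=> // z zx.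
  apply: contraT => zs; have := ha z x; rewrite zx inE zs xD (it _ _ (ltW zx) xt).
  by move=> /(_ isT isT).
by case=> *; split; apply: ly.
Qed.

(** Distinct simple roots pair nonpositively: with pairing 1, [rr g (f x)] and [rr (f x) g] would be
    opposite roots, yet both would lie in the positive system. *)
Lemma rn_simple_addable_le0 l x g : is_ideal l -> addable l x ->
  simple_in (Qs l) g -> co d g = 0 -> rn g (f x) <= 0.
Proof.
move=> il hx hg hd; have [e h] := rn_L x hd; rewrite leNgt; apply/negP => h0.
have h1 : rn g (f x) = 1 by lia.
have /simple_inP[Qg hg'] := hg; have /simple_inP[Qx hx'] := simple_addable il hx.
have gx : g <> f x by move=> e'; move: hd; rewrite e' (tp_d H).
have := hx' _ Qg gx; have := hg' _ Qx (nesym gx).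
suff -> : rr g (f x) = ropp (rr (f x) g) by rewrite Qs_opp => /negbTE ->.
by apply: co_inj => k; rewrite co_opp !co_rr -e h1; lia.
Qed.

(** The root that corresponds to [g] at [l :|: A] has coefficient 0 or 1 at [d], since [g] pairs
    nonpositively with the elements of [A]. In the first case [u] is normalized there, in the second
    it is nonnegative on [M]. *)
Lemma simple_layer_ge0 l A u g : layer l A -> linf u -> nonnegM u ->
  normalized (l :|: A) u -> simple_in (Qs l) g -> co d g = 0 -> 0 <= refs A u g.
Proof.
move=> hl lu uM uN hg hd; have [g' hg' e] := simple_refs hl hg; rewrite -e //.
have hd' : 0 <= co d g'.
  rewrite e; last exact: linf_co.
  rewrite /refs hd sub0r oppr_ge0; apply: sumr_le0 => a aA; rewrite (tp_d H) mulr1.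
  by apply: rn_simple_addable_le0 hg hd; [apply: hl.1 | apply: hl.2].
have [g1|g0] : co d g' = 1 \/ co d g' = 0 by have := tp_co H g'; lia.
  by have [x <-] := tp_onto H g1.
exact: uN.
Qed.

(** A normalized lift of one side of a growth square is, unchanged, a lift of the
    opposite side. *)
Lemma slide_lift (l a b n : {set M}) u u' : growth_square l a b n ->
  linf u -> nonnegM u -> linf u' -> nonnegM u' -> normalized n u' ->
  br (Qs a) u (refs (n :\: a) u') -> br (Qs l) u (refs (b :\: l) u').
Proof.
move=> S lu uM lu' uM' uN h.
have la := subsetP (gs_la S); have lb := subsetP (gs_lb S).
have an := subsetP (gs_an S); have bn := subsetP (gs_bn S).
have [LA LB' LB LA'] := layer_square S.
set A := a :\: l in LA *; set B := n :\: a in LB h *; set B' := b :\: l in LB' *.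
set A' := n :\: b in LA'.
have elA : l :|: A = a by apply/setP => x; rewrite !inE; have := la x; case: (x \in l); case: (x \in a) => // ->.
have elB' : l :|: B' = b by apply/setP => x; rewrite !inE; have := lb x; case: (x \in l); case: (x \in b) => // ->.
have eaB : a :|: B = n by apply/setP => x; rewrite !inE; have := an x; case: (x \in a); case: (x \in n) => // ->.
have oA := layer_selforth LA; have oB := layer_selforth LB.
have oB' := layer_selforth LB'; have oA' := layer_selforth LA'.
(* [w] is [u'] carried from [n] back to [l] through [a], whereas the goal passes through [b]. *)
pose w := refs A (refs B u').
have lw : linf w by do 2!apply: linf_refs.
have h1 : br (Qs l) (refs A u) w by apply: br_refsV => //; rewrite elA.
have Dn x : x \in n :\: l -> isolated (n :\: l) x \/ ~ isolated (n :\: l) x.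
  by move=> _; case: (boolP [forall y in n :\: l, ~~ hasse_adj x y]) =>
    [/forall_inP|/forall_inP] ?; [left|right].
have AD x : x \in A -> x \in n :\: l by rewrite !inE => /andP[-> /an ->].
have BD x : x \in B -> x \in n :\: l.
  by rewrite !inE => /andP[xa ->]; rewrite andbT; apply: contra xa; apply: la.
have iso_orth x y : x \in n :\: l -> isolated (n :\: l) x -> y \in n :\: l -> x <> y ->
    rn (f x) (f y) = 0.
  move=> xD ix yD xy; apply: incomparable_rn => //; apply/negP => lt.
    by have [_ _] := growth_square_lt S xD yD lt; apply/negP/ix.
  have [_ _] := growth_square_lt S yD xD lt; rewrite hasse_adjC; exact/negP/ix.
have h2 : br (Qs l) u (refs (A :\: B') w).
  apply: br_raise_set h1 => //; first exact: subsetDl.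
    (* Here [x] lies in [a] but not in [b], so it is isolated and hence orthogonal to [B]. *)
    move=> x; rewrite inE => /andP[xB' xA]; rewrite /w refs_in // oppr_le0.
    have xD := AD _ xA; have ix : isolated (n :\: l) x.
      case: (Dn x xD) => // /(gs_niso S xD) e; move: xB' xA; rewrite !inE e.
      by case: (x \in a); case: (x \in l).
    rewrite refs_orth // => y By; apply: iso_orth => //; first exact: BD.
    by move=> e; move: xA By; rewrite -e !inE => /andP[_ ->].
  (* Here [x] lies in both [a] and [b], so some [y] in [B] covers it. The value of [w] at [f x] is
     that of [u'] at the simple root [g'] into which [f x] is carried at [n]; it is nonnegative as
     soon as [g'] has nonnegative coefficient at [d]. *)
  move=> x; rewrite !inE => /andP[xB' /andP[xl xa]].
  have xA : x \in A by rewrite inE xl.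
  have xD := AD _ xA.
  have xb : x \in b by move: xB'; rewrite xl xa; case: (x \in b).
  have [y yD hxy] : exists2 y, y \in n :\: l & hasse_adj x y.
    have ni : ~ isolated (n :\: l) x by move=> /(gs_iso S xD); rewrite xb xa.
    case: (boolP [exists y in n :\: l, hasse_adj x y]) => [/exists_inP[y]|ne].
      by exists y.
    case: ni => y yD; apply/negP => hxy; move/negP: ne; apply.
    by apply/exists_inP; exists y.
  have cxy : covers x y.
    case/orP: hxy => // /[dup] /andP[lt _] _.
    by have [_ /negP] := growth_square_lt S yD xD lt.
  have ya : y \notin a.
    by have /andP[lt _] := cxy; have [] := growth_square_lt S xD yD lt.
  have yB_ : y \in B by move: yD; rewrite !inE ya => /andP[].
  have r1 := step_rn (covers_step cxy).
  have [g hg eg] := simple_refs LA (simple_addable LA.1 (LA.2 _ xA)).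
  rewrite elA in hg.
  have [g' hg' eg'] := simple_refs LB hg; rewrite eaB in hg'.
  have egg v : linf v -> v g' = refs A (refs B v) (f x).
    by move=> lv; rewrite eg' // eg //; apply: linf_refs.
  rewrite /w -egg //.
  (* This coefficient is the number of elements of [B] not orthogonal to [x], minus 1, and [y] is
     such an element. *)
  have g0 : 0 <= co d g'.
    rewrite egg; last exact: linf_co.
    rewrite refs_in // /refs (tp_d H) (bigD1 y) //= (tp_d H).
    have [xy _] : x <> y /\ True by split=> // e; move: ya; rewrite -e xa.
    have [-> _] := rn_M xy; rewrite r1.
    rewrite mul1r opprB addrAC subrr add0r.
    apply: sumr_ge0 => z /andP[zB _]; rewrite (tp_d H) mulr1.
    have xz : x <> z by move=> e; move: zB; rewrite -e !inE xa.
    by have [_ /andP[]] := rn_M xz.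
  have [g1|g1] : co d g' = 1 \/ co d g' = 0 by have := tp_co H g'; clear -g0; lia.
    by have [z <-] := tp_onto H g1.
  exact: uN.
have eA : A = (A :\: B') :|: (A :&: B') by rewrite setUC setID.
have eB : B = (B :&: B') :|: (B :\: B') by rewrite setID.
have eB' : B' = (A :&: B') :|: (B :&: B').
  apply/setP => x; rewrite !inE; have := la x; have := bn x.
  case: (x \in l); case: (x \in a); case: (x \in b) => //=; case: (x \in n) => //.
  by move=> h3; have := h3 isT.
have dis (X Y : {set M}) Z : [disjoint X :\: Z & Y :&: Z].
  by rewrite -setI_eq0; apply/eqP/setP => x; rewrite !inE; case: (x \in Z); rewrite ?andbF.
have dAB : [disjoint A & B].
  by rewrite -setI_eq0; apply/eqP/setP => x; rewrite !inE; case: (x \in a); rewrite ?andbF.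
have disAB : [disjoint A :&: B' & B :&: B'].
  apply: disjointWl (subsetIl _ _) _; exact: disjointWr (subsetIl _ _) dAB.
have h3 : refs (A :\: B') w = refs B' (refs (B :\: B') u').
  have o1 : orth (A :\: B') (A :&: B').
    move=> x y xA yA_; apply: oA; [by case/setDP: xA | by case/setIP: yA_ |].
    by move=> e; case/setDP: xA; case/setIP: yA_; rewrite e => _ ->.
  have o2 : orth (B :&: B') (B :\: B').
    move=> x y xB yB_; apply: oB; [by case/setIP: xB | by case/setDP: yB_ |].
    by move=> e; case/setDP: yB_; case/setIP: xB; rewrite e => _ ->.
  have o3 : orth (A :&: B') (B :&: B').
    move=> x y xA yB_; apply: oB'; [by case/setIP: xA | by case/setIP: yB_ |].
    by move=> e; move/pred0P: disAB => /(_ x); rewrite /= {2}e xA yB_.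
  rewrite /w {2}eA {1}eB !refsU //; last by rewrite disjoint_sym; apply: dis.
  rewrite {1}refsK; last by apply: selforthS oA; apply: subsetDl.
  by rewrite -refsU // -eB'.
rewrite h3 in h2; apply: br_trans h2 _.
apply: br_refsV => //; first exact: linf_refs.
rewrite elB'.
have sBA' : B :\: B' \subset A'.
  apply/subsetP => x; rewrite !inE => /andP[h4 /andP[xa ->]]; rewrite andbT.
  apply: contra h4 => xb; rewrite xb andbT; apply: contra xa; exact: la.
(* The remaining reflections are at elements outside [b], where [u'] is nonnegative, so undoing them
   goes up. *)
elim/set_ind: (B :\: B') sBA' => [|z Z zZ IH]; first by rewrite refs0 => _; apply: br_refl.
rewrite subUset sub1set => /andP[zA ZA]; apply: br_trans (IH ZA).
have o : orth [set z] Z.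
  move=> x y /set1P -> yZ; apply: oA' => //; first exact: (subsetP ZA).
  by move=> e; rewrite e yZ in zZ.
rewrite refsU1 // -[in X in br _ _ X](refK (refs Z u') (f z)).
apply: br_one; first by rewrite Qs_M; case/setDP: zA.
rewrite ref_self refs_orth; first by have := uM' z; lia.
by move=> y; apply: o; rewrite inE.
Qed.

End Tight.

(** * Lifts *)

Section Orbit.
Variables (R : root_frame) (d : rk R).
Local Notation I := (ri R).
Implicit Types (b c g : I) (u v w : I -> int).

Inductive levi_orbit (om : I -> int) : (I -> int) -> Prop :=
| levi_base : levi_orbit om om
| levi_ref u k : levi_orbit om u -> k != d -> levi_orbit om (ref (sr k) u).

Lemma levi_linf om u : linf om -> levi_orbit om u -> linf u.
Proof. by move=> h; elim=> // v k _ IH _; apply: linf_ref. Qed.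

Lemma levi_ge0 om u : linf om -> (forall b, co d b = 1 -> 0 <= om b) ->
  levi_orbit om u -> forall b, co d b = 1 -> 0 <= u b.
Proof.
move=> h h0 hu; elim: hu => // v k hv IH kd b hb.
rewrite -linf_rr; last exact: levi_linf hv.
by apply: IH; rewrite co_rr co_sr eq_sym (negbTE kd) mulr0 subr0.
Qed.

(** Conjugation by a simple reflection reduces to a positive root of coefficient 0 and smaller
    height. *)
Lemma levi_ref_pos om u b : linf om -> levi_orbit om u -> rpos b -> co d b = 0 ->
  levi_orbit om (ref b u).
Proof.
move=> lo; have [n] := ubnP `|ht b|%N; elim: n b u => // n IH b u hn hu pb hb.
have [k [ck hk]] := exists_pos_simple pb.
have kd : k != d by apply: contraTneq ck => ->; rewrite hb.
have [->|bk] := eqVneq b (sr k); first exact: levi_ref.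
set b' := rr (sr k) b.
have eb : b = rr (sr k) b' by rewrite /b' rr_inv.
have lu := levi_linf lo hu.
have -> : ref b u = ref (sr k) (ref b' (ref (sr k) u)).
  rewrite -[in LHS](refK u (sr k)) {1}eb ref_conj //; exact: linf_ref.
apply: levi_ref => //; apply: IH; last first.
- by rewrite /b' co_rr co_sr eq_sym (negbTE kd) mulr0 subr0.
- exact: pos_simple_rr.
- exact: levi_ref.
have pb' : rpos b' by apply: pos_simple_rr.
have := ht_gt0 pb'; have := ht_gt0 pb; rewrite /b' ht_rr ht_sr; clear -hk hn; lia.
Qed.

(** The dominant [om] is fixed by raising at a simple root, so the lifting property takes in one
    simple reflection at a time. *)
Lemma levi_le_top om u : linf om -> (forall b, rpos b -> 0 <= om b) ->
  levi_orbit om u -> br (rpos (R:=R)) u om.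
Proof.
move=> lo o0; elim=> [|v k hv IH kd]; first exact: br_refl.
have lv := levi_linf lo hv.
have [vk|vk] := lerP (v (sr k)) 0.
  rewrite -(raise_le0 vk) -[om in X in br _ _ X](@raise_ge0 _ (sr k)); last exact/o0/pos_sr.
  exact: br_raise (simple_in_pos k) lv IH.
apply: br_trans IH; rewrite -[v in X in br _ _ X](refK v (sr k)).
apply: br_one; first exact: pos_sr.
by rewrite ref_self; lia.
Qed.

End Orbit.

Section Lifts.
Variables (R : root_frame) (d : rk R) (disp : Order.disp_t) (M : finPOrderType disp).
Variable f : M -> ri R.
Hypothesis H : tight_poset d f.
Local Notation I := (ri R).
Implicit Types (x y z : M) (A B l : {set M}) (b c g : I) (u v w : I -> int).
Variable om : I -> int.
Hypotheses (lom : linf om) (om0 : forall b, rpos b -> 0 <= om b).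
Local Notation Y := (levi_orbit d om).
Local Notation QsM := (Qs f).
Local Notation refsM := (refs f).
Local Notation normalized := (normalized d f).

Let Ylin u : Y u -> linf u. Proof. exact: levi_linf. Qed.

Lemma levi_nonnegM u : Y u -> nonnegM f u.
Proof.
move=> hu x; apply: (levi_ge0 lom _ hu); last exact: (tp_d H).
by move=> b hb; apply: om0; apply: (@pos_witness _ _ d); rewrite hb.
Qed.

Lemma normalization l u : Y u -> exists v, [/\ Y v, normalized l v, br (QsM l) u v &
  forall w, linf w -> (forall g, simple_in (QsM l) g -> co d g = 0 -> 0 <= w g) ->
    br (QsM l) u w -> br (QsM l) v w].
Proof.
have [n] := ubnP #|[set b | QsM l b && (u b < 0)]|; elim: n u => // n IH u hn hu.
have lu := Ylin hu.
have [/existsP[g /and3P[hg /eqP gd ug]]|/existsPn ne] :=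
  boolP [exists g, [&& simple_in (QsM l) g, co d g == 0 & u g < 0]]; last first.
  exists u; split=> //; last exact: br_refl.
  by move=> g hg gd; move: (ne g); rewrite hg gd eqxx /= -leNgt.
have /simple_inP[Qg hg'] := hg.
have pg : rpos g by rewrite -(Qs_L H l gd).
have [|v [Yv nv brv hv]] := IH (ref g u) _ (levi_ref_pos lom hu pg gd).
  rewrite ltnS in hn; apply: leq_trans hn.
  have gD : g \in [set b | QsM l b && (u b < 0)] by rewrite inE Qg ug.
  rewrite (cardsD1 g [set b | QsM l b && (u b < 0)]) gD ltnS.
  rewrite -(card_imset _ (@rr_inj R g)); apply: subset_leq_card.
  apply/subsetP => c /imsetP[b]; rewrite inE => /andP[Qb ub] ->.
  have bg : b <> g by move=> e; move: ub; rewrite e ref_self; clear -ug; lia.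
  rewrite !inE linf_rr // ub andbT hg' // andbT; apply/eqP => e.
  have eb : b = ropp g by rewrite /ropp -{2}e rr_inv.
  by move: Qb; rewrite eb (Qs_opp H) Qg.
exists v; split=> //.
  by apply: br_trans brv; apply: br_one => //; apply: ltW.
move=> w lw hw h; apply: hv => //.
rewrite -(raise_le0 (ltW ug)) -[w](@raise_ge0 _ g); last exact: hw.
exact: br_raise.
Qed.

Definition lift (l : nat -> {set M}) m (u : nat -> I -> int) :=
  (forall t, (t <= m)%N -> Y (u t)) /\
  (forall t, (t < m)%N -> br (QsM (l t)) (u t) (refsM (l t.+1 :\: l t) (u t.+1))).

(** The chain is normalized from its last ideal backwards. The first link survives because the next
    functional, carried back, is nonnegative on the simple roots concerned, hence stays above the
    normalization of the first one. *)
Lemma normalize_lift (l : nat -> {set M}) m (u : nat -> I -> int) :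
  (forall t, (t < m)%N -> l t \subset l t.+1 /\ layer (l t) (l t.+1 :\: l t)) ->
  lift l m u -> exists u' : nat -> I -> int,
    [/\ lift l m u', forall t, (t <= m)%N -> normalized (l t) (u' t) &
    br (QsM (l 0)) (u 0) (u' 0)].
Proof.
elim: m l u => [|m IH] l u hl [hY hb].
  have [v [Yv nv brv _]] := normalization (l 0) (hY 0 (leqnn 0)).
  exists (fun=> v); split=> //; last by move=> t; rewrite leqn0 => /eqP ->.
have [||u' [[hY' hb'] nu' br0]] := IH (l \o succn) (u \o succn).
- by move=> t tm; apply: hl.
- by split=> t tm; [apply: hY | apply: hb].
have [sub ly] := hl 0 (ltn0Sn m).
have eU : l 0 :|: (l 1 :\: l 0) = l 1.
  by apply/setP => x; rewrite !inE; case: (boolP (x \in l 0)) => //= /(subsetP sub) ->.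
have lu1 : linf (u 1) by apply/Ylin/hY.
have lu1' : linf (u' 0) by apply/Ylin/hY'.
have [v [Yv nv brv hv]] := normalization (l 0) (hY 0 (leq0n _)).
have st : br (QsM (l 0)) v (refsM (l 1 :\: l 0) (u' 0)).
  apply: hv; first exact: linf_refs.
    move=> g hg gd; apply: (simple_layer_ge0 H ly) => //.
      exact/levi_nonnegM/hY'.
    by rewrite eU; apply: (nu' 0).
  apply: br_trans (hb 0 (ltn0Sn m)) _.
  by apply: (br_refsV H ly lu1); rewrite eU.
exists (fun t => if t is t'.+1 then u' t' else v); split=> //; last by case=> // t /nu'.
split; first by case=> // t /hY'.
by case=> // t /hb'.
Qed.

Lemma slide_lifts (t b : nat -> {set M}) m (u : nat -> I -> int) :
  (forall i, (i < m)%N -> growth_square (b i) (t i) (b i.+1) (t i.+1)) ->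
  lift t m u -> exists u' : nat -> I -> int, lift b m u'.
Proof.
move=> S L; have [|u' [[hY hb] nu _]] := normalize_lift _ L.
  move=> i im; have [_ _ h _] := layer_square (S i im).
  by split; first exact: gs_an (S i im).
exists u'; split=> // i im; apply: (slide_lift H (S i im)).
- exact/Ylin/hY/ltnW.
- exact/levi_nonnegM/hY/ltnW.
- exact/Ylin/hY.
- exact/levi_nonnegM/hY.
- exact: nu.
- exact: hb.
Qed.

(** At the empty ideal a normalized functional of the orbit is dominant, hence equal to [om]. While
    [om] vanishes on [l t] it is dominant there too, so the link forces the next functional to be
    [om] reflected in the next layer. On that layer both [om] and its negative are then
    nonnegative. *)
Lemma lift_from_empty (l : nat -> {set M}) m (u : nat -> I -> int) : l 0 = set0 ->
  (forall t, (t < m)%N -> l t \subset l t.+1 /\ layer (l t) (l t.+1 :\: l t)) ->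
  lift l m u -> forall x, x \in l m -> om (f x) = 0.
Proof.
move=> l0 hl L; have [u' [[hY hb] nu _]] := normalize_lift hl L.
have e0 : u' 0 = om.
  apply: esym; apply: (@br_top _ (rpos (R:=R))); last first.
    by apply: levi_le_top => //; apply: (hY 0).
  have Y0 := hY 0 (leq0n m).
  have N0 k : k != d -> 0 <= u' 0 (sr k).
    move=> kd; apply: (nu 0 (leq0n m)); last by rewrite co_sr eq_sym (negbTE kd).
    by rewrite l0 Qs0; apply: simple_in_pos.
  move=> b pb; have [[x ->]|[x e]|hbd] := tp_cases H b.
  - exact: levi_nonnegM Y0 x.
  - by move: pb; rewrite e pos_opp (tp_pos H).
  - rewrite (Ylin Y0 b); apply: sumr_ge0 => k _.
    have [->|kd] := eqVneq k d; first by rewrite hbd mul0r.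
    by apply: mulr_ge0; [apply/posP | apply: N0].
suff : forall t, (t <= m)%N -> u' t = om /\ forall x, x \in l t -> om (f x) = 0.
  by case/(_ m (leqnn m)).
elim=> [_|t IH tm]; first by split=> // x; rewrite l0 inE.
have [et zt] := IH (ltnW tm); have [sub ly] := hl t tm.
have topt b : QsM (l t) b -> 0 <= om b.
  rewrite /Qs => /orP[/andP[/om0//]|/imsetP[x xl e]].
  by rewrite -[b]oppK e linf_opp // zt.
have e1 := br_top topt (eq_ind _ (fun v => br _ v _) (hb t tm) _ et).
have oA := layer_selforth H ly.
have e2 : u' t.+1 = refsM (l t.+1 :\: l t) om by rewrite -e1 refsK.
have z x : x \in l t.+1 :\: l t -> om (f x) = 0.
  move=> xA; have := levi_nonnegM (hY _ tm) x; rewrite e2 refs_in //.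
  by have := om0 (tp_pos H x); clear; lia.
split=> [|x xl]; last first.
  by have [/zt//|xt] := boolP (x \in l t); apply: z; rewrite inE xt.
rewrite e2; apply: functional_extensionality => b.
by rewrite /refs big1 ?subr0 // => x /z ->; rewrite mulr0.
Qed.

Lemma growth_vanishing (G : nat -> nat -> {set M}) p q ulow :
  (forall i j, (i < p)%N -> (j < q)%N ->
    growth_square (G i j) (G i.+1 j) (G i j.+1) (G i.+1 j.+1)) ->
  (forall j, (j < q)%N -> G p j \subset G p j.+1) ->
  (forall j, (j < q)%N -> layer (G 0 j) (G 0 j.+1 :\: G 0 j) /\ G 0 j \subset G 0 j.+1) ->
  G 0 0 = set0 -> Y ulow ->
  (forall x, x \notin G p 0 -> ulow (f x) = 0) ->
  forall x, x \in G 0 q -> om (f x) = 0.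
Proof.
move=> S sub ly G0 Yl Z.
have L : exists u : nat -> I -> int, lift (G p) q u.
  exists (fun=> ulow); split=> // t tq.
  suff -> : refsM (G p t.+1 :\: G p t) ulow = ulow by apply: br_refl.
  apply: functional_extensionality => b; rewrite /refs big1 ?subr0 // => x.
  rewrite inE => /andP[xt _]; rewrite Z ?mulr0 //.
  apply: contra xt; elim: t tq => // t IH tq x0.
  by apply: (subsetP (sub _ (ltnW tq))); apply: IH x0; apply: ltnW.
have {L} : exists u : nat -> I -> int, lift (G 0) q u.
  elim: p S L {sub Z} => // p IH S L; apply: IH => [i j ip jq|]; first exact: S (ltnW ip) jq.
  case: L => u L; apply: slide_lifts L => j jq; exact: S.
case=> u; apply: lift_from_empty => // t tq; by have [] := ly t tq.
Qed.

End Lifts.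

(** * The doubletree *)

Section BottomTree.
Variables (R : root_frame) (d : rk R) (disp : Order.disp_t) (M : finPOrderType disp).
Variable f : M -> ri R.
Hypothesis H : tight_poset d f.
Implicit Types (x y z b c e : M) (k s : rk R).

Lemma co_le x y k : (x <= y)%O -> co k (f x) <= co k (f y).
Proof.
move/(tp_le H); elim=> // [{}x {}y [g /posP pg h]|{}x {}y z _ h1 _ h2].
  by rewrite h; have := pg k; lia.
exact: le_trans h1 h2.
Qed.

Lemma co_ge0 x k : 0 <= co k (f x).
Proof. exact: (posP _ (tp_pos H x)). Qed.

Lemma rn_simple x k : k != d ->
  rn (sr k) (f x) = rn (f x) (sr k) /\ -1 <= rn (f x) (sr k) <= 1.
Proof.
move=> kd; have hk : co d (sr k) = 0 by rewrite co_sr eq_sym (negbTE kd).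
by have [e h] := rn_L H x hk; rewrite -e.
Qed.

Lemma lower x k : k != d -> 0 < rn (f x) (sr k) ->
  exists2 y, (y < x)%O & forall l, co l (f y) = co l (f x) - (l == k)%:R.
Proof.
move=> kd h; have [e h'] := rn_simple x kd.
have r1 : rn (f x) (sr k) = 1 by lia.
have [y ey] : exists y, f y = rr (sr k) (f x).
  by apply: (tp_onto H); rewrite co_rr co_sr eq_sym (negbTE kd) (tp_d H); lia.
have cy l : co l (f y) = co l (f x) - (l == k)%:R by rewrite ey co_rr r1 mul1r co_sr.
exists y => //; apply: (step_lt H (pos_sr k)) => l.
by rewrite cy co_sr subrK.
Qed.

(** In the expansion of [rn (f x) (f x) = 2] the node [d] contributes at most 1, so another node
    contributes positively. *)
Lemma exists_lower x : f x <> sr d -> exists2 k, k != d & 0 < rn (f x) (sr k).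
Proof.
move=> xd; have [z ez] : exists z, f z = sr d by apply: (tp_onto H); rewrite co_sr eqxx.
case: (pickP [pred k | (k != d) && (0 < rn (f x) (sr k))]) => [k /andP[]|h]; first by exists k.
have : rn (f x) (f x) = 2 by apply: rnaa.
rewrite rn_expand (bigD1 d) //= (tp_d H) -ez.
have [_ h1] : rn (f z) (f x) = rn (f x) (f z) /\ 0 <= rn (f z) (f x) <= 1.
  by apply: (rn_M H) => e; apply: xd; rewrite -ez e.
rewrite mul1r; set S := (\sum_(i | _) _) => e.
suff S0 : S <= 0 by exfalso; move: e h1 S0; clear; lia.
apply: sumr_le0 => k kd; have [-> _] := rn_simple x kd.
apply: mulr_ge0_le0; first exact: co_ge0.
by move: (h k); rewrite /= kd /= leNgt => ->.
Qed.

Lemma strong_ind (P : M -> Prop) :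
  (forall x, (forall y, (y < x)%O -> P y) -> P x) -> forall x, P x.
Proof.
move=> IH x; have [n] := ubnP #|[set z | (z < x)%O]|; elim: n x => // n IHn x hn.
apply: IH => y yx; apply: IHn; rewrite ltnS in hn; apply: leq_trans hn.
apply: proper_card; apply/properP; split.
  by apply/subsetP => z; rewrite !inE => /lt_trans; apply.
by exists y; rewrite !inE ?ltxx.
Qed.

Lemma simple_min x y : f x = sr d -> (x <= y)%O.
Proof.
move=> ex; elim/strong_ind: y => y IH; have [fy|/eqP fy] := eqVneq (f y) (sr d).
  by rewrite (tp_inj H (etrans fy (esym ex))).
have [k kd /(lower kd)[z zy _]] := exists_lower fy.
exact: le_trans (IH z zy) (ltW zy).
Qed.

Definition first_of s x := 0 < co s (f x) /\ forall y, (y < x)%O -> co s (f y) = 0.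

Lemma first_of_spec s x : s != d -> first_of s x ->
  [/\ co s (f x) = 1, rn (f x) (sr s) = 1,
      forall k, k != d -> k != s -> rn (f x) (sr k) <= 0 &
      exists2 y, (y < x)%O & forall l, co l (f y) = co l (f x) - (l == s)%:R].
Proof.
move=> sd [x0 hx].
have xd : f x <> sr d by move=> e; move: x0; rewrite e co_sr (negbTE sd).
have [k kd hk] := exists_lower xd; have [y yx hy] := lower kd hk.
have ks : k = s.
  apply/eqP; apply: contraTT x0 => ks.
  by have := hy s; rewrite (hx _ yx) eq_sym (negbTE ks); clear; lia.
rewrite {}ks in kd hk hy *; split.
- by have := hy s; rewrite (hx _ yx) eqxx; clear; lia.
- by have [_] := rn_simple x kd; clear -hk; lia.
- move=> j jd js; rewrite leNgt; apply/negP => /(lower jd)[z zx hz].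
  by have := hz s; rewrite (hx _ zx) eq_sym (negbTE js); clear -x0; lia.
- by exists y.
Qed.

Lemma first_of_rn s x y : s != d -> first_of s x -> first_of s y -> x <> y ->
  rn (f x) (f y) = 1.
Proof.
move=> sd fx fy xy; have [e h] := rn_M H xy.
have [_ xs _ _] := first_of_spec sd fx; have [_ _ _ [z zy hz]] := first_of_spec sd fy.
have zx : z <> x by move=> e'; move: (fx.1); rewrite -e' fy.2.
have [_ h'] := rn_M H zx; have [es _] := rn_simple x sd.
have : rn (f y) (f x) = rn (f z) (f x) + rn (sr s) (f x).
  by apply: rn_add => k; rewrite hz co_sr subrK.
by rewrite es xs -e; clear -h h'; lia.
Qed.

(** Two such roots pair to 1, so one difference, say of [a] and [b], is a positive root; it pairs to
    2 - 1 = 1 with [a]. But its coefficients at [d] and [s] are 0, and [a] pairs nonpositively with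
    all other simple roots. *)
Lemma first_of_uniq s x y : s != d -> first_of s x -> first_of s y -> x = y.
Proof.
move=> sd; suff main a b : first_of s a -> first_of s b -> a <> b -> ~ rpos (rr (f b) (f a)).
  move=> fx fy; apply/eqP; apply: contraT => /eqP xy.
  have := main _ _ fx fy xy; have := main _ _ fy fx (nesym xy).
  have r1 := first_of_rn sd fx fy xy; have r2 := first_of_rn sd fy fx (nesym xy).
  have -> : rr (f x) (f y) = ropp (rr (f y) (f x)).
    by apply: co_inj => k; rewrite co_opp !co_rr r1 r2; clear; lia.
  by rewrite pos_opp; case: (rpos _) => // _ /(_ isT).
move=> fa fb ab /posP pg; have r1 := first_of_rn sd fa fb ab.
have [ca _ la _] := first_of_spec sd fa; have [cb _ _ _] := first_of_spec sd fb.
have : rn (rr (f b) (f a)) (f a) = 1.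
  by rewrite rn_rrl rnaa r1 (first_of_rn sd fb fa (nesym ab)).
rewrite rn_expand; suff : \sum_k co k (rr (f b) (f a)) * rn (sr k) (f a) <= 0.
  by move=> h e; move: h; rewrite e.
apply: sumr_le0 => k _.
have [->|kd] := eqVneq k d; first by rewrite co_rr r1 !(tp_d H) subrr mul0r.
have [->|ks] := eqVneq k s; first by rewrite co_rr r1 ca cb subrr mul0r.
apply: mulr_ge0_le0 => //; have [-> _] := rn_simple a kd; exact: la.
Qed.

Lemma exists_first_of s x : 0 < co s (f x) -> exists2 e, first_of s e & (e <= x)%O.
Proof.
elim/strong_ind: x => x IH hx.
have [/existsP[y /andP[yx cy]]|/existsPn h] := boolP [exists y, (y < x)%O && (0 < co s (f y))].
  by have [e he ey] := IH y yx cy; exists e => //; apply: le_trans ey (ltW yx).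
exists x => //; split=> // y yx; move: (h y) (co_ge0 y s); rewrite yx /=; clear; lia.
Qed.

Lemma first_of_le s e x : s != d -> first_of s e -> (0 < co s (f x)) = (e <= x)%O.
Proof.
move=> sd he; apply/idP/idP => [/exists_first_of[e' he' /le_trans]|ex].
  by rewrite (first_of_uniq sd he he'); apply.
exact: lt_le_trans he.1 (co_le s ex).
Qed.

(** Below [x] is a chain, so exactly one simple root [s] can be subtracted from [f x], giving [f c].
    If the element [e] where [s] first appears were strictly below [x], it would lie below [c],
    which by induction is the first element for another node [j]. *)
Lemma bottom_tree_first x : x \in bottom_tree M ->
  f x = sr d \/ exists2 s, s != d & first_of s x.
Proof.
elim/strong_ind: x => x IH xB.
have comp y z : (y <= x)%O -> (z <= x)%O -> (y >=< z)%O.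
  move=> yx zx; move: xB; rewrite inE => /forall_inP/(_ y); rewrite inE => /(_ yx).
  by move=> /forall_inP/(_ z); rewrite inE; apply.
have [/eqP|/eqP xd] := boolP (f x == sr d); [by left | right].
have [s sd hs] := exists_lower xd; have [c cx hc] := lower sd hs.
have [es bs] := rn_simple x sd; have rs : rn (f x) (sr s) = 1 by clear -hs bs; lia.
have others k : k != d -> k != s -> rn (f x) (sr k) <= 0.
  move=> kd ks; rewrite leNgt; apply/negP => /(lower kd)[c' c'x hc'].
  have /orP[le|le] := comp _ _ (ltW cx) (ltW c'x).
    by have := co_le k le; rewrite hc hc' eqxx (negbTE ks); clear; lia.
  by have := co_le s le; rewrite hc hc' eqxx eq_sym (negbTE ks); clear; lia.
have cs : 0 < co s (f x) by have := co_ge0 c s; rewrite hc eqxx; clear; lia.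
have [e he] := exists_first_of cs; rewrite le_eqVlt => /orP[/eqP <-|ex]; first by exists s.
have ec : (e <= c)%O.
  have /orP[//|ce] := comp _ _ (ltW ex) (ltW cx).
  have heq k : k != s -> co k (f e) = co k (f x).
    by move=> ks; have := co_le k (ltW ex); have := co_le k ce; rewrite hc (negbTE ks); clear; lia.
  have := co_le s (ltW ex); have := co_le s ce; rewrite hc eqxx => h1 h2.
  have [h|h] : co s (f e) = co s (f x) \/ co s (f e) = co s (f x) - 1 by clear -h1 h2; lia.
    have e' : f e = f x by apply: co_inj => k; have [->|/heq] := eqVneq k s.
    by move: ex; rewrite (tp_inj H e') ltxx.
  have e' : f e = f c.
    apply: co_inj => k; rewrite hc; have [->|ks] := eqVneq k s; first by rewrite h.
    by rewrite heq // subr0.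
  by rewrite (tp_inj H e').
have cB : c \in bottom_tree M.
  rewrite inE; apply/forall_inP => y; rewrite inE => yc; apply/forall_inP => z.
  by rewrite inE => zc; apply: comp; [apply: le_trans yc (ltW cx) | apply: le_trans zc (ltW cx)].
have ce : 0 < co s (f c) by rewrite (first_of_le _ sd he).
case: (IH c cx cB) => [cd|[j jd hj]].
  by move: ce; rewrite cd co_sr (negbTE sd).
have [cj rj lj _] := first_of_spec jd hj.
have [es1 rs1 _ [h he1 hh]] := first_of_spec sd he.
have rcs : rn (f c) (sr s) = -1.
  have : rn (f x) (sr s) = rn (f c) (sr s) + rn (sr s) (sr s).
    by apply: rn_add => k; rewrite hc co_sr subrK.
  by rewrite rnaa rs; clear; lia.
have js : j != s by apply/eqP => e'; move: rj; rewrite e' rcs.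
have hs0 : co s (f h) = 0 by rewrite hh es1 eqxx subrr.
have hc' : h <> c by move=> e'; move: ce; rewrite -e' hs0.
have [_ hhc] := rn_M H hc'.
(* With [f h = f e - sr s], the difference of [f c] and [f h] pairs with [f c] to at least 2 - 1. In
   its expansion [s] contributes at most -1, [j] at most 1, and the other nodes nothing positive. *)
suff : \sum_k (co k (f c) - co k (f h)) * rn (sr k) (f c) <= 0.
  have -> : \sum_k (co k (f c) - co k (f h)) * rn (sr k) (f c) = rn (f c) (f c) - rn (f h) (f c).
    rewrite (rn_expand (f c)) (rn_expand (f h)) -sumrB.
    by apply: eq_bigr => k _; rewrite mulrBl.
  by rewrite rnaa; move: hhc; clear; lia.
rewrite (bigD1 s) // (bigD1 j) //=.
have [-> _] := rn_simple c sd; have [-> _] := rn_simple c jd.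
rewrite rcs rj cj hs0 subr0 mulr1 mulrN1 addrA.
set S := (\sum_(i | _) _); suff S0 : S <= 0.
  by have := co_ge0 h j; move: ce S0; clear; lia.
apply: sumr_le0 => k /andP[ks kj].
have [->|kd] := eqVneq k d; first by rewrite !(tp_d H) subrr mul0r.
apply: mulr_ge0_le0.
  by rewrite subr_ge0; apply: co_le; apply: le_trans (ltW he1) ec.
by have [-> _] := rn_simple c kd; apply: lj.
Qed.

Lemma bottom_tree_support x : x \in bottom_tree M ->
  exists s, forall y, (0 < co s (f y)) = (x <= y)%O.
Proof.
case/bottom_tree_first => [xd|[s sd hs]]; last by exists s => y; apply: first_of_le.
by exists d => y; rewrite (tp_d H) simple_min.
Qed.

End BottomTree.

(** * The longest element of the Levi Weyl group *)

Section Levi.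
Variables (R : root_frame) (d : rk R).
Local Notation I := (ri R).
Implicit Types (a b c : I) (u : I -> int) (g gi : I -> I).

(** Pairs of mutually inverse elements of the parabolic Weyl group omitting [d]. *)
Inductive levi : (I -> I) -> (I -> I) -> Prop :=
| levi_id : levi id id
| levi_mul g gi k : levi g gi -> k != d -> levi (rr (sr k) \o g) (gi \o rr (sr k)).

Section Element.
Variables (g gi : I -> I).
Hypothesis hg : levi g gi.

Lemma levi_gK : cancel g gi.
Proof. by elim: hg => // g' gi' k _ IH _ b; rewrite /= rr_inv. Qed.

Lemma levi_giK : cancel gi g.
Proof. by elim: hg => // g' gi' k _ IH _ b; rewrite /= IH rr_inv. Qed.

Lemma levi_rr a b : gi (rr a b) = rr (gi a) (gi b).
Proof.
by elim: hg a b => // g' gi' k _ IH _ a b /=; rewrite -rr_conj IH.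
Qed.

Lemma levi_rn a b : rn (gi a) (gi b) = rn a b.
Proof. by elim: hg a b => // g' gi' k _ IH _ a b /=; rewrite IH rn_rr. Qed.

Lemma levi_cod b : co d (gi b) = co d b.
Proof.
elim: hg b => // g' gi' k _ IH kd b /=; rewrite IH co_rr co_sr eq_sym (negbTE kd).
by rewrite mulr0 subr0.
Qed.

Lemma linf_levi u : linf u -> linf (u \o gi).
Proof.
move=> lu; elim: hg => // g' gi' k _ IH _.
have -> : u \o (gi' \o rr (sr k)) = ref (sr k) (u \o gi'); last exact: linf_ref.
by apply: functional_extensionality => b /=; rewrite -[RHS]linf_rr.
Qed.

Lemma linf_leviV u : linf u -> linf (u \o g).
Proof.
elim: hg u => // g' gi' k _ IH _ u lu.
have -> : u \o (rr (sr k) \o g') = (ref (sr k) u) \o g'; last exact/IH/linf_ref.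
by apply: functional_extensionality => b /=; rewrite linf_rr.
Qed.

Lemma levi_orbit_gi u : linf u -> levi_orbit d u (u \o gi).
Proof.
move=> lu.
suff : linf (u \o gi) /\ levi_orbit d u (u \o gi) by case.
elim: hg => [|g' gi' k _ [l IH] kd]; first by split=> //; apply: levi_base.
have -> : u \o (gi' \o rr (sr k)) = ref (sr k) (u \o gi').
  by apply: functional_extensionality => b /=; rewrite -[RHS]linf_rr.
by split; [apply: linf_ref | apply: levi_ref].
Qed.

End Element.

(** Multiply by simple reflections as long as some simple root of the Levi stays positive; the
    number of positive Levi roots kept positive decreases. *)
Lemma exists_longest : exists g gi, levi g gi /\
  forall b, co d b = 0 -> rpos (gi b) = ~~ rpos b.
Proof.
pose N (gi : I -> I) := #|[set b | [&& rpos b, co d b == 0 & rpos (gi b)]]|.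
have [g [gi [hg hk]]] : exists g gi, levi g gi /\ forall k, k != d -> ~~ rpos (gi (sr k)).
  suff main n : forall g gi, levi g gi -> (N gi < n)%N ->
      exists g gi, levi g gi /\ forall k, k != d -> ~~ rpos (gi (sr k)).
    exact: (main _ _ _ levi_id (ltnSn _)).
  elim: n => // n IH g gi hg hn.
  have [/existsP[k /andP[kd pk]]|/existsPn h] := boolP [exists k, (k != d) && rpos (gi (sr k))];
    last by exists g, gi; split=> // k kd; move: (h k); rewrite kd.
  apply: (IH _ _ (levi_mul hg kd)); rewrite ltnS in hn; apply: leq_trans hn.
  have kD : sr k \in [set b | [&& rpos b, co d b == 0 & rpos (gi b)]].
    by rewrite inE pos_sr pk co_sr [d == k]eq_sym (negbTE kd).
  rewrite /N (cardsD1 (sr k) [set b | [&& rpos b, co d b == 0 & rpos (gi b)]]) kD ltnS.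
  rewrite -(card_imset _ (@rr_inj R (sr k))); apply: subset_leq_card.
  apply/subsetP => c /imsetP[b]; rewrite inE => /and3P[pb /eqP bd /= pgb] ->.
  have bk : b != sr k.
    apply: contraTneq pgb => ->; rewrite -[rr _ _]/(ropp (sr k)) /ropp (levi_rr hg).
    by rewrite -[rr _ _]/(ropp (gi (sr k))) pos_opp pk.
  rewrite !inE pos_simple_rr // co_rr bd co_sr [d == k]eq_sym (negbTE kd) mulr0 subr0 eqxx pgb !andbT.
  apply: contraNneq bk => e; exfalso.
  have eb : b = ropp (sr k) by rewrite -[b](rr_inv (sr k)) e.
  by move: pb; rewrite eb pos_opp pos_sr.
exists g, gi; split=> // b bd.
have neg c : co d c = 0 -> rpos c -> ~~ rpos (gi c).
  move=> cd /posP pc; rewrite -pos_opp; apply/posP => j; rewrite co_opp oppr_ge0.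
  rewrite -[co j (gi c)]/((co j \o gi) c) (linf_levi hg (linf_co j) c); apply: sumr_le0 => k _.
  have [->|kd] := eqVneq k d; first by rewrite cd mul0r.
  apply: mulr_ge0_le0 => //=; have := hk k kd; rewrite -pos_opp => /posP/(_ j).
  by rewrite co_opp oppr_ge0.
have [pb|pb] := boolP (rpos b); first exact/negbTE/neg.
have : ~~ rpos (gi (ropp b)) by apply: neg; rewrite ?co_opp ?bd // pos_opp.
by rewrite /ropp (levi_rr hg) -/(ropp (gi b)) pos_opp negbK.
Qed.

End Levi.

(** * The twisted frame and the dual poset *)

Section Twist.
Variables (R : root_frame) (d : rk R) (g gi : ri R -> ri R).
Hypothesis hg : levi d g gi.

(** The roots are the same and the base is moved by [g]. For the longest [g] the roots of
    coefficient 0 change sign while the coefficient at [d] is kept, which reverses the order of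
    [M]. *)
Definition twist : root_frame.
Proof.
refine (@RootFrame (ri R) (rk R) (g \o @sr R) (@rn R) (@rr R) (fun k b => co k (gi b))
  _ _ (@rn_rr R) (@rnaa R) (@rn_gt0_sym R) (@rn_eq0_sym R) _ _ _ _).
- by move=> a b h; apply: (can_inj (levi_giK hg)); apply: co_inj.
- by move=> k a b; rewrite (levi_rr hg) co_rr (levi_rn hg).
- by move=> k l; rewrite /= (levi_gK hg) co_sr.
- by move=> a; apply: co_sign.
- move=> a k h; have [e|e] := co_reduced h; [left | right].
    by rewrite -[a](levi_giK hg) e.
  apply: (can_inj (levi_giK hg)).
  by rewrite /= (levi_rr hg) (levi_gK hg) e.
- move=> b a; rewrite -(levi_rn hg) rn_expand; apply: eq_bigr => k _.
  by rewrite -[in RHS](levi_rn hg) /= (levi_gK hg).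
Defined.

Lemma twist_linf u : linf (R:=R) u -> linf (R:=twist) u.
Proof.
move=> lu b; rewrite -{1}[b](levi_giK hg) -[LHS]/((u \o g) (gi b)).
exact: (linf_leviV hg lu).
Qed.

Lemma twist_add (a b c : ri R) :
  (forall k, co (r:=twist) k a = co (r:=twist) k b + co (r:=twist) k c) <->
  (forall k, co k a = co k b + co k c).
Proof.
have add (S : root_frame) (a' b' c' : ri S) u : linf u ->
    (forall k, co k a' = co k b' + co k c') -> u a' = u b' + u c'.
  move=> lu h; rewrite !(lu _) -big_split; apply: eq_bigr => k _.
  by rewrite h mulrDl.
split=> h k.
  exact: (add twist a b c _ (twist_linf (linf_co k)) h).
pose k' : rk R := k.
exact: (add R a b c (co k' \o gi) (linf_levi hg (linf_co k')) h).
Qed.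

Variables (disp : Order.disp_t) (M : finPOrderType disp) (f : M -> ri R).
Hypothesis H : tight_poset d f.
Hypothesis hneg : forall b, co d b = 0 -> rpos (gi b) = ~~ rpos b.

Lemma twist_step x y : frame_step (R:=twist) f x y <-> frame_step f y x.
Proof.
have d0 b x' y' : (forall k, co k (f y') = co k (f x') + co k b) -> co d b = 0.
  by move/(_ d); rewrite !(tp_d H); lia.
split=> -[b pb hb].
  move/twist_add in hb; have b0 := d0 _ _ _ hb.
  exists (ropp b); last by move=> k; rewrite co_opp hb; lia.
  by rewrite pos_opp -hneg.
have b0 := d0 _ _ _ hb.
exists (ropp b); last by apply/twist_add => k; rewrite co_opp hb; lia.
rewrite -[rpos _]/(rpos (R:=R) (gi (ropp b))) hneg ?pos_opp ?negbK //.
by rewrite co_opp b0.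
Qed.

Lemma twist_tight : @tight_poset twist d _ M^d f.
Proof.
have opE (b : ri R) : ropp (R:=twist) b = ropp b by [].
split.
- by move=> b; rewrite /= (levi_cod hg); apply: (tp_co H).
- exact: (tp_inj H).
- by move=> b; rewrite /= (levi_cod hg); apply: (tp_onto H).
- by move=> x; rewrite /= (levi_cod hg); apply: (tp_d H).
- exact: (tp_sl H).
move=> x y; rewrite -[(x <= y)%O]/(y <= x :> M)%O; split=> [/(tp_le H)|h].
  elim=> [a b st|a|a b c _ h1 _ h2]; [apply: rt_step; exact/twist_step | exact: rt_refl |].
  exact: rt_trans h2 h1.
apply/(tp_le H); elim: h => [a b /twist_step st|a|a b c _ h1 _ h2];
  [exact: rt_step | exact: rt_refl | exact: rt_trans h2 h1].
Qed.

(** In the twisted frame [co s] and [co s \o gi] exchange the roles of dominant and starting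
    functional, so the converse implication concerns the same pair. *)
Lemma twist_orbit u : linf u -> levi_orbit (R:=twist) d (u \o gi) u.
Proof.
move=> lu; have lT := twist_linf (linf_levi hg lu).
suff main h hi : levi d h hi -> forall v, linf v ->
    levi_orbit (R:=twist) d (u \o gi) (v \o hi) -> levi_orbit (R:=twist) d (u \o gi) v.
  by apply: (main _ _ hg u lu); apply: levi_base.
elim=> // h' hi' k hh IH kd v lv Y; apply: IH => //.
have e : ref (sr k) (v \o (hi' \o rr (sr k))) = v \o hi'.
  have lh := linf_levi hh lv.
  rewrite -[RHS](refK _ (sr k)); congr ref; apply: functional_extensionality => b.
  by rewrite /= -linf_rr.
rewrite -e.
have kd0 : co (r:=twist) d (sr k) = 0 by rewrite /= (levi_cod hg) co_sr eq_sym (negbTE kd).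
have [p|np] := boolP (rpos (R:=twist) (sr k)).
  exact: (@levi_ref_pos twist d (u \o gi) _ (sr k) lT Y p kd0).
have := @levi_ref_pos twist d (u \o gi) _ (ropp (R:=twist) (sr k)) lT Y.
rewrite pos_opp np co_opp kd0 oppr0 => /(_ isT erefl).
by rewrite ref_opp //; apply: levi_linf Y.
Qed.

End Twist.

(** * Promotion on tight posets *)

Section TightPromotion.
Variables (R : root_frame) (d : rk R) (disp : Order.disp_t) (M : finPOrderType disp).
Variable f : M -> ri R.
Hypothesis H : tight_poset d f.
Variables g gi : ri R -> ri R.
Hypothesis hg : levi d g gi.
Hypothesis hneg : forall b, co d b = 0 -> rpos (gi b) = ~~ rpos b.
Implicit Types (x y z : M) (s : rk R) (T : {ffun M -> nat}).

Lemma growth_vanishing_iff s (G : nat -> nat -> {set M}) p q :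
  (forall i j, (i < p)%N -> (j < q)%N ->
    growth_square (G i j) (G i.+1 j) (G i j.+1) (G i.+1 j.+1)) ->
  (forall i j, (i <= p)%N -> (j < q)%N -> [/\ is_ideal (G i j), is_ideal (G i j.+1),
     G i j \subset G i j.+1 & is_antichain (G i j.+1 :\: G i j)]) ->
  G 0 0 = set0 -> G p q = setT ->
  (forall x, x \notin G p 0 -> co s (gi (f x)) = 0) <->
  (forall x, x \in G 0 q -> co s (f x) = 0).
Proof.
move=> S rows G0 Gpq.
have ly disp' (P : finPOrderType disp') (A B : {set P}) :
    is_ideal A -> is_ideal B -> is_antichain (B :\: A) -> layer A (B :\: A).
  move=> iA iB ha; split=> // x xD; case/setDP: (xD) => xt xs; split=> // z zx.
  apply: contraT => zs; have := ha z x; rewrite zx inE zs xD (iB _ _ (ltW zx) xt).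
  by move=> /(_ isT isT).
split=> Z.
  apply: (growth_vanishing H (om := co s) _ _ S) Z => //.
  - exact: linf_co.
  - by move=> b /posP.
  - by move=> j jq; have [_ _] := rows p j (leqnn p) jq.
  - move=> j jq; have [iA iB sub ha] := rows 0%N j (leq0n p) jq; split=> //; exact: ly.
  - exact: levi_orbit_gi hg _ (linf_co s).
(* Complements with both indices reversed: the full corner becomes the empty one. *)
pose G' i j : {set M^d} := ~: G (p - i)%N (q - j)%N.
suff K (x : M^d) : x \in G' 0%N q -> co (r:=twist hg) s (f x) = 0.
  by move=> x xG; apply: K; rewrite inE subn0 subnn.
apply: (@growth_vanishing (twist hg) d _ M^d f (twist_tight hg H hneg)
  (co (r:=twist hg) s) _ _ G' p q (co s)).
- exact: linf_co.
- by move=> b /posP.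
- move=> i j ip jq; rewrite /G'.
  have -> : (p - i = (p - i.+1).+1)%N by lia.
  have -> : (q - j = (q - j.+1).+1)%N by lia.
  apply: growth_squareC; apply: growth_square_dual; apply: S; lia.
- move=> j jq; rewrite /G'; have -> : (q - j = (q - j.+1).+1)%N by lia.
  have jq' : (q - j.+1 < q)%N by lia.
  have [_ _ sub _] := rows 0%N _ (leq0n p) jq'.
  by rewrite subnn; apply/subsetP => z; rewrite !inE; apply: contra; apply: (subsetP sub).
- move=> j jq; rewrite /G'; have -> : (q - j = (q - j.+1).+1)%N by lia.
  have jq' : (q - j.+1 < q)%N by lia.
  have [iA iB sub ha] := rows p _ (leqnn p) jq'; rewrite subn0; split; last first.
    by apply/subsetP => z; rewrite !inE; apply: contra; apply: (subsetP sub).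
  apply: ly; try exact: is_ideal_dual.
  have eD z : z \in ~: G p (q - j.+1)%N :\: ~: G p (q - j.+1).+1 ->
      z \in G p (q - j.+1).+1 :\: G p (q - j.+1)%N by rewrite !inE negbK andbC.
  by move=> y z /eD yA /eD zA; apply: (ha z y zA yA).
- by rewrite /G' !subn0 Gpq setCT.
- exact: twist_orbit (linf_co s).
- by move=> x'; rewrite inE negbK subn0 subnn; apply: Z.
Qed.

Section Tableau.
Variable q : nat.
Hypothesis q0 : (0 < q)%N.

(** The second equivalence is read off the transposed rectangle, which again consists of growth
    squares. *)
Lemma growth_rect_vanishing T s j : increasing_tableau q T -> (j <= q)%N ->
  ((forall x, (j < T x)%N -> co s (gi (f x)) = 0) <->
   (forall x, (iter j (Kpromotion q) T x <= q - j)%N -> co s (f x) = 0)) /\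
  ((forall x, (q - j < iter j (Kpromotion q) T x)%N -> co s (gi (f x)) = 0) <->
   (forall x, (T x <= j)%N -> co s (f x) = 0)).
Proof.
move=> hT jq; set U := iter j _ T.
have hI i := iter_Kpromotion_increasing i q0 hT.
pose G := growth_rect q T j.
have Gsq i c : (i < j)%N -> (c < q - j)%N ->
    growth_square (G i c) (G i.+1 c) (G i c.+1) (G i.+1 c.+1).
  exact: growth_rect_square.
have rows i c : [/\ is_ideal (G i c), is_ideal (G i c.+1),
    G i c \subset G i c.+1 & is_antichain (G i c.+1 :\: G i c)].
  split; rewrite /G /growth_rect; [exact: sublevel_ideal (hI _) _ | exact: sublevel_ideal (hI _) _ | |].
  - by apply: sublevel_sub; rewrite addSn.
  - by rewrite addSn; apply: sublevel_antichain (hI _) _.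
have G0 : G 0%N 0%N = set0 by rewrite /G /growth_rect (sublevel0 (hI _)).
have Gq : G j (q - j)%N = setT.
  by rewrite /G /growth_rect subnK // (sublevel_height (hI _)).
have GT x : (x \in G j 0%N) = (T x <= j)%N by rewrite inE subnn add0n.
have GU x : (x \in G 0%N (q - j)%N) = (U x <= q - j)%N by rewrite inE subn0 addn0.
split.
  have := growth_vanishing_iff s Gsq (fun i c _ _ => rows i c) G0 Gq.
  have -> : (forall x, x \notin G j 0%N -> co s (gi (f x)) = 0) <->
            (forall x, (j < T x)%N -> co s (gi (f x)) = 0).
    by split=> Z x; have := Z x; rewrite GT -ltnNge.
  have -> // : (forall x, x \in G 0%N (q - j)%N -> co s (f x) = 0) <->
            (forall x, (U x <= q - j)%N -> co s (f x) = 0).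
  by split=> Z x; have := Z x; rewrite GU.
have cols i c : (i <= q - j)%N -> (c < j)%N -> [/\ is_ideal (G c i), is_ideal (G c.+1 i),
    G c i \subset G c.+1 i & is_antichain (G c.+1 i :\: G c i)].
  move=> iq cj; rewrite /G /growth_rect; have -> : (j - c = (j - c.+1).+1)%N by lia.
  have [|h1 h2] := @Kpromotion_column _ _ q _ (hI (j - c.+1)%N) q0 (i + c)%N; first by lia.
  by rewrite addnS; split=> //;
    [exact: sublevel_ideal (hI (j - c.+1).+1) _ | exact: sublevel_ideal (hI _) _].
have Gsq' i c : (i < q - j)%N -> (c < j)%N ->
    growth_square (G c i) (G c i.+1) (G c.+1 i) (G c.+1 i.+1).
  by move=> ic cj; apply: growth_squareC; apply: Gsq.
have := @growth_vanishing_iff s (fun i c => G c i) (q - j) j Gsq' cols G0 Gq.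
have -> : (forall x, x \notin G 0%N (q - j)%N -> co s (gi (f x)) = 0) <->
          (forall x, (q - j < U x)%N -> co s (gi (f x)) = 0).
  by split=> Z x; have := Z x; rewrite GU -ltnNge.
have -> // : (forall x, x \in G j 0%N -> co s (f x) = 0) <->
          (forall x, (T x <= j)%N -> co s (f x) = 0).
by split=> Z x; have := Z x; rewrite GT.
Qed.

Lemma promotion_support T s j : increasing_tableau q T -> (j <= q)%N ->
  ((forall x, (T x <= j)%N -> co s (f x) = 0) <->
   (forall x, (iter q (Kpromotion q) T x <= j)%N -> co s (f x) = 0)) /\
  ((forall x, (j < T x)%N -> co s (gi (f x)) = 0) <->
   (forall x, (j < iter q (Kpromotion q) T x)%N -> co s (gi (f x)) = 0)).
Proof.
move=> hT jq; have [h1 h2] := growth_rect_vanishing s hT jq.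
have hT' := iter_Kpromotion_increasing j q0 hT.
have [h3 h4] := growth_rect_vanishing s hT' (leq_subr j q).
rewrite -iterD subnK // subKn // in h3 h4.
split; first exact: iff_trans (iff_sym h2) h3.
exact: iff_trans h1 (iff_sym h4).
Qed.

Theorem tight_promotion T : increasing_tableau q T ->
  {in doubletree M, forall x, T x = iter q (Kpromotion q) T x}.
Proof.
move=> hT x; set U := iter q _ T.
have hU := iter_Kpromotion_increasing q q0 hT.
have Tq := tableau_le hT x; have Uq := tableau_le hU x.
have key : (forall j, (j <= q)%N -> (j < T x)%N <-> (j < U x)%N) -> T x = U x.
  move=> h; apply/eqP; rewrite eqn_leq; apply/andP; split; rewrite leqNgt; apply/negP => lt.
    by have /(h (U x) Uq) := lt; rewrite ltnn.
  by have /(h (T x) Tq) := lt; rewrite ltnn.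
rewrite inE => /orP[xB|xT]; apply: key => j jq.
  have [s hs] := bottom_tree_support H xB.
  (* [x] is the least element with [s] in its support, so [co s] vanishes on an ideal exactly when
     the ideal misses [x]. *)
  have eqv (V : {ffun M -> nat}) : increasing_tableau q V ->
      (forall y, (V y <= j)%N -> co s (f y) = 0) <-> (j < V x)%N.
    move=> hV; split=> [Z|Vx y yj].
      by rewrite ltnNge; apply/negP => /Z e; have := hs x; rewrite e lexx.
    apply/eqP; apply: contraT => c0; have : (x <= y)%O.
      by rewrite -hs lt_neqAle eq_sym c0; apply: co_ge0 H _ _.
    rewrite le_eqVlt => /orP[/eqP e|xy]; first by move: yj; rewrite -e leqNgt Vx.
    by have := hV.2 _ _ xy; clear -yj Vx; lia.
  have [h _] := promotion_support s hT jq.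
  exact: iff_trans (iff_sym (eqv T hT)) (iff_trans h (eqv U hU)).
(* The top tree is the bottom tree of the dual poset, to be read in the twisted frame. *)
have xB : x \in @bottom_tree _ M^d.
  move: xT; rewrite !inE => /forall_inP h; apply/forall_inP => y; rewrite inE => xy.
  apply/forall_inP => z; rewrite inE => xz; have := h y; rewrite inE => /(_ xy) /forall_inP hy.
  by have := hy z; rewrite inE => /(_ xz); rewrite /Order.comparable orbC.
have [s hs] : exists s : rk R, forall y, (0 < co s (gi (f y))) = (y <= x)%O.
  by have [s hs] := bottom_tree_support (twist_tight hg H hneg) xB; exists s => y; apply: hs.
have nn y : 0 <= co s (gi (f y)) by exact: (co_ge0 (twist_tight hg H hneg) y s).
have eqv (V : {ffun M -> nat}) : increasing_tableau q V ->
    (forall y, (j < V y)%N -> co s (gi (f y)) = 0) <-> ~ (j < V x)%N.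
  move=> hV; split=> [Z /Z e|/negP Vx y yj].
    by have := hs x; rewrite /= e lexx.
  apply/eqP; apply: contraT => c0; have : (y <= x)%O.
    by have := hs y; rewrite /= lt_neqAle eq_sym c0 nn => /esym.
  rewrite le_eqVlt => /orP[/eqP e|xy]; first by move: Vx; rewrite -e yj.
  by have := hV.2 _ _ xy; clear -yj Vx; lia.
have [_ h] := promotion_support s hT jq.
have {}h := iff_trans (iff_sym (eqv T hT)) (iff_trans h (eqv U hU)).
by case: (j < T x)%N h; case: (j < U x)%N => // -[h1 h2]; split=> //; [case: h2 | case: h1].
Qed.

End Tableau.
End TightPromotion.

(** * Root frames of root data *)

Section FrameNorm.
Variable R : root_frame.
Implicit Types (a b c : ri R) (k l : rk R).

(** The Weyl-invariant form summed over all coroots; it compares root lengths without an ambient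
    Euclidean space. *)
Definition iform a c : int := \sum_b rn a b * rn c b.
Definition nrm a := iform a a.

Lemma iformC a c : iform a c = iform c a.
Proof. by apply: eq_bigr => b _; rewrite mulrC. Qed.

Lemma iform_rr c a b : iform (rr c a) (rr c b) = iform a b.
Proof.
rewrite /iform (reindex_inj (@rr_inj R c)) /=.
by apply: eq_bigr => e _; rewrite !rn_rr.
Qed.

Lemma nrm_rr c a : nrm (rr c a) = nrm a.
Proof. exact: iform_rr. Qed.

Lemma nrm_gt0 a : 0 < nrm a.
Proof.
rewrite /nrm /iform (bigD1 a) //= rnaa; apply: ltr_wpDr => //.
by apply: sumr_ge0 => b _; rewrite -expr2 sqr_ge0.
Qed.

Lemma iform2 a b : 2 * iform a b = rn a b * nrm b.
Proof.
have h : iform (rr b a) (rr b b) = - iform a b + rn a b * nrm b.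
  rewrite /nrm /iform mulr_sumr -sumrN -big_split /=; apply: eq_bigr => c _.
  by rewrite rn_rrl rn_oppl; ring.
rewrite iform_rr in h.
by rewrite mulr2n mulrDl mul1r {1}h addrAC addNr add0r.
Qed.

Lemma rn_nrm a b : rn a b * nrm b = rn b a * nrm a.
Proof. by rewrite -!iform2 iformC. Qed.

Lemma rn_simple_le0 k l : k != l -> rn (sr k) (sr l) <= 0.
Proof.
move=> kl; have := co_sign (rr (sr l) (sr k)).
move=> [] h; have := h k; have := h l; rewrite !co_rr !co_sr !eqxx (negbTE kl) eq_sym (negbTE kl);
  by lia.
Qed.

Lemma iform_simple_le0 k l : k != l -> iform (sr k) (sr l) <= 0.
Proof.
move=> kl; have := iform2 (sr k) (sr l); have := rn_simple_le0 kl.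
have := nrm_gt0 (sr l); nia.
Qed.

(** Take a root [b] of maximal height among those supported where [m] is nonzero. Every simple root
    there pairs nonnegatively with it, so the vanishing sum vanishes term by term, which would make
    [rn b b] zero. *)
Lemma null_nonneg (m : rk R -> int) : (forall k, 0 <= m k) ->
  (forall b, \sum_k m k * rn (sr k) b = 0) -> forall k, m k = 0.
Proof.
move=> m0 hm k; apply/eqP; apply: contraT => mk.
pose S b := [forall l, (m l == 0) ==> (co l b == 0)].
have Sk : S (sr k).
  apply/forallP => l; apply/implyP => ml; rewrite co_sr; case: (l =P k) => // e.
  by move: mk; rewrite -e ml.
have [b Sb hb] := @arg_maxP _ _ _ (sr k) S (@ht R) Sk.
have pl l : m l != 0 -> 0 <= rn (sr l) b.
  move=> ml; rewrite leNgt; apply/negP => /rn_lt0_sym lt.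
  have : ht (rr (sr l) b) <= ht b.
    apply: hb; apply/forallP => j; apply/implyP => mj; rewrite co_rr co_sr.
    have /forallP/(_ j) := Sb; rewrite mj /= => /eqP ->; case: (j =P l) => [e|]; last by rewrite mulr0.
    by move: ml; rewrite -e mj.
  by rewrite ht_rr ht_sr; lia.
have z l : m l * rn (sr l) b = 0.
  have ge j : 0 <= m j * rn (sr j) b.
    by have [->|/pl h] := eqVneq (m j) 0; [rewrite mul0r | apply: mulr_ge0].
  have /eqP := hm b; rewrite psumr_eq0 => [/allP/(_ l)|//].
  by rewrite mem_index_enum => /(_ isT)/eqP.
have := rnaa b; rewrite rn_expand big1 // => l _.
have [ml|ml] := eqVneq (m l) 0.
  by have /forallP/(_ l) := Sb; rewrite ml eqxx /= => /eqP ->; rewrite mul0r.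
by have /eqP := z l; rewrite mulf_eq0 (negbTE ml) /= => /eqP ->; rewrite mulr0.
Qed.

(** Nondegeneracy of the pairing on the root lattice. If [p] and [q] are the positive and negative
    parts of [m], the squared length of [p] equals its product with [q], which involves only
    products of distinct simple roots and is at most 0. *)
Lemma null_vector (m : rk R -> int) :
  (forall b, \sum_k m k * rn (sr k) b = 0) -> forall k, m k = 0.
Proof.
move=> hm.
pose p k : int := Num.max (m k) 0; pose q k : int := Num.max (- m k) 0.
have mpq k : m k = p k - q k by rewrite /p /q; lia.
have p0 k : 0 <= p k by rewrite /p; lia.
have q0 k : 0 <= q k by rewrite /q; lia.
have pq k : p k * q k = 0.
  by rewrite /p /q; case: (lerP (m k) 0) => h; rewrite ?mul0r // max_r ?mulr0 //; lia.
have e b : \sum_k p k * rn (sr k) b = \sum_k q k * rn (sr k) b.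
  apply/eqP; rewrite -subr_eq0 -sumrB; apply/eqP; rewrite -[RHS](hm b); apply: eq_bigr => k _.
  by rewrite mpq mulrBl.
have le0 : \sum_b (\sum_k p k * rn (sr k) b) ^+ 2 <= 0.
  have -> : \sum_b (\sum_k p k * rn (sr k) b) ^+ 2 =
      \sum_k \sum_l p k * q l * iform (sr k) (sr l).
    under eq_bigr => b _ do rewrite expr2 {2}e big_distrlr /=.
    rewrite exchange_big /=; apply: eq_bigr => k _.
    rewrite exchange_big /=; apply: eq_bigr => l _.
    by rewrite /iform mulr_sumr; apply: eq_bigr => b _; ring.
  apply: sumr_le0 => k _; apply: sumr_le0 => l _.
  have [->|kl] := eqVneq k l; first by rewrite pq mul0r.
  by apply: mulr_ge0_le0; [apply: mulr_ge0 | apply: iform_simple_le0].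
have z b : \sum_k p k * rn (sr k) b = 0.
  have ge (c : ri R) : true -> 0 <= (\sum_k p k * rn (sr k) c) ^+ 2 by rewrite sqr_ge0.
  have : \sum_b (\sum_k p k * rn (sr k) b) ^+ 2 == 0 by rewrite eq_le le0 sumr_ge0.
  rewrite psumr_eq0 // => /allP/(_ b); rewrite mem_index_enum sqrf_eq0.
  by move/(_ isT)/eqP.
move=> k; rewrite mpq (null_nonneg p0 z) (null_nonneg q0) ?subr0 // => b.
by rewrite -e.
Qed.

(** The coroot of [a] is proportional to [a / nrm a], so its coefficient at [d] is
    [co d a * nrm (sr d) / nrm a]. This natural number is positive and at most 1. *)
Lemma coroot_coefficient d a (c : rk R -> nat) :
  (forall x, rn x a = \sum_k (c k)%:Z * rn x (sr k)) -> (c d <= 1)%N -> 0 < co d a ->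
  nrm a = co d a * nrm (sr d).
Proof.
move=> hc cd ad.
(* [Q b] plays the part of [P / nrm b], which keeps the comparison of the two expansions
   integral. *)
pose P := \prod_b nrm b; pose Q b := \prod_(e | e != b) nrm e.
have PQ b : P = nrm b * Q b by rewrite /P (bigD1 b).
have P0 : 0 < P by apply: prodr_gt0 => b _; apply: nrm_gt0.
have h : Q a * co d a - (c d)%:Z * Q (sr d) = 0.
  apply: (@null_vector (fun k => Q a * co k a - (c k)%:Z * Q (sr k))) => b.
  have : nrm b * \sum_k (Q a * co k a - (c k)%:Z * Q (sr k)) * rn (sr k) b = 0; last first.
    by move/eqP; rewrite mulf_eq0 gt_eqF ?nrm_gt0 //= => /eqP.
  have -> : \sum_k (Q a * co k a - (c k)%:Z * Q (sr k)) * rn (sr k) b =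
      Q a * rn a b - \sum_k (c k)%:Z * Q (sr k) * rn (sr k) b.
    rewrite (rn_expand a b) mulr_sumr -sumrB; apply: eq_bigr => k _; ring.
  rewrite mulrBr; have -> : nrm b * (Q a * rn a b) = P * rn b a.
    by rewrite (PQ a) mulrCA -[nrm b * _]mulrC rn_nrm; ring.
  rewrite hc !mulr_sumr -sumrB big1 // => k _.
  have -> : nrm b * ((c k)%:Z * Q (sr k) * rn (sr k) b) =
    (c k)%:Z * Q (sr k) * (rn (sr k) b * nrm b) by ring.
  by rewrite rn_nrm (PQ (sr k)); ring.
have e : P * (co d a * nrm (sr d)) = P * ((c d)%:Z * nrm a).
  rewrite {1}(PQ a) (PQ (sr d)).
  have -> : nrm a * Q a * (co d a * nrm (sr d)) = nrm a * nrm (sr d) * (Q a * co d a) by ring.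
  have -> : Q a * co d a = (c d)%:Z * Q (sr d) by move: h => /eqP; rewrite subr_eq0 => /eqP.
  ring.
have e2 : co d a * nrm (sr d) = (c d)%:Z * nrm a by apply: (mulfI (lt0r_neq0 P0)).
have n1 := nrm_gt0 a; have n2 := nrm_gt0 (sr d).
have c1 : c d = 1%N.
  by case: (c d) cd e2 => [|[|//]] _; rewrite // mul0r => /eqP; rewrite mulf_eq0 !gt_eqF.
by rewrite e2 c1 mul1r.
Qed.

End FrameNorm.

(** What is kept of the minuscule condition is [mf_nrm]: the squared length is proportional to the
    coefficient at [d]. *)
Record minuscule_frame (R : root_frame) (d : rk R) (disp : Order.disp_t)
    (M : finPOrderType disp) (f : M -> ri R) : Prop := MinusculeFrame {
  mf_inj : injective f;
  mf_onto : forall b, 0 < co d b -> exists x, f x = b;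
  mf_d : forall x, 0 < co d (f x);
  mf_nrm : forall b, 0 < co d b -> nrm b = co d b * nrm (sr d);
  mf_le : forall x y : M, (x <= y)%O <-> clos_refl_trans M (frame_step f) x y }.

(** * The root frame of a based root datum *)

Section Datum.
Variable D : based_root_datum.
Local Notation I := (rd_idx D).
Implicit Types (a b c g : I) (x y : 'rV[int]_(rd_rank D)).

Definition dn b a : int := pairing (rd_root b) (rd_coroot a).

Lemma pairingBl n (x x' : 'rV[int]_n) (y : 'cV[int]_n) :
  pairing (x - x') y = pairing x y - pairing x' y.
Proof. by rewrite /pairing mulmxBl !mxE. Qed.

Lemma pairingZl n k (x : 'rV[int]_n) (y : 'cV[int]_n) : pairing (k *: x) y = k * pairing x y.
Proof. by rewrite /pairing -scalemxAl mxE. Qed.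

Lemma pairingBr n (x : 'rV[int]_n) (y y' : 'cV[int]_n) :
  pairing x (y - y') = pairing x y - pairing x y'.
Proof. by rewrite /pairing mulmxBr !mxE. Qed.

Lemma pairingZr n k (x : 'rV[int]_n) (y : 'cV[int]_n) : pairing x (k *: y) = k * pairing x y.
Proof. by rewrite /pairing -scalemxAr mxE. Qed.

Lemma pairing_suml n (J : finType) (F : J -> 'rV[int]_n) (y : 'cV[int]_n) :
  pairing (\sum_j F j) y = \sum_j pairing (F j) y.
Proof. by rewrite /pairing mulmx_suml summxE. Qed.

Definition dr a b : I :=
  odflt b [pick g | rd_root g == rd_root b - dn b a *: rd_root a].

Lemma root_dr a b : rd_root (dr a b) = rd_root b - dn b a *: rd_root a.
Proof.
rewrite /dr; case: pickP => [g /eqP //|h].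
by have [g e] := reflection_root a b; move: (h g); rewrite /= e eqxx.
Qed.

(** The datum reflects coroots independently of roots, so this index is not known to be [dr a c]. As
    for [dr], the default value is never reached. *)
Definition dcr a c : I :=
  odflt c [pick g | rd_coroot g == rd_coroot c - dn a c *: rd_coroot a].

Lemma coroot_dcr a c : rd_coroot (dcr a c) = rd_coroot c - dn a c *: rd_coroot a.
Proof.
rewrite /dcr; case: pickP => [g /eqP //|h].
by have [g e] := reflection_coroot a c; move: (h g); rewrite /= e eqxx.
Qed.

Lemma dnaa a : dn a a = 2. Proof. exact: pairing_root_coroot. Qed.

Lemma dcrK a : involutive (dcr a).
Proof.
move=> c; apply: rd_coroot_inj; rewrite !coroot_dcr /dn coroot_dcr pairingBr pairingZr.
rewrite pairing_root_coroot; set k := pairing _ _.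
have -> : k - dn a c * 2 = - k by rewrite /k /dn; ring.
by rewrite scaleNr opprK subrK.
Qed.

Definition vform x y : int :=
  \sum_c pairing x (rd_coroot c) * pairing y (rd_coroot c).

Definition vr a x := x - pairing x (rd_coroot a) *: rd_root a.

Lemma pairing_vr a x c : pairing (vr a x) (rd_coroot c) = pairing x (rd_coroot (dcr a c)).
Proof.
by rewrite coroot_dcr pairingBl pairingBr pairingZl pairingZr -/(dn a c) mulrC.
Qed.

Lemma vform_vr a x y : vform (vr a x) (vr a y) = vform x y.
Proof.
rewrite [RHS](reindex_inj (inv_inj (dcrK a))) /=.
by apply: eq_bigr => c _; rewrite !pairing_vr.
Qed.

Lemma vr_vr a x : vr a (vr a x) = x.
Proof.
rewrite /vr pairingBl pairingZl pairing_root_coroot; set k := pairing _ _.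
have -> : k - k * 2 = - k by ring.
by rewrite scaleNr opprK subrK.
Qed.

Lemma vr_root a b : vr a (rd_root b) = rd_root (dr a b).
Proof. by rewrite root_dr. Qed.

Lemma vform_root x a : 2 * vform x (rd_root a) =
  pairing x (rd_coroot a) * vform (rd_root a) (rd_root a).
Proof.
have h : vform (vr a x) (vr a (rd_root a)) =
    - vform x (rd_root a) + pairing x (rd_coroot a) * vform (rd_root a) (rd_root a).
  rewrite /vform mulr_sumr -sumrN -big_split /=; apply: eq_bigr => c _.
  by rewrite /vr !pairingBl !pairingZl pairing_root_coroot; ring.
rewrite vform_vr in h.
by rewrite mulr2n mulrDl mul1r {1}h addrAC addNr add0r.
Qed.

Lemma vform_gt0 a : 0 < vform (rd_root a) (rd_root a).
Proof.
rewrite /vform (bigD1 a) //= pairing_root_coroot; apply: ltr_wpDr => //.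
by apply: sumr_ge0 => b _; rewrite -expr2 sqr_ge0.
Qed.

(** By [vform_root] the invariant form determines the coroot of a root through its pairings, which
    ties the coroot of a reflected root to the reflected coroot. *)
Lemma pairing_dr a b x :
  pairing x (rd_coroot (dr a b)) = pairing (vr a x) (rd_coroot b).
Proof.
have g0 := vform_gt0 b.
have e : vform (rd_root (dr a b)) (rd_root (dr a b)) = vform (rd_root b) (rd_root b).
  by rewrite -vr_root vform_vr.
apply: (mulIf (lt0r_neq0 g0)); rewrite -[in LHS]e -!vform_root.
by rewrite -[x in vform x _](vr_vr a) -vr_root vform_vr.
Qed.

Lemma dn_dr a b c : dn (dr c b) (dr c a) = dn b a.
Proof. by rewrite /dn pairing_dr -vr_root vr_vr. Qed.

Lemma dn_sym a b : dn a b * vform (rd_root b) (rd_root b) = dn b a * vform (rd_root a) (rd_root a).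
Proof.
by rewrite /dn -!vform_root; congr (_ * _); apply: eq_bigr => c _; rewrite mulrC.
Qed.

Notation SK := 'I_#|simples D|.
Definition dsr (k : SK) : I := enum_val k.

Lemma simple_expansion : exists co : I -> SK -> int, forall a,
  rd_root a = \sum_k co a k *: rd_root (dsr k) /\
  ((forall k, 0 <= co a k) \/ (forall k, co a k <= 0)).
Proof.
suff h a : exists co : SK -> int, rd_root a = \sum_k co k *: rd_root (dsr k) /\
    ((forall k, 0 <= co k) \/ (forall k, co k <= 0)).
  by have [co hco] := fin_all_exists h; exists co.
have [c hc] := simples_span a.
have e : \sum_(s in simples D) rd_root s *+ c s = \sum_k (c (dsr k))%:Z *: rd_root (dsr k).
  by rewrite big_enum_val; apply: eq_bigr => k _; rewrite -scaler_nat natz.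
case: hc => ->; rewrite e; [exists (fun k => (c (dsr k))%:Z) | exists (fun k => - (c (dsr k))%:Z)].
  by split=> //; left.
split; last by right=> k; rewrite oppr_le0.
by rewrite -sumrN; apply: eq_bigr => k _; rewrite scaleNr.
Qed.

Lemma simple_uniq (c : SK -> int) :
  \sum_k c k *: rd_root (dsr k) = 0 -> forall k, c k = 0.
Proof.
move=> h k; pose c' s := \sum_(l | dsr l == s) c l.
have c'E l : c' (dsr l) = c l.
  rewrite /c' (eq_bigl (pred1 l)) ?big_pred1_eq // => j /=.
  by rewrite (inj_eq enum_val_inj).
rewrite -c'E; apply: simples_free (enum_valP k).
by rewrite big_enum_val -[RHS]h; apply: eq_bigr => l _; rewrite c'E.
Qed.

Section WithCo.
Variable co0 : I -> SK -> int.
Hypothesis hco : forall a,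
  rd_root a = \sum_k co0 a k *: rd_root (dsr k) /\
  ((forall k, 0 <= co0 a k) \/ (forall k, co0 a k <= 0)).

Lemma co0_uniq a (c : SK -> int) :
  rd_root a = \sum_k c k *: rd_root (dsr k) -> forall k, co0 a k = c k.
Proof.
move=> h k; apply/eqP; rewrite -subr_eq0; apply/eqP.
apply: (@simple_uniq (fun k => co0 a k - c k)).
under eq_bigr do rewrite scalerBl.
by rewrite sumrB -h -(hco a).1 subrr.
Qed.

Definition datum_frame : root_frame.
Proof.
refine (@RootFrame I SK dsr dn dr (fun k a => co0 a k) _ _ dn_dr dnaa _ _ _ _ _ _).
- by move=> a b h; apply: rd_root_inj; rewrite (hco a).1 (hco b).1; apply: eq_bigr => k _; rewrite h.
- move=> k a b; apply: (@co0_uniq _ (fun k => co0 b k - dn b a * co0 a k)).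
  rewrite root_dr (hco b).1 [in X in _ *: X](hco a).1 scaler_sumr -sumrB.
  by apply: eq_bigr => l _; rewrite scalerBl scalerA.
- move=> a b; have := dn_sym a b; have := vform_gt0 a; have := vform_gt0 b.
  by move=> h1 h2 e h; rewrite -(pmulr_lgt0 _ h2) -e pmulr_lgt0.
- move=> a b; have := dn_sym a b; have := vform_gt0 a.
  by move=> h1 e h; apply: (mulIf (lt0r_neq0 h1)); rewrite -e h !mul0r.
- move=> k l; apply: (@co0_uniq _ (fun k => (k == l)%:R)).
  rewrite (bigD1 l) //= eqxx scale1r big1 ?addr0 // => j jl.
  by rewrite (negbTE jl) scale0r.
- by move=> a; apply: (hco a).2.
- move=> a k h; have ea : rd_root a = co0 a k *: rd_root (dsr k).
    rewrite {1}(hco a).1 (bigD1 k) //= big1 ?addr0 // => j jk.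
    by rewrite h // scale0r.
  have [] := @reduced D (dsr k) a (co0 a k) 1.
  + apply/eqP => z; have := dnaa a; rewrite /dn {1}ea z scale0r.
    by rewrite /pairing mul0mx mxE.
  + by rewrite scale1r.
  + by move/rd_root_inj; left.
  + move=> e; right; apply: rd_root_inj.
    by rewrite e root_dr dnaa scaler_nat mulr2n opprD addrA subrr add0r.
- move=> b a; rewrite {1}/dn (hco b).1 pairing_suml; apply: eq_bigr => k _.
  by rewrite pairingZl.
Defined.

Lemma datum_positive a : positive_root a <-> rpos (R:=datum_frame) a.
Proof.
split=> [[c hc]|/posP h].
  apply/posP => k /=; rewrite (@co0_uniq a (fun k => (c (dsr k))%:Z)) //.
  by rewrite hc big_enum_val; apply: eq_bigr => l _; rewrite -scaler_nat natz.
exists (fun s => `|(\sum_(k | dsr k == s) co0 a k)%R|%N).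
rewrite /root_expansion {1}(hco a).1 [RHS]big_enum_val; apply: eq_bigr => k _.
rewrite -scaler_nat; congr (_ *: _).
rewrite (eq_bigl (pred1 k)) ?big_pred1_eq => [|j /=]; last by rewrite (inj_eq enum_val_inj).
by have := h k; rewrite /= natz; lia.
Qed.

Lemma datum_co a (c : I -> nat) k : root_expansion a c -> co0 a k = c (dsr k).
Proof.
move=> hc; rewrite (@co0_uniq a (fun k => (c (dsr k))%:Z)) //.
by rewrite hc big_enum_val; apply: eq_bigr => l _; rewrite -scaler_nat natz.
Qed.

End WithCo.
End Datum.

Lemma minuscule_poset_frame (disp : Order.disp_t) (M : finPOrderType disp) :
  minuscule_poset M -> exists (R : root_frame) (d : rk R) (f : M -> ri R), minuscule_frame d f.
Proof.
case=> D [d [[dS hd] [f [hf hle]]]].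
have [co0 hco] := simple_expansion D.
pose R := datum_frame hco.
have [k ek] : exists k : 'I_#|simples D|, dsr k = d.
  by exists (enum_rank_in dS d); rewrite /dsr enum_rankK_in.
have inM a : in_minuscule_poset d a <-> 0 < co (r:=R) (k : rk R) a.
  split=> [[c hc cd]|ck].
    by rewrite /= (datum_co hco k hc) ek; lia.
  have /datum_positive [c hc] : rpos (R:=R) a by apply: pos_witness ck.
  exists c => //; move: ck; rewrite /= (datum_co hco k hc) ek; lia.
exists R, k, f; split.
- move=> x y e; apply: le_anti; apply/andP; split; apply/hle; rewrite e; exact: rt_refl.
- by move=> b /inM/hf.
- by move=> x; apply/inM/hf; exists x.
- move=> b kb; have /datum_positive pb : rpos (R:=R) b by apply: pos_witness kb.
  have [c hc cd] := hd b pb.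
  apply: (@coroot_coefficient R k b (fun l => c (dsr l))) => //; last by rewrite ek.
  move=> x; rewrite /= /dn hc big_enum_val /pairing mulmx_sumr summxE.
  by apply: eq_bigr => l _; rewrite -scaler_nat natz -scalemxAr mxE.
move=> x y; rewrite hle.
(* An upward step keeps the coefficient at [d] positive, so a path of roots that starts in [M] never
   leaves it. *)
have st a b : root_step a b -> 0 < co (r:=R) k a ->
    0 < co (r:=R) k b /\ forall x' y', f x' = a -> f y' = b -> frame_step (R:=R) f x' y'.
  case=> pa pb [g pg hg] ka.
  have e j : co (r:=R) j b = co (r:=R) j a + co (r:=R) j g.
    apply: (@co0_uniq D co0 hco b (fun l => co0 a l + co0 g l)).
    rewrite -[rd_root b](subrK (rd_root a)) hg (hco a).1 (hco g).1 addrC.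
    by rewrite -big_split; apply: eq_bigr => l _; rewrite scalerDl.
  have /posP pg' : rpos (R:=R) g by apply/datum_positive.
  split; first by rewrite e; have := pg' k; lia.
  move=> x' y' ex ey; exists g; first exact/posP.
  by move=> j; rewrite ex ey.
split=> [h|].
  suff main a b : root_le a b -> forall x' , f x' = a -> exists2 y', f y' = b &
      clos_refl_trans M (frame_step (R:=R) f) x' y'.
    have [y' ey cl] := main _ _ h x erefl.
    suff -> : y = y' by [].
    apply: le_anti; apply/andP; split; apply/hle; rewrite ey; exact: rt_refl.
  elim=> [{}a {}b s x' ex|{}a x' ex|{}a {}b c _ IH1 _ IH2 x' ex].
  - have ka : 0 < co (r:=R) k a by apply/inM/hf; exists x'.
    have [kb fs] := st _ _ s ka; have /inM/hf [y' ey] := kb.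
    by exists y' => //; apply: rt_step; apply: fs.
  - by exists x' => //; apply: rt_refl.
  - have [y' ey c1] := IH1 x' ex; have [z' ez c2] := IH2 y' ey.
    by exists z' => //; apply: rt_trans c1 c2.
elim=> [{}x {}y [g pg h]|{}x|{}x {}y z _ h1 _ h2]; [|exact: rt_refl|exact: rt_trans h1 h2].
have px z : rpos (R:=R) (f z) by apply: (@pos_witness R _ k); apply/inM/hf; exists z.
apply: rt_step; split; try exact/datum_positive/px.
exists g; first exact/datum_positive.
rewrite (hco (f y)).1 (hco (f x)).1 (hco g).1 -sumrB; apply: eq_bigr => l _.
by rewrite -scalerBl -[co0 (f y) l]/(co (r:=R) l (f y)) h addrC addKr.
Qed.

(** * Roots with coefficient 1 and 2 *)

Section Cases.
Variables (R : root_frame) (d : rk R).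
Implicit Types (a b c e l : ri R) (k j : rk R).

Lemma co_sr_neq (k l : rk R) : k != l -> co k (sr (r:=R) l) = 0.
Proof. by move=> kl; rewrite co_sr (negbTE kl). Qed.

(** The squared length of [a - b] is then 0. *)
Lemma rn_eq2 a b : rn a b = 2 -> rn b a = 2 -> a = b.
Proof.
move=> h1 h2; have := rn_nrm a b; rewrite h1 h2 => e.
have {}e : nrm a = nrm b by clear -e; lia.
have z c : rn a c - rn b c = 0.
  have ge (x : ri R) : true -> 0 <= (rn a x - rn b x) ^+ 2 by rewrite sqr_ge0.
  have : \sum_x (rn a x - rn b x) ^+ 2 == 0.
    have -> : \sum_x (rn a x - rn b x) ^+ 2 = nrm a + nrm b - 2 * iform a b.
      rewrite /nrm /iform mulr_sumr -big_split -sumrB /=.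
      by apply: eq_bigr => x _; ring.
    by rewrite iform2 h1 e; apply/eqP; ring.
  rewrite psumr_eq0 // => /allP/(_ c); rewrite mem_index_enum sqrf_eq0.
  by move/(_ isT)/eqP.
apply: co_inj => k; apply/eqP; rewrite -subr_eq0; apply/eqP.
apply: (@null_vector R (fun k => co k a - co k b)) => c.
rewrite -[RHS](z c) (rn_expand a) (rn_expand b) -sumrB.
by apply: eq_bigr => j _; rewrite mulrBl.
Qed.

Hypothesis Hn : forall b, 0 < co d b -> nrm b = co d b * nrm (sr d).
Local Notation h := (co d).

Let N0 : 0 < nrm (sr d). Proof. exact: nrm_gt0. Qed.

Lemma h_rn a b : 0 < h a -> 0 < h b -> rn a b * h b = rn b a * h a.
Proof.
move=> ha hb; have := rn_nrm a b; rewrite (Hn ha) (Hn hb) !mulrA.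
exact: (mulIf (lt0r_neq0 N0)).
Qed.

(** Reflections preserve length, and length determines a positive coefficient at [d]. *)
Lemma h_rr a b : 0 < h a -> h (rr b a) = 0 \/ h (rr b a) = h a \/ h (rr b a) = - h a.
Proof.
move=> ha; have e : nrm (rr b a) = h a * nrm (sr d) by rewrite nrm_rr Hn.
case: (ltrgtP (h (rr b a)) 0) => [lt|gt|]; [right; right|right; left|by left].
  have gt : 0 < h (ropp (rr b a)) by rewrite co_opp; lia.
  have := Hn gt; rewrite [nrm (ropp _)]nrm_rr e co_opp => /(mulIf (lt0r_neq0 N0)) ->.
  by rewrite opprK.
by have := Hn gt; rewrite e => /(mulIf (lt0r_neq0 N0)).
Qed.

Lemma rn_range a b : 0 < h a -> 0 < h b -> 0 <= rn a b <= 2.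
Proof.
move=> ha hb; have := h_rn ha hb; have := h_rr b ha; have := h_rr a hb.
rewrite !co_rr => h1 h2 e.
have {}h1 : rn b a * h a = 0 \/ rn b a * h a = h b \/ rn b a * h a = 2 * h b by lia.
rewrite -e in h1.
case: h1 => [|[|]] h1.
- by have -> : rn a b = 0 by apply: (mulIf (lt0r_neq0 hb)); rewrite h1 mul0r.
- by have -> : rn a b = 1 by apply: (mulIf (lt0r_neq0 hb)); rewrite h1 mul1r.
- by have -> : rn a b = 2 by apply: (mulIf (lt0r_neq0 hb)).
Qed.

Lemma rn_levi a b : 0 < h a -> h b = 0 ->
  [\/ rn b a = 0 /\ rn a b = 0, 0 < rn b a /\ rn a b = 1 | rn b a < 0 /\ rn a b = -1].
Proof.
move=> ha hb; have hr : h (rr a b) = - rn b a * h a by rewrite co_rr hb; ring.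
have n0 : 0 < nrm b := nrm_gt0 b.
have e := rn_nrm a b; rewrite (Hn ha) in e.
case: (ltrgtP (rn b a) 0) => [lt|gt|z]; last by apply: Or31; split=> //; apply: rn_eq0_sym.
- apply: Or33; split=> //; have p : 0 < h (rr a b) by rewrite hr pmulr_lgt0 // oppr_gt0.
  have := Hn p; rewrite nrm_rr hr => e2.
  apply: (mulIf (lt0r_neq0 n0)); rewrite e e2; ring.
- apply: Or32; split=> //.
  have p : 0 < h (ropp (rr a b)) by rewrite co_opp hr mulNr opprK pmulr_lgt0.
  have := Hn p; rewrite [nrm (ropp _)]nrm_rr nrm_rr co_opp hr => e2.
  apply: (mulIf (lt0r_neq0 n0)); rewrite e e2; ring.
Qed.

Lemma tight_of_short (disp : Order.disp_t) (M : finPOrderType disp) (f : M -> ri R) :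
  minuscule_frame d f -> (forall b, 0 < h b -> h b = 1) -> tight_poset d f.
Proof.
move=> [fi fo fd _ fle] h1; have fd1 x : h (f x) = 1 by apply: h1.
have hb b : -1 <= h b <= 1.
  have [c|c|c] := ltrgtP (h b) 0; last by rewrite c.
    by have := h1 (ropp b); rewrite co_opp oppr_gt0 => /(_ c); clear; lia.
  by rewrite h1.
split=> //; first by move=> b hb1; apply: fo; rewrite hb1.
have MM x y : f y <> f x -> rn (f y) (f x) = rn (f x) (f y) /\ 0 <= rn (f y) (f x) <= 1.
  move=> ne; have := h_rn (fd y) (fd x); rewrite !fd1 !mulr1 => e; split=> //.
  have := rn_range (fd y) (fd x) => r.
  have n2 : rn (f y) (f x) <> 2 by move=> e2; apply: ne; apply: rn_eq2; rewrite -?e.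
  by move: r n2; clear; lia.
move=> x b bx bx'; case: (ltrgtP (h b) 0) => c.
- have [y ey] : exists y, f y = ropp b by apply: fo; rewrite co_opp; lia.
  have [|e r] := MM x y; first by rewrite ey => e; apply: bx'; rewrite -e oppK.
  by move: e r; rewrite ey rn_oppl rn_oppr; clear; lia.
- have [y ey] := fo b c; have [|e r] := MM x y; first by rewrite ey.
  by move: e r; rewrite ey; clear; lia.
have := hb (rr (f x) b); rewrite co_rr c fd1 => r.
by case: (rn_levi (fd x) c); move: r; clear; lia.
Qed.

(** Descent by height-lowering simple reflections, which fix the coefficient at [d]; the base case
    is a lowest root of an orbit of the Levi Weyl group. *)
Lemma low_ind (P : ri R -> Prop) :
  (forall a, 0 < h a -> (forall k, k != d -> rn a (sr k) <= 0) -> P a) ->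
  (forall a k, 0 < h a -> k != d -> 0 < rn a (sr k) -> P (rr (sr k) a) -> P a) ->
  forall a, 0 < h a -> P a.
Proof.
move=> H1 H2 a; have [n] := ubnP `|ht a|%N; elim: n a => // n IH a hn ha.
have [/existsP[k /andP[kd hk]]|/existsPn low] := boolP [exists k, (k != d) && (0 < rn a (sr k))];
  last by apply: H1 => // k kd; move: (low k); rewrite kd /= -leNgt.
have ha' : 0 < h (rr (sr k) a) by rewrite co_rr co_sr_neq 1?eq_sym // mulr0 subr0.
apply: (H2 _ k) => //; apply: IH => //.
have := ht_gt0 (pos_witness ha); have := ht_gt0 (pos_witness ha').
by rewrite ht_rr ht_sr; move: hn hk; clear; lia.
Qed.

Lemma h_simple a k : k != d -> h (rr (sr k) a) = h a.
Proof. by move=> kd; rewrite co_rr co_sr_neq 1?eq_sym // mulr0 subr0. Qed.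

Lemma hd1 : h (sr d) = 1. Proof. by rewrite co_sr eqxx. Qed.
Lemma hd0 : 0 < h (sr d). Proof. by rewrite hd1. Qed.

(** In the expansion of [rn a a = 2] only [d] contributes positively, so [rn (sr d) a] is 1 or 2. By
    [h_rn] the value 1 makes [a] long and the value 2 makes it equal to [sr d]. *)
Lemma low_cases a : 0 < h a -> (forall k, k != d -> rn a (sr k) <= 0) ->
  a = sr d \/ [/\ h a = 2, rn a (sr d) = 2 & rn (sr d) a = 1].
Proof.
move=> ha low; have pa := pos_witness ha; have := rnaa a.
rewrite rn_expand (bigD1 d) //=; set S := (\sum_(_ | _) _) => e.
have S0 : S <= 0.
  apply: sumr_le0 => k kd; apply: mulr_ge0_le0; first exact/posP.
  by rewrite leNgt; apply/negP => /rn_gt0_sym; have := low k kd; clear; lia.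
have := rn_range ha hd0; have := rn_range hd0 ha; have := h_rn ha hd0.
rewrite hd1 mulr1 => e1 r1 r2.
have [z|[z|z]] : rn (sr d) a = 0 \/ rn (sr d) a = 1 \/ rn (sr d) a = 2 by move: r1; clear; lia.
- by move: e S0; rewrite z; clear; lia.
- right; rewrite z in e e1 *; split=> //; move: e e1 S0 r2; clear; lia.
- left; apply: rn_eq2 => //; rewrite z in e1; move: e1 r2 ha; clear; lia.
Qed.

Lemma h_le2 a : 0 < h a -> h a = 1 \/ h a = 2.
Proof.
move=> ha; elim/low_ind: a / ha => [a ha low|a k _ kd _]; last by rewrite h_simple.
by case: (low_cases ha low) => [->|[-> _ _]]; [left; apply: hd1 | right].
Qed.

Definition short a := h a = 1.
Definition long a := h a = 2.

Lemma short_gt0 a : short a -> 0 < h a. Proof. by move=> ->. Qed.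
Lemma long_gt0 a : long a -> 0 < h a. Proof. by move=> ->. Qed.

Lemma short_short a b : short a -> short b ->
  rn a b = rn b a /\ [\/ rn a b = 0, rn a b = 1 | a = b].
Proof.
move=> sa sb; have := h_rn (short_gt0 sa) (short_gt0 sb).
rewrite sa sb !mulr1 => e; split=> //.
have := rn_range (short_gt0 sa) (short_gt0 sb) => r.
have [z|[z|z]] : rn a b = 0 \/ rn a b = 1 \/ rn a b = 2 by move: r; clear; lia.
- exact: Or31.
- exact: Or32.
- by apply: Or33; apply: rn_eq2; rewrite -?e.
Qed.

Lemma long_short l a : long l -> short a ->
  (rn l a = 0 /\ rn a l = 0) \/ (rn l a = 2 /\ rn a l = 1).
Proof.
move=> ll sa; have := h_rn (long_gt0 ll) (short_gt0 sa); rewrite ll sa.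
have := rn_range (long_gt0 ll) (short_gt0 sa); clear; lia.
Qed.

Lemma long_sub l a : long l -> short a -> rn l a = 2 ->
  exists2 b, short b & forall k, co k l = co k a + co k b.
Proof.
move=> ll sa r; have [[]|[_ r']] := long_short ll sa; first by rewrite r.
exists (ropp (rr l a)); first by rewrite /short co_opp co_rr r' ll sa.
by move=> k; rewrite co_opp co_rr r'; clear; lia.
Qed.

(** If [l] paired to 2 with [a] and to 0 with [b], then [l - a] would be a root of coefficient 1
    pairing to -1 with [b]. *)
Lemma nonorth_support a b l : short a -> short b -> long l -> rn a b = 1 -> rn l a = rn l b.
Proof.
suff main a' b' : short a' -> short b' -> long l -> rn a' b' = 1 -> rn l a' = 2 -> rn l b' <> 0.
  move=> sa sb ll r; have [rs _] := short_short sa sb.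
  have [[x y]|[x y]] := long_short ll sa; have [[x' y']|[x' y']] := long_short ll sb;
    rewrite ?x ?x' //.
    by case: (main b a) => //; rewrite -rs.
  by case: (main a b).
move=> sa sb ll r r2 z; have [c sc hc] := long_sub ll sa r2.
have := rn_add b' hc; have := rn_range (short_gt0 sc) (short_gt0 sb).
by rewrite z r; clear; lia.
Qed.

Lemma orth_support a b l : short a -> short b -> long l -> rn l a = 2 -> rn l b = 2 ->
  rn a b = 0 -> forall k, co k l = co k a + co k b.
Proof.
move=> sa sb ll ra rb o; have [c sc hc] := long_sub ll sa ra.
have := rn_add b hc; rewrite rb o add0r => e.
have [ec _] := short_short sc sb; suff <- : c = b by [].
by apply: rn_eq2; rewrite -?ec.
Qed.

(** * Sums of orthogonal short roots *)

Section Long.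
Variable l1 : ri R.
Hypothesis ll1 : long l1.

Lemma low_long : exists l0, [/\ long l0, rn l0 (sr d) = 2, rn (sr d) l0 = 1 &
  forall k, k != d -> rn l0 (sr k) <= 0].
Proof.
have hl := long_gt0 ll1; elim/low_ind: l1 / hl ll1 => [a ha low la|a k ha kd _ IH la].
  case: (low_cases ha low) => [e|[h1 h2 h3]]; last by exists a.
  by move: la; rewrite e /long hd1.
by apply: IH; rewrite /long h_simple.
Qed.

(** Otherwise [sr k] pairs to -2 with [sr d], and [sr k + 2 sr d] is a long root [l2] pairing to 1
    with [l0]. The root [l0 - l2] cannot be positive since [l0] is lowest; if it is negative, [l0]
    is twice [sr d] or equals [l2], both impossible. *)
Lemma low_long_orth l0 k : long l0 -> rn l0 (sr d) = 2 -> rn (sr d) l0 = 1 ->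
  (forall j, j != d -> rn l0 (sr j) <= 0) -> k != d -> rn (sr d) (sr k) <> 0 ->
  rn l0 (sr k) = 0.
Proof.
move=> ll r2 r1 low kd nz; apply/eqP; apply: contraT => nz'.
have lt : rn l0 (sr k) < 0 by have := low k kd; move/eqP: nz'; clear; lia.
have hk : h (sr k) = 0 by rewrite co_sr_neq // eq_sym.
have dk : rn (sr d) (sr k) = -1 /\ rn (sr k) (sr d) < 0.
  have le : rn (sr d) (sr k) <= 0 by apply: rn_simple_le0; rewrite eq_sym.
  by case: (rn_levi hd0 hk) => -[h1 h2] //; move: le nz; rewrite h2.
have [dk1 dk2] := dk.
pose c := rr (sr k) (sr d).
have sc : short c by rewrite /short /c h_simple // hd1.
have rlc : rn l0 c = rn (rr (sr k) l0) (sr d) by rewrite -[l0](rr_inv (sr k)) rn_rr rr_inv.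
rewrite rn_rrl r2 in rlc.
have [[z _]|[z _]] := long_short ll sc; last by exfalso; move: rlc; rewrite z; nia.
have cd : rn c (sr d) = 2 + rn (sr k) (sr d).
  by rewrite /c rn_rrl rnaa dk1; clear; lia.
have kdm2 : rn (sr k) (sr d) = -2.
  have [_ [|e|e]] := short_short sc hd1.
  - by rewrite cd; clear; lia.
  - by have := nonorth_support sc hd1 ll e; rewrite z r2.
  - by move: dk2 cd; rewrite e rnaa; clear; lia.
have lkm1 : rn l0 (sr k) = -1 by move: rlc; rewrite z kdm2; clear; lia.
pose l2 := rr (sr d) (sr k).
have cl2 j : co j l2 = (j == k)%:R + 2 * (j == d)%:R by rewrite /l2 co_rr !co_sr kdm2; ring.
have ll2 : long l2 by rewrite /long cl2 eqxx eq_sym (negbTE kd).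
have r02 : rn l0 l2 = 1.
  have -> : rn l0 l2 = rn (rr (sr d) l0) (sr k) by rewrite -[l0](rr_inv (sr d)) rn_rr rr_inv.
  by rewrite rn_rrl r2 dk1 lkm1.
have r20 : rn l2 l0 = 1.
  by have := h_rn (long_gt0 ll) (long_gt0 ll2); rewrite ll ll2 r02; clear; lia.
pose b := rr l2 l0.
have cb j : co j b = co j l0 - co j l2 by rewrite co_rr r02 mul1r.
have rb : rn b l0 = 1 by rewrite rn_rrl rnaa r02 r20.
have pl0 := posP _ (pos_witness (long_gt0 ll)).
have [pb|nb] := boolP (rpos b).
  suff : rn b l0 <= 0 by rewrite rb.
  rewrite rn_expand; apply: sumr_le0 => j _; have [->|jd] := eqVneq j d.
    by rewrite cb ll ll2 subrr mul0r.
  apply: mulr_ge0_le0; first exact: (posP _ pb).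
  by rewrite leNgt; apply/negP => /rn_gt0_sym; have := low j jd; clear; lia.
have /posP pb' : rpos (ropp b) by rewrite pos_opp.
have le j : co j l0 <= co j l2 by have := pb' j; rewrite co_opp cb; clear; lia.
have z0 j : j != d -> j != k -> co j l0 = 0.
  by move=> jd jk; have := le j; have := pl0 j; rewrite cl2 (negbTE jd) (negbTE jk); clear; lia.
have [k0|k1] : co k l0 = 0 \/ co k l0 = 1.
  by have := le k; have := pl0 k; rewrite cl2 eqxx (negbTE kd); clear; lia.
  have [j jd|e|e] := @co_reduced R l0 d.
  - by have [->|/(z0 j jd)] := eqVneq j k.
  - by move: ll; rewrite e /long hd1.
  - by move: ll; rewrite e /long -/(ropp _) co_opp hd1.
have e : l0 = l2.
  apply: co_inj => j; have [->|jd] := eqVneq j d; first by rewrite ll ll2.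
  have [->|jk] := eqVneq j k; first by rewrite k1 cl2 eqxx (negbTE kd).
  by rewrite z0 // cl2 (negbTE jd) (negbTE jk).
by move: r02; rewrite -e rnaa.
Qed.

(** Levi reflections reduce to [a = sr d] and then lower [b] while fixing [sr d]. When the lowering
    root [sr k] is not orthogonal to [sr d], it is orthogonal to the lowest long root [l0]; then
    [l0] pairs to 2 with both summands and is their sum. *)
Lemma orth_add a b : short a -> short b -> a <> b -> rn a b = 0 ->
  exists2 l, long l & forall k, co k l = co k a + co k b.
Proof.
have [l0 [ll0 r2 r1 low]] := low_long.
have lift a' b' k : k != d ->
    (exists2 l, long l & forall j, co j l = co j (rr (sr k) a') + co j (rr (sr k) b')) ->
    exists2 l, long l & forall j, co j l = co j a' + co j b'.
  move=> kd [l ll hl]; exists (rr (sr k) l); first by rewrite /long h_simple.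
  by move=> j; have := rn_add (sr k) hl; rewrite !co_rr => ->; rewrite hl !co_rr !rn_rrl rnaa; ring.
have short_rr a' k : k != d -> short a' -> short (rr (sr k) a').
  by move=> kd; rewrite /short h_simple.
have base b' : short b' -> sr d <> b' -> rn (sr d) b' = 0 ->
    exists2 l, long l & forall k, co k l = co k (sr d) + co k b'.
  move=> sb; have hb := short_gt0 sb.
  elim/low_ind: b' / hb sb => [c hc lc sc ne|c k hc kd rk IH sc ne o].
    by case: (low_cases hc lc) => [e|[]]; [case: ne | rewrite sc].
  have [z|/eqP nz] := eqVneq (rn (sr d) (sr k)) 0.
    apply: (lift _ _ k kd); rewrite (rr_fix z); apply: IH.
    - exact: short_rr.
    - by move=> e; apply: ne; apply: (rr_inj (a := sr k)); rewrite -e rr_fix.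
    - by rewrite -{1}(rr_fix z) rn_rr.
  have z := low_long_orth ll0 r2 r1 low kd nz.
  have sc1 := short_rr _ _ kd sc.
  have e1 : rn l0 c = rn l0 (rr (sr k) c) by rewrite -[in RHS](rr_fix z) rn_rr.
  have r : rn l0 (rr (sr k) c) = 2.
    have [es [|e|e]] := short_short sc1 hd1; last by rewrite e.
      rewrite rn_rrl (rn_eq0_sym o) => w; exfalso.
      have lt : rn (sr k) (sr d) < 0.
        apply: rn_lt0_sym; have := @rn_simple_le0 R d k; rewrite eq_sym => /(_ kd).
        by move: nz; clear; lia.
      by move: w rk lt; clear; nia.
    by rewrite (nonorth_support sc1 hd1 ll0 e).
  exists l0 => //; apply: orth_support => //; first exact: hd1.
  by rewrite e1.
move=> sa; have ha := short_gt0 sa.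
elim/low_ind: a / ha b sa => [a ha la b sa sb ab o|a k ha kd rk IH b sa sb ab o].
  case: (low_cases ha la) => [e|[]]; last by rewrite sa.
  by rewrite e in ab o *; apply: base.
apply: (lift _ _ k kd); apply: IH; [exact: short_rr | exact: short_rr | | by rewrite rn_rr].
by move/rr_inj.
Qed.

(** For orthogonal [a] and [b], reflect the long root [a + b] in [b]. *)
Lemma short_comparable a b : short a -> short b -> a <> b ->
  exists g, forall k, co k g = co k a - co k b.
Proof.
move=> sa sb ab; have [e [o|r|//]] := short_short sa sb.
  have [l ll hl] := orth_add sa sb ab o.
  exists (rr b l) => k; rewrite co_rr (rn_add b hl) o rnaa hl; ring.
by exists (rr b a) => k; rewrite co_rr r; ring.
Qed.

Lemma long_decomp l : long l -> exists a b, [/\ short a, short b, rn l a = 2 &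
  forall k, co k l = co k a + co k b].
Proof.
move=> ll; suff [a sa r] : exists2 a, short a & rn l a = 2.
  by have [b sb hb] := long_sub ll sa r; exists a, b.
have hl := long_gt0 ll; elim/low_ind: l / hl ll => [a ha low la|a k ha kd _ IH la].
  case: (low_cases ha low) => [e|[_ r _]]; first by move: la; rewrite e /long hd1.
  by exists (sr d); first exact: hd1.
have [|c sc r] := IH; first by rewrite /long h_simple.
exists (rr (sr k) c); first by rewrite /short h_simple.
by rewrite -[a](rr_inv (sr k)) rn_rr.
Qed.

Section Nonorth.
Variables a0 b0 : ri R.
Hypotheses (sa0 : short a0) (sb0 : short b0) (r0 : rn a0 b0 = 1).

(** Having such a partner is invariant under the Levi Weyl group, and every short root lies in the
    orbit of [sr d]. *)
Lemma partner a : short a -> exists2 b, short b & rn a b = 1.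
Proof.
pose P a := exists2 b, short b & rn a b = 1.
have PP k x : k != d -> P (rr (sr k) x) <-> P x.
  move=> kd; split=> -[b sb r].
    by exists (rr (sr k) b); [rewrite /short h_simple | rewrite -[x](rr_inv (sr k)) rn_rr].
  by exists (rr (sr k) b); [rewrite /short h_simple | rewrite rn_rr].
have Pd : P (sr d).
  have ha := short_gt0 sa0; have : P a0 by exists b0.
  elim/low_ind: a0 / ha sa0 => [x ha la sa Pa|x k ha kd _ IH sa Pa].
    by case: (low_cases ha la) => [<-|[]]; last by rewrite sa.
  by apply: IH; [rewrite /short h_simple | apply/PP].
move=> sa; have ha := short_gt0 sa; rewrite -/(P a).
elim/low_ind: a / ha sa => [x ha la sa|x k ha kd _ IH sa].
  by case: (low_cases ha la) => [->|[]]; last by rewrite sa.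
by apply/(PP k) => //; apply: IH; rewrite /short h_simple.
Qed.

(** If [l = c + c'] were orthogonal to [a], then so would be [c] and a partner [e] of [c]. The long
    root [c + a] would then pair to 2 with [c] and to 1 with [e], against [nonorth_support]. *)
Lemma full_support l a : long l -> short a -> rn l a = 2.
Proof.
move=> ll sa; have [c [c' [sc sc' rc hc]]] := long_decomp ll.
have [[z _]|[//]] := long_short ll sa; exfalso.
have orth x : short x -> rn l x = 2 -> rn x a = 0 /\ x <> a.
  move=> sx rx; have [_ [//|e|e]] := short_short sx sa.
  - by split=> // e'; move: rx; rewrite e' z.
  - by have := nonorth_support sx sa ll e; rewrite rx z.
  - by move: rx; rewrite e z.
have [oc nc] := orth _ sc rc; have [e se re] := partner sc.
have rle : rn l e = 2 by rewrite -(nonorth_support sc se ll re).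
have [oe _] := orth _ se rle.
have [l2 ll2 hl2] := orth_add sc sa nc oc.
have r2c : rn l2 c = 2 by rewrite (rn_add c hl2) rnaa (rn_eq0_sym oc).
have := nonorth_support sc se ll2 re; rewrite r2c (rn_add e hl2) re (rn_eq0_sym oe).
by [].
Qed.

Lemma long_unique l l' : long l -> long l' -> l = l'.
Proof.
move=> ll ll'; have rd := full_support ll hd1; have rd' := full_support ll' hd1.
have [c sc hc] := long_sub ll' hd1 rd'.
have o : rn (sr d) c = 0.
  have := rn_add (sr d) hc; rewrite rd' rnaa => e.
  by apply: rn_eq0_sym; move: e; clear; lia.
have e := orth_support hd1 sc ll rd (full_support ll sc) o.
by apply: co_inj => k; rewrite e hc.
Qed.

Lemma nonorth_chain (disp : Order.disp_t) (M : finPOrderType disp) (f : M -> ri R) :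
  minuscule_frame d f -> forall x y : M, (x >=< y)%O.
Proof.
move=> [fi fo fd _ fle].
have st x y g : rpos g -> (forall k, co k (f y) = co k (f x) + co k g) -> (x <= y)%O.
  by move=> pg hg; apply/fle; apply: rt_step; exists g.
have cmp x y g : (forall k, co k g = co k (f x) - co k (f y)) -> (x >=< y)%O.
  move=> hg; apply/orP; have [pg|ng] := boolP (rpos g); [right|left].
    by apply: (st _ _ g pg) => k; rewrite hg; ring.
  by apply: (st _ _ (ropp g)) => [|k]; rewrite ?pos_opp // co_opp hg; ring.
have sl x y : short (f x) -> long (f y) -> (x >=< y)%O.
  move=> sx ly; have [b sb hb] := long_sub ly sx (full_support ly sx).
  by rewrite comparable_sym; apply: (cmp _ _ b) => k; rewrite hb; ring.
move=> x y; have [/eqP exy|/eqP xy] := boolP (f x == f y).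
  by rewrite (fi _ _ exy) comparablexx.
case: (h_le2 (fd x)) (h_le2 (fd y)) => [sx|lx] [sy|ly].
- by have [g hg] := short_comparable sx sy xy; apply: cmp hg.
- exact: sl.
- by rewrite comparable_sym; apply: sl.
- by case: xy; apply: long_unique.
Qed.

End Nonorth.
End Long.
End Cases.

(** * Shifted staircases and type D *)

(** Strict pairs replace the weak pairs of the shifted staircase, so that [(i, j)] can stand for the
    root [e_i + e_j] of type D. *)
Record staircase (disp : Order.disp_t) (M : finPOrderType disp) (m : nat)
    (p : M -> nat * nat) : Prop := Staircase {
  sc_lt : forall x, ((p x).1 < (p x).2 < m)%N;
  sc_inj : injective p;
  sc_onto : forall i j, (i < j < m)%N -> exists x, p x = (i, j);
  sc_le : forall x y : M, (x <= y)%O = ((p x).1 <= (p y).1)%N && ((p x).2 <= (p y).2)%N }.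

Lemma sum_delta (m k : nat) (F : nat -> int) (j : nat) : (j < m)%N ->
  \sum_(k <= i < m) (i == j)%:R * F i = (k <= j)%N%:R * F j.
Proof.
move=> jm; under eq_bigr do rewrite mulr_natl mulrb.
by rewrite -big_mkcond big_nat1_eq jm andbT mulr_natl mulrb.
Qed.

Lemma sum_delta1 (m k j : nat) : (j < m)%N -> \sum_(k <= i < m) (i == j)%:R = (k <= j)%N%:R :> int.
Proof.
by move=> jm; rewrite -[RHS]mulr1 -(sum_delta k (fun=> 1) jm); apply: eq_bigr => i _; rewrite mulr1.
Qed.

(** * The root system of type D in coordinates *)

Section DType.
Variable m' : nat.
Local Notation m := m'.+2.

Definition droot := {t : 'I_m * 'I_m * (bool * bool) | (t.1.1 < t.1.2)%N}.
Definition lo (a : droot) : nat := (val a).1.1.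
Definition hi (a : droot) : nat := (val a).1.2.
Definition slo (a : droot) := (val a).2.1.
Definition shi (a : droot) := (val a).2.2.
Definition sgb (b : bool) : int := if b then 1 else -1.

Definition nv (a : droot) (i : nat) : int :=
  (i == lo a)%:R * sgb (slo a) + (i == hi a)%:R * sgb (shi a).

Implicit Types (a b c : droot) (i j k : nat).

Lemma lo_hi a : (lo a < hi a < m)%N.
Proof. by rewrite /lo /hi (valP a) ltn_ord. Qed.

Lemma nv_lo a : nv a (lo a) = sgb (slo a).
Proof.
by rewrite /nv eqxx mul1r; have := lo_hi a; case: eqP => [->|]; rewrite ?ltnn // mul0r addr0.
Qed.

Lemma nv_hi a : nv a (hi a) = sgb (shi a).
Proof.
by rewrite /nv eqxx mul1r; have := lo_hi a; case: eqP => [->|]; rewrite ?ltnn // mul0r add0r.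
Qed.

Lemma nv_neq0 a i : (nv a i != 0) = (i == lo a) || (i == hi a).
Proof.
have [->|il] := eqVneq i (lo a); first by rewrite nv_lo; case: slo.
have [->|ih] := eqVneq i (hi a); first by rewrite nv_hi; case: shi.
by rewrite /nv (negbTE il) (negbTE ih) !mul0r addr0.
Qed.

Lemma nv_inj a b : nv a =1 nv b -> a = b.
Proof.
move=> h; have la := lo_hi a; have lb := lo_hi b.
have e i : (i == lo a) || (i == hi a) = (i == lo b) || (i == hi b).
  by rewrite -!nv_neq0 h.
have e1 : lo a = lo b by have := e (lo a); have := e (lo b); lia.
have e2 : hi a = hi b by have := e (hi a); have := e (hi b); lia.
have sinj (x y : bool) : sgb x = sgb y -> x = y by case: x y => [] [].
have e3 : slo a = slo b by apply: sinj; rewrite -!nv_lo -e1 h.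
have e4 : shi a = shi b by apply: sinj; rewrite -!nv_hi -e2 h.
apply: val_inj; move: e1 e2 e3 e4; rewrite /lo /hi /slo /shi.
by case: (val a) (val b) => [[a1 a2] [a3 a4]] [[b1 b2] [b3 b4]] /= /val_inj -> /val_inj -> -> ->.
Qed.

Lemma droot_make i j (x y : bool) : (i < j < m)%N ->
  exists a, [/\ lo a = i, hi a = j, slo a = x & shi a = y].
Proof.
case/andP=> ij jm; have im := ltn_trans ij jm.
by exists (exist _ (Ordinal im, Ordinal jm, (x, y)) ij).
Qed.

Lemma sum_nv k a (F : nat -> int) : \sum_(k <= i < m) nv a i * F i =
  (k <= lo a)%N%:R * (sgb (slo a) * F (lo a)) + (k <= hi a)%N%:R * (sgb (shi a) * F (hi a)).
Proof.
have /andP[l1 l2] := lo_hi a.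
under eq_bigr do rewrite /nv mulrDl -!mulrA.
by rewrite big_split /= !(sum_delta _ (fun i => _ * F i)) // (ltn_trans l1).
Qed.

Definition dot a b : int := \sum_(0 <= i < m) nv a i * nv b i.

Lemma dotC a b : dot a b = dot b a.
Proof. by apply: eq_bigr => i _; rewrite mulrC. Qed.

Lemma dotE a b : dot a b = sgb (slo a) * nv b (lo a) + sgb (shi a) * nv b (hi a).
Proof. by rewrite /dot sum_nv !mul1r. Qed.

Lemma sgb_sqr x : sgb x * sgb x = 1.
Proof. by case: x. Qed.

Lemma dotaa a : dot a a = 2.
Proof. by rewrite dotE nv_lo nv_hi !sgb_sqr. Qed.

Lemma sum_bilinear a b c (s t : int) :
  \sum_(0 <= i < m) (nv a i - s * nv c i) * (nv b i - t * nv c i) =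
  dot a b - t * dot a c - s * dot c b + s * t * dot c c.
Proof.
rewrite /dot !mulr_sumr -!sumrB -big_split /=.
by apply: eq_bigr => i _; ring.
Qed.

(** An integral vector of squared length 2 has exactly two nonzero entries, both plus or minus 1;
    hence closure under reflections needs no inspection of signs. *)
Lemma norm2_root (w : nat -> int) : (forall i, (m <= i)%N -> w i = 0) ->
  \sum_(0 <= i < m) w i * w i = 2 -> exists a, nv a =1 w.
Proof.
move=> w0; rewrite big_mkord => hw.
have [p wp] : exists p : 'I_m, w p != 0.
  apply/existsP; apply: contraT => /existsPn h; move: hw; rewrite big1 // => i _.
  by have := h i; rewrite negbK => /eqP ->; rewrite mul0r.
rewrite (bigD1 p) //= in hw.
have ge (P : pred 'I_m) : 0 <= \sum_(i | P i) w i * w i.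
  by apply: sumr_ge0 => i _; rewrite -expr2 sqr_ge0.
have sq (z : int) : z != 0 -> 0 <= 2 - z * z -> z * z = 1.
  by move=> z0 zz; have [|] : z = 1 \/ z = -1; [nia|move->|move->].
have p1 : w p * w p = 1 by apply: sq => //; rewrite -hw addrAC subrr add0r; apply: ge.
have {}hw : \sum_(i < m | i != p) w i * w i = 1.
  by apply: (addrI 1); rewrite -{1}p1 hw.
have [q /andP[qp wq]] : exists q : 'I_m, (q != p) && (w q != 0).
  apply/existsP; apply: contraT => /existsPn h; move: hw; rewrite big1 // => i ip.
  by have := h i; rewrite ip /= negbK => /eqP ->; rewrite mul0r.
rewrite (bigD1 q) //= in hw.
have q1 : w q * w q = 1.
  have S0 : 0 <= 1 - w q * w q by rewrite -hw addrAC subrr add0r; apply: ge.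
  by apply: sq => //; move: S0; clear; lia.
have z (i : 'I_m) : i != p -> i != q -> w i = 0.
  move=> ip iq; have /eqP : \sum_(i < m | (i != p) && (i != q)) w i * w i = 0.
    by apply: (addrI 1); rewrite -{1}q1 hw.
  rewrite psumr_eq0 => [/allP/(_ i)|j _]; last by rewrite -expr2 sqr_ge0.
  by rewrite mem_index_enum ip iq /= mulf_eq0 orbb => /(_ isT)/eqP.
have main (u v : 'I_m) : (u < v)%N -> w u * w u = 1 -> w v * w v = 1 ->
    (forall i : 'I_m, i != u -> i != v -> w i = 0) -> exists a, nv a =1 w.
  move=> uv u1 v1 zz; have uvm : (u < v < m)%N by rewrite uv ltn_ord.
  have [a [e1 e2 e3 e4]] := droot_make (w u == 1) (w v == 1) uvm.
  have sgw (t : int) : t * t = 1 -> sgb (t == 1) = t.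
    by move=> t1; have [->|->] : t = 1 \/ t = -1 by nia.
  exists a => i; rewrite /nv e1 e2 e3 e4 !sgw //.
  have [->|iu] := eqVneq i (u : nat); first by rewrite (ltn_eqF uv) mul1r mul0r addr0.
  have [->|iv] := eqVneq i (v : nat); first by rewrite mul1r mul0r add0r.
  rewrite !mul0r addr0; have [im|im] := ltnP i m; last by rewrite w0.
  by rewrite -[i]/(nat_of_ord (Ordinal im)) zz.
case: (ltngtP p q) => [pq|pq|e]; [exact: main z| |]; last first.
  by move: qp; rewrite (ord_inj e) eqxx.
by apply: (main q p) => // i iq ip; apply: z.
Qed.

Definition dref a b : droot :=
  odflt b [pick c | [forall i : 'I_m, nv c i == nv b i - dot b a * nv a i]].

Lemma nv_out a i : (m <= i)%N -> nv a i = 0.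
Proof.
move=> im; have := lo_hi a; apply: contraTeq; rewrite nv_neq0; lia.
Qed.

Lemma nv_dref a b i : nv (dref a b) i = nv b i - dot b a * nv a i.
Proof.
have [im|im] := ltnP i m; last by rewrite !nv_out // mulr0 subr0.
rewrite /dref; case: pickP => [c /forallP/(_ (Ordinal im))/eqP //|h].
have [||c hc] := @norm2_root (fun i => nv b i - dot b a * nv a i).
- by move=> j jm; rewrite !nv_out // mulr0 subr0.
- by rewrite sum_bilinear !dotaa (dotC a b); ring.
by move: (h c) => /forallP[] j; rewrite hc.
Qed.

(** Coefficients with respect to the base [e_0 + e_1], [e_k - e_(k-1)]; the
    first one is half the coordinate sum. *)
Definition dco0 a : int := 1 - (~~ slo a)%:R - (~~ shi a)%:R.
Definition dco k a : int :=
  if k == 0%N then dco0 a else if k == 1%N then dco0 a - nv a 0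
  else \sum_(k <= i < m) nv a i.

Lemma dco0E a : 2 * dco0 a = \sum_(0 <= i < m) nv a i.
Proof.
under eq_bigr do rewrite -[nv a _]mulr1.
by rewrite sum_nv !mul1r !mulr1 /dco0; case: slo; case: shi.
Qed.

Lemma sum_nv1 a : \sum_(1 <= i < m) nv a i = dco 0 a + dco 1 a.
Proof.
rewrite /dco /=; have := dco0E a; rewrite [X in _ = X]big_ltn //.
by set S := (\sum_(1 <= i < m) _); move: S; clear; lia.
Qed.

Lemma dco_linear (a b c : droot) (s t : int) :
  (forall i, nv c i = s * nv a i + t * nv b i) ->
  forall k, dco k c = s * dco k a + t * dco k b.
Proof.
move=> h; have suf k : \sum_(k <= i < m) nv c i =
    s * (\sum_(k <= i < m) nv a i) + t * (\sum_(k <= i < m) nv b i).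
  by rewrite !mulr_sumr -big_split; apply: eq_bigr => i _; rewrite h.
have h0 : dco0 c = s * dco0 a + t * dco0 b.
  have := suf 0%N; rewrite -!dco0E => e.
  by apply: (mulfI (x := 2)) => //; rewrite e; ring.
move=> k; rewrite /dco; case: eqP => // _; case: eqP => // _.
by rewrite h0 h; ring.
Qed.

Lemma nv_dco a i : nv a i = dco i a - dco i.+1 a + (i == 1%N)%:R * dco 0 a.
Proof.
case: i => [|[|i]]; rewrite /dco /=; first by ring.
- have := sum_nv1 a; rewrite /dco /= big_ltn //; clear; lia.
have [im|im] := ltnP i.+2 m; first by rewrite [in RHS]big_ltn //; ring.
by rewrite nv_out // !big_geq //; [ring | exact: leqW].
Qed.

Definition dsimple_coord k i : int :=
  (i == k)%:R - (i.+1 == k)%:R + ((k == 0%N) && (i == 1%N))%:R.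

Lemma dsimple_exists (k : 'I_m) : exists a, [forall i : 'I_m, nv a i == dsimple_coord k i].
Proof.
case: k => [[|k] km].
  have [a [h1 h2 h3 h4]] := @droot_make 0 1 true true isT.
  exists a; apply/forallP => i; apply/eqP; rewrite /nv /dsimple_coord h1 h2 h3 h4 /=.
  by rewrite !mulr1 subr0.
have km' : (k < k.+1 < m)%N by rewrite ltnSn.
have [a [h1 h2 h3 h4]] := droot_make false true km'.
exists a; apply/forallP => i; apply/eqP; rewrite /nv /dsimple_coord h1 h2 h3 h4 /= eqSS.
by rewrite /sgb; ring.
Qed.

Definition dsimple (k : 'I_m) : droot := xchoose (dsimple_exists k).

Lemma nv_dsimple (k : 'I_m) i : nv (dsimple k) i = dsimple_coord k i.
Proof.
have [im|im] := ltnP i m.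
  by have /forallP/(_ (Ordinal im))/eqP := xchooseP (dsimple_exists k).
rewrite nv_out // /dsimple_coord; have := ltn_ord k => km.
have -> : (i == k) = false by lia.
have -> : (i.+1 == k) = false by lia.
have -> : (i == 1%N) = false by lia.
by rewrite andbF.
Qed.

Lemma dco_dsimple (k l : 'I_m) : dco k (dsimple l) = (k == l)%:R.
Proof.
have lm := ltn_ord l.
have suf j : \sum_(j <= i < m) nv (dsimple l) i =
    (j <= l)%N%:R - (j < l)%N%:R + ((l == 0%N :> nat) && (j <= 1)%N)%:R.
  under eq_bigr => i _ do rewrite nv_dsimple /dsimple_coord.
  rewrite big_split sumrB /=; congr (_ - _ + _).
  - exact: sum_delta1.
  - case: (l : nat) lm => [|l'] lm; first by rewrite big1.
    by have := @sum_delta1 m j l' (ltnW lm).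
  - by case: (l == 0%N :> nat) => /=; [exact: sum_delta1 | rewrite big1].
have z : dco0 (dsimple l) = (l == 0%N :> nat)%:R.
  apply: (mulfI (x := 2)) => //; rewrite dco0E suf leq0n andbT.
  by case: (l : nat) => [|l'].
rewrite -(inj_eq val_inj) /= /dco z suf nv_dsimple /dsimple_coord.
by case: (k : nat) => [|[|k']]; case: (l : nat) => [|[|l']] //=; clear; lia.
Qed.

Lemma dco_sign a : (forall k : 'I_m, 0 <= dco k a) \/ (forall k : 'I_m, dco k a <= 0).
Proof.
have l := lo_hi a.
have suf k : \sum_(k <= i < m) nv a i =
    (k <= lo a)%N%:R * sgb (slo a) + (k <= hi a)%N%:R * sgb (shi a).
  by under eq_bigr do rewrite -[nv a _]mulr1; rewrite sum_nv !mulr1.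
have n0 : nv a 0 = (0%N == lo a)%:R * sgb (slo a).
  by rewrite /nv [0%N == hi a]ltn_eqF ?mul0r ?addr0 //; case/andP: l; case: (hi a).
case e : (shi a); [left|right] => k; rewrite /dco suf n0 /dco0 e /=;
  by case: (slo a) => /=; case: (nat_of_ord k) => [|[|j]] /=; move: l; clear; lia.
Qed.

(** A positive later coordinate forces some positive coefficient, and [dco_sign] extends this to
    all. *)
Lemma shi_pos a : shi a -> forall k : 'I_m, 0 <= dco k a.
Proof.
move=> s; case: (dco_sign a) => // h.
have l := lo_hi a; have hm : (hi a < m)%N by case/andP: l.
exfalso; have hk := h (Ordinal hm); rewrite /dco /= in hk.
have [h1|h1] := leqP (hi a) 1.
  have e1 : hi a = 1%N by lia.
  have e0 : lo a = 0%N by lia.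
  have := h ord0; move: hk; rewrite e1 /dco /= /nv e0 e1 /dco0 s /=.
  by case: (slo a) => /=; clear; lia.
move: hk; rewrite !gtn_eqF ?(ltnW h1) // big_ltn // nv_hi s big_nat big1 // => i /andP[ih _].
by apply/eqP; rewrite -[_ == _]negbK nv_neq0; lia.
Qed.

Definition dframe : root_frame.
Proof.
refine (@RootFrame droot 'I_m dsimple dot dref (fun k : 'I_m => dco k) _ _ _ dotaa _ _ _ _ _ _).
- move=> a b h; apply: nv_inj => i.
  have hh k : dco k a = dco k b.
    have [km|km] := ltnP k m; first exact: (h (Ordinal km)).
    by case: k km => [|[|k]] km //; rewrite /dco /= !big_geq.
  by rewrite !nv_dco !hh.
- move=> k a b; rewrite (@dco_linear b a (dref a b) 1 (- dot b a)); first by ring.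
  by move=> i; rewrite nv_dref; ring.
- move=> a b c.
  rewrite [LHS](eq_bigr (fun i => (nv b i - dot b c * nv c i) * (nv a i - dot a c * nv c i))).
    by rewrite sum_bilinear dotaa (dotC c a); ring.
  by move=> i _; rewrite !nv_dref.
- by move=> a b; rewrite dotC.
- by move=> a b; rewrite dotC.
- exact: dco_dsimple.
- exact: dco_sign.
- move=> a k h.
  have e i : nv a i = dco k a * nv (dsimple k) i.
    rewrite nv_dco nv_dsimple /dsimple_coord.
    have hh j : dco j a = (j == k)%:R * dco k a.
      have [->|jk] := eqVneq j k; first by rewrite mul1r.
      rewrite mul0r; have [jm|jm] := ltnP j m; first by apply: (h (Ordinal jm)).
      by case: j jm {jk} => [|[|j]] jm //; rewrite /dco /= big_geq.
    rewrite (hh i) (hh i.+1) (hh 0%N) [0%N == k]eq_sym -mulnb natrM; ring.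
  have : dco k a * dco k a = 1.
    have := dotaa a; rewrite /dot; under eq_bigr do rewrite !e mulrACA.
    by rewrite -mulr_sumr -/(dot _ _) dotaa; clear; lia.
  move=> c2; have [c1|c1] : dco k a = 1 \/ dco k a = -1 by nia.
    by left; apply: nv_inj => i; rewrite e c1 mul1r.
  by right; apply: nv_inj => i; rewrite e c1 nv_dref dotaa; ring.
- move=> b a; rewrite /dot.
  have x i : (i < m)%N -> nv b i = \sum_(k < m) dco k b * nv (dsimple k) i.
    move=> im; rewrite nv_dco.
    under eq_bigr => k _ do rewrite nv_dsimple /dsimple_coord mulrDr mulrBr.
    rewrite big_split sumrB /=; congr (_ - _ + _).
    + rewrite (bigD1 (Ordinal im)) //= eqxx mulr1 big1 ?addr0 // => k ki.
      by rewrite (_ : (i == k) = false) ?mulr0 // eq_sym; apply/negbTE.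
    + have [jm|jm] := ltnP i.+1 m.
        rewrite (bigD1 (Ordinal jm)) //= eqxx mulr1 big1 ?addr0 // => k ki.
        by rewrite (_ : (i.+1 == k) = false) ?mulr0 // eq_sym; apply/negbTE.
      rewrite big1 => [|k _]; last by rewrite gtn_eqF ?mulr0 //; apply: leq_trans (ltn_ord k) jm.
      by case: (i) im jm => [|i'] im jm //; rewrite /dco /= big_geq.
    + rewrite (bigD1 ord0) //= big1 => [|k k0]; first by rewrite addr0 mulrC.
      by rewrite (_ : (k == 0%N :> nat) = false) ?mulr0 //; apply/negbTE.
  rewrite big_nat; under eq_bigr => i im do rewrite x // mulr_suml.
  rewrite -big_nat exchange_big /=; apply: eq_bigr => k _.
  by rewrite mulr_sumr; apply: eq_bigr => i _; rewrite mulrA.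
Defined.

End DType.

(** * Staircases as tight posets of type D *)

Section StaircaseTight.
Variables (disp : Order.disp_t) (M : finPOrderType disp) (m' : nat) (p : M -> nat * nat).
Hypothesis H : staircase m'.+2 p.
Local Notation m := m'.+2.
Implicit Types x y z : M.

Lemma staircase_le_order (R : M -> M -> Prop) :
  (forall x y, (p x).1 = (p y).1 -> ((p x).2 < (p y).2)%N -> R x y) ->
  (forall x y, (p x).2 = (p y).2 -> ((p x).1 < (p y).1)%N -> R x y) ->
  forall x y, (x <= y)%O -> clos_refl_trans M R x y.
Proof.
move=> R2 R1 x y; rewrite (sc_le H) => /andP[h1 h2].
have lx := sc_lt H x; have ly := sc_lt H y.
have [z ez] : exists z, p z = ((p x).1, (p y).2) by apply: (sc_onto H); lia.
apply: (@rt_trans _ _ _ z).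
  have [e|ne] := eqVneq (p x).2 (p y).2.
    suff -> : x = z by apply: rt_refl.
    by apply: (sc_inj H); rewrite ez -e; case: (p x).
  by apply: rt_step; apply: R2; rewrite ez //= ltn_neqAle ne.
have [e|ne] := eqVneq (p x).1 (p y).1.
  suff -> : z = y by apply: rt_refl.
  by apply: (sc_inj H); rewrite ez e; case: (p y).
by apply: rt_step; apply: R1; rewrite ez //= ltn_neqAle ne.
Qed.

(** Node 0 is a half-spin node: the roots of coefficient 1 there are the [e_i + e_j]. *)
Lemma staircase_tight : exists f : M -> ri (dframe m'), tight_poset (ord0 : rk (dframe m')) f.
Proof.
have [f hf] := fin_all_exists (fun x => droot_make true true (sc_lt H x)).
have nvf x i : nv (f x) i = (i == (p x).1)%:R + (i == (p x).2)%:R.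
  by have [e1 e2 e3 e4] := hf x; rewrite /nv e1 e2 e3 e4 !mulr1.
have codf b : dco 0 b = dco0 b by [].
have fd x : dco 0 (f x) = 1 by have [_ _ e3 e4] := hf x; rewrite codf /dco0 e3 e4.
have onto b : dco 0 b = 1 -> exists x, f x = b.
  rewrite codf /dco0 => e; have [|x ex] := sc_onto H (i := lo b) (j := hi b); first exact: lo_hi.
  have [e1 e2 e3 e4] := hf x; exists x; apply: nv_inj => i.
  rewrite /nv e1 e2 e3 e4 ex /=.
  by move: e; case: (slo b); case: (shi b).
have nv1 (b : droot m') i : -1 <= nv b i <= 1.
  have [->|il] := eqVneq i (lo b); first by rewrite nv_lo; case: slo.
  have [->|ih] := eqVneq i (hi b); first by rewrite nv_hi; case: shi.
  by rewrite /nv (negbTE il) (negbTE ih) !mul0r addr0.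
exists f; split.
- by move=> b; rewrite /= codf /dco0; case: slo; case: shi.
- move=> x y e; apply: (sc_inj H); have [e1 e2 _ _] := hf x; have [e1' e2' _ _] := hf y.
  by move: e1 e2 e1' e2'; rewrite e; case: (p x) (p y) => [a b] [c d] /= -> -> -> ->.
- exact: onto.
- exact: fd.
- move=> x b /= bx bx'; split; first exact: dotC.
  have [e1 e2 e3 e4] := hf x.
  have dE : dot b (f x) = nv b (p x).1 + nv b (p x).2.
    by rewrite dotC dotE e1 e2 e3 e4 !mul1r.
  have h1 := nv1 b (p x).1; have h2 := nv1 b (p x).2; have lx := sc_lt H x.
  have idx : nv b (p x).1 != 0 -> nv b (p x).2 != 0 -> lo b = (p x).1 /\ hi b = (p x).2.
    by rewrite !nv_neq0; have := lo_hi b; lia.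
  have ne2 : dot b (f x) <> 2.
    rewrite dE => e; have [||l1 l2] := idx; [by move: e h1 h2; clear; lia | by move: e h1 h2; clear; lia |].
    apply: bx; apply: nv_inj => i; rewrite nvf /nv l1 l2 -nv_lo -nv_hi l1 l2.
    have -> : nv b (p x).1 = 1 by move: e h1 h2; clear; lia.
    have -> : nv b (p x).2 = 1 by move: e h1 h2; clear; lia.
    by rewrite !mulr1.
  have nem2 : dot b (f x) <> -2.
    rewrite dE => e; have [||l1 l2] := idx; [by move: e h1 h2; clear; lia | by move: e h1 h2; clear; lia |].
    apply: bx'; apply: nv_inj => i.
    rewrite nv_dref dotaa nvf {1}/nv l1 l2 -nv_lo -nv_hi l1 l2.
    have -> : nv b (p x).1 = -1 by move: e h1 h2; clear; lia.
    have -> : nv b (p x).2 = -1 by move: e h1 h2; clear; lia.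
    by ring.
  by move: ne2 nem2 h1 h2; rewrite dE; clear; lia.
have pos_root i j : (i < j < m)%N -> exists g : droot m', rpos (R:=dframe m') g /\
    forall k, nv g k = (k == j)%:R - (k == i)%:R.
  move=> ij; have [g [e1 e2 e3 e4]] := droot_make false true ij.
  exists g; split; first by apply/posP; apply: shi_pos; rewrite e4.
  by move=> k; rewrite /nv e1 e2 e3 e4 /sgb; ring.
have lin (a b c : droot m') : (forall i, nv c i = nv a i + nv b i) ->
    forall k : 'I_m, dco k c = dco k a + dco k b.
  move=> hh k; rewrite (@dco_linear _ a b c 1 1); first by rewrite !mul1r.
  by move=> i; rewrite hh !mul1r.
move=> x y; split.
  apply: staircase_le_order => {}x {}y e lt; have lx := sc_lt H x; have ly := sc_lt H y.
    have [|g [pg hg]] := pos_root (p x).2 (p y).2; first by lia.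
    exists g => //; apply: lin => i; rewrite !nvf hg e; ring.
  have [|g [pg hg]] := pos_root (p x).1 (p y).1; first by lia.
  exists g => //; apply: lin => i; rewrite !nvf hg e; ring.
elim=> [{}x {}y [g /posP pg hg]|{}x|{}x {}y z _ h1 _ h2]; [|exact: lexx|exact: le_trans h1 h2].
(* For [k] at least 1 this sum counts the members of the pair that are at least [k]. It is the
   coefficient at [k], or for [k = 1] the sum of those at 0 and 1, and so is monotone. *)
have suf k z : (1 <= k)%N -> \sum_(k <= i < m) nv (f z) i = (k <= (p z).1)%N%:R + (k <= (p z).2)%N%:R.
  move=> k1; have lz := sc_lt H z.
  under eq_bigr do rewrite nvf.
  by rewrite big_split /= !sum_delta1 //; lia.
have le k : (1 <= k < m)%N ->
    ((k <= (p x).1) + (k <= (p x).2) <= (k <= (p y).1) + (k <= (p y).2))%N.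
  case/andP=> k1 km.
  suff : \sum_(k <= i < m) nv (f x) i <= \sum_(k <= i < m) nv (f y) i.
    by rewrite !suf //; clear; lia.
  have [->|k2] := eqVneq k 1%N.
    rewrite !sum_nv1.
    have := hg (ord0 : 'I_m); have := hg (Ordinal (isT : (1 < m)%N)).
    have := pg (ord0 : 'I_m); have := pg (Ordinal (isT : (1 < m)%N)).
    rewrite /= => g1 g0 -> ->; move: g1 g0; clear; lia.
  have kE (b : droot m') : dco k b = \sum_(k <= i < m) nv b i.
    by rewrite /dco (negbTE k2) gtn_eqF.
  rewrite -!kE; have := hg (Ordinal km); have := pg (Ordinal km) => /= gk ->.
  by move: gk; clear; lia.
rewrite (sc_le H); have lx := sc_lt H x; have ly := sc_lt H y.
apply/andP; split.
  have [->//|i0] := eqVneq (p x).1 0%N.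
  by have := le (p x).1; lia.
by have := le (p x).2; lia.
Qed.

End StaircaseTight.

(** * Orthogonal short roots give a staircase *)

Section OrthStaircase.
Variables (R : root_frame) (d : rk R) (disp : Order.disp_t) (M : finPOrderType disp).
Variable f : M -> ri R.
Hypothesis H : minuscule_frame d f.
Variable l1 : ri R.
Hypothesis ll1 : long d l1.
Hypothesis orth : forall a b, short d a -> short d b -> a <> b -> rn a b = 0.
Implicit Types (a b c g : ri R) (i j r t : nat).
Let Hn := mf_nrm H.

(** Sorting by height makes every difference of a later and an earlier short root a positive
    root. *)
Definition shorts : seq (ri R) :=
  sort (fun a b => ht a <= ht b) [seq a <- enum (ri R) | co d a == 1].

Lemma mem_shorts a : (a \in shorts) = (co d a == 1).
Proof. by rewrite mem_sort mem_filter mem_enum andbT. Qed.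

Lemma shorts_uniq : uniq shorts.
Proof. by rewrite sort_uniq filter_uniq // enum_uniq. Qed.

Local Notation n := (size shorts).
Definition sh k : ri R := nth (sr d) shorts k.

Lemma sh_short k : (k < n)%N -> short d (sh k).
Proof. by move=> kn; apply/eqP; rewrite -mem_shorts mem_nth. Qed.

Lemma sh_inj i j : (i < n)%N -> (j < n)%N -> sh i = sh j -> i = j.
Proof. by move=> im jm /eqP; rewrite nth_uniq ?shorts_uniq // => /eqP. Qed.

Lemma sh_index a : short d a -> exists2 k, (k < n)%N & sh k = a.
Proof.
move=> sa; have ma : a \in shorts by rewrite mem_shorts sa.
by exists (index a shorts); [rewrite index_mem | rewrite /sh nth_index].
Qed.

Lemma sh_rn i j : (i < n)%N -> (j < n)%N -> rn (sh i) (sh j) = 2 * (i == j)%:R.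
Proof.
move=> im jm; case: eqP => [->|ij]; first by rewrite rnaa.
by rewrite orth ?mulr0 //; try exact: sh_short; move/sh_inj => e; apply: ij; apply: e.
Qed.

Lemma sh_diff i j : (i < j < n)%N -> exists2 g, rpos g & forall k, co k g = co k (sh j) - co k (sh i).
Proof.
case/andP=> ij jn; have im := ltn_trans ij jn.
have [||ne|g hg] := short_comparable Hn ll1 (a := sh j) (b := sh i) _ _ _.
- exact: sh_short.
- exact: sh_short.
- by have := sh_inj jn im ne; lia.
exists g => //.
have hs : ht (sh i) <= ht (sh j).
  have tr : transitive (fun a b : ri R => ht a <= ht b) by move=> a b c; apply: le_trans.
  have so : sorted (fun a b : ri R => ht a <= ht b) shorts.
    by apply: sort_sorted => a b; apply: le_total.
  have := @sorted_ltn_nth _ _ tr (sr d) shorts so i j; rewrite !inE; exact.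
have hgt : ht g = ht (sh j) - ht (sh i).
  by rewrite /ht -sumrB; apply: eq_bigr => k _; rewrite hg.
apply: contraT => ng; have := @ht_gt0 R (ropp g); rewrite pos_opp => /(_ ng).
suff -> : ht (ropp g) = - ht g by rewrite hgt; move: hs; clear; lia.
by rewrite /ht -sumrN; apply: eq_bigr => k _; rewrite co_opp.
Qed.

(** The reflection in [g] moves [sh r] to another short root, and the two differ by plus or minus
    [g]. *)
Lemma levi_sh g r : (r < n)%N -> rpos g -> co d g = 0 -> rn g (sh r) <> 0 ->
  exists u v, (v < u < n)%N /\ forall k, co k g = co k (sh u) - co k (sh v).
Proof.
move=> rn_ pg g0 nz; have sr_ := sh_short rn_.
have main x y : (x < n)%N -> (y < n)%N -> (forall k, co k g = co k (sh x) - co k (sh y)) ->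
    exists u v, (v < u < n)%N /\ forall k, co k g = co k (sh u) - co k (sh v).
  move=> xn yn h; exists x, y; split=> //; rewrite xn andbT.
  case: (ltngtP y x) => // [xy|e].
    have [|g' /posP pg' hg'] := sh_diff (i := x) (j := y); first by rewrite xy.
    have [k nk] := co_neq0 g; have := pg' k; have := posP _ pg k.
    by rewrite hg'; move: nk; rewrite h; clear; lia.
  by have [k] := co_neq0 g; rewrite h e subrr eqxx.
have s1 : short d (rr g (sh r)) by rewrite /short co_rr g0 mulr0 subr0.
have [t tn et] := sh_index s1.
have ct k : co k (sh t) = co k (sh r) - rn (sh r) g * co k g by rewrite et co_rr.
case: (rn_levi Hn (short_gt0 sr_) g0) => -[h1 h2]; first by case: nz.
- by apply: (main r t) => // k; rewrite ct h2; ring.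
- by apply: (main t r) => // k; rewrite ct h2; ring.
Qed.

(** On [M], twice the number of short summands of index at least [k]. In terms of pairings it is
    defined and additive on all roots, which allows a comparison along steps of the order. *)
Definition cnt k a : int := \sum_(k <= r < n) rn a (sh r).

Lemma cnt_pos k g : rpos g -> 0 <= cnt k g.
Proof.
move=> pg; rewrite /cnt.
have [hg|hg] := ltrP 0 (co d g).
  rewrite big_nat; apply: sumr_ge0 => r /andP[_ rn_].
  by have /andP[] := rn_range Hn hg (short_gt0 (sh_short rn_)).
have g0 : co d g = 0 by have := posP _ pg d; move: hg; clear; lia.
have [/existsP[r nr]|/existsPn z] := boolP [exists r : 'I_n, rn g (sh r) != 0]; last first.
  rewrite big_nat big1 // => r /andP[_ rn_].
  by have := z (Ordinal rn_); rewrite negbK => /eqP.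
have [u [v [/andP[vu un] h]]] := levi_sh (ltn_ord r) pg g0 (elimN eqP nr).
have vn := ltn_trans vu un.
have e : forall t, (t < n)%N -> rn g (sh t) = 2 * ((t == u)%:R - (t == v)%:R).
  move=> t tn; have := @rn_add R g (sh v) (sh u) (sh t).
  rewrite (sh_rn un tn) (sh_rn vn tn) ![_ == t]eq_sym mulrBr => -> //; first by ring.
  by move=> j; rewrite h subrK.
rewrite big_nat; under eq_bigr => t /andP[_ tn] do rewrite e //.
rewrite -big_nat -mulr_sumr sumrB.
by rewrite !sum_delta1 //; move: vu; clear; lia.
Qed.

(** Index 0 stands for an absent summand and [r.+1] for [sh r]: a short root gets the pair
    [(0, r.+1)], a long one a pair of positive indices. *)
Definition spot k (i : nat) : int := if i is i'.+1 then 2 * (k <= i')%N%:R else 0.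
Definition part (k : rk R) (i : nat) : int := if i is i'.+1 then co k (sh i') else 0.
Definition spec (x : M) (ij : nat * nat) :=
  (ij.1 < ij.2 < n.+1)%N /\ forall k, co k (f x) = part k ij.1 + part k ij.2.

Lemma spec_cnt x ij k : spec x ij -> cnt k (f x) = spot k ij.1 + spot k ij.2.
Proof.
case: ij => i j [/= /andP[ij jn] h].
have sd (w : nat) : (w < n)%N -> \sum_(k <= i < n) rn (sh w) (sh i) = 2 * (k <= w)%N%:R.
  move=> wn; rewrite big_nat.
  under eq_bigr => t /andP[_ tn] do rewrite sh_rn // eq_sym.
  by rewrite -big_nat -mulr_sumr sum_delta1.
rewrite /cnt; case: j ij jn h => // j ij jn h.
case: i ij h => [|i] ij h /=.
  have -> : f x = sh j by apply: co_inj => t; rewrite h add0r.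
  by rewrite add0r sd.
rewrite -!sd //; last by lia.
by rewrite -big_split; apply: eq_bigr => t _; apply: rn_add => u; rewrite h.
Qed.

Lemma spec_le x y ij ij' : spec x ij -> spec y ij' -> (x <= y)%O ->
  (ij.1 <= ij'.1)%N && (ij.2 <= ij'.2)%N.
Proof.
move=> sx sy /(mf_le H) xy.
have le k : cnt k (f x) <= cnt k (f y).
  elim: xy => [a b [g pg hg]|a|a b c _ h1 _ h2]; [|exact: lexx|exact: le_trans h1 h2].
  suff -> : cnt k (f b) = cnt k (f a) + cnt k g by have := cnt_pos k pg; clear; lia.
  by rewrite /cnt -big_split; apply: eq_bigr => r _; apply: rn_add.
have {}le k : spot k ij.1 + spot k ij.2 <= spot k ij'.1 + spot k ij'.2.
  by rewrite -(spec_cnt k sx) -(spec_cnt k sy).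
case: ij ij' sx sy le => [i j] [i' j'] [/= /andP[ij jn] _] [/= /andP[ij' jn'] _] le.
case: j ij jn le => // j ij jn le; case: j' ij' jn' le => // j' ij' jn' le.
apply/andP; split; last first.
  by have := le j; rewrite /= leqnn; case: (i) (i') ij ij' => [|?] [|?] /=; clear; lia.
case: i ij le => // i ij le; have := le i; rewrite /= leqnn.
by case: (i') ij ij' => [|?] /=; clear; lia.
Qed.

Lemma orth_staircase : exists m' p, @staircase disp M m'.+2 p.
Proof.
have n0 : (0 < n)%N.
  have : sr d \in shorts by rewrite mem_shorts co_sr !eqxx.
  by case: shorts.
have ex x : exists ij, spec x ij.
  case: (h_le2 Hn (mf_d H x)) => hx.
    have [k kn ek] := sh_index hx; exists (0%N, k.+1).
    by split=> [|j] /=; rewrite ?ltnS // ek add0r.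
  have [a [b [sa sb ra hab]]] := long_decomp Hn hx.
  have [i im ei] := sh_index sa; have [j jm ej] := sh_index sb.
  have ij : i <> j.
    move=> e; have := rn_add a hab; rewrite ra -ei -ej -e !sh_rn // eqxx.
    by clear; lia.
  case: (ltngtP i j) => // lt.
    by exists (i.+1, j.+1); split=> [|k] /=; rewrite ?hab ?ei ?ej //; lia.
  by exists (j.+1, i.+1); split=> [|k] /=; rewrite ?hab ?ei ?ej 1?addrC //; lia.
have [p hp] := fin_all_exists ex.
have uniq x ij : spec x ij -> p x = ij.
  move=> sx; have := spec_le (hp x) sx (lexx x); have := spec_le sx (hp x) (lexx x).
  by case: (p x) ij sx => [a b] [a' b'] _ /= h1 h2; congr (_, _); lia.
have stp x y g : rpos g -> (forall k, co k (f y) = co k (f x) + co k g) -> (x <= y)%O.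
  by move=> pg hg; apply/(mf_le H); apply: rt_step; exists g.
have onto i j : (i < j < n.+1)%N -> exists x, p x = (i, j).
  move=> ij; suff [x hx] : exists x, spec x (i, j) by exists x; apply: uniq.
  case: j ij => // j ij; case: i ij => [|i] ij.
    have [|x ex'] := mf_onto H (b := sh j); first by apply: short_gt0; apply: sh_short; lia.
    by exists x; split=> //= k; rewrite ex' add0r.
  have [||ne||l ll hl] := orth_add Hn ll1 (a := sh i) (b := sh j) _ _ _ _.
  - by apply: sh_short; lia.
  - by apply: sh_short; lia.
  - by have := @sh_inj i j _ _ ne; lia.
  - by rewrite sh_rn; [rewrite ltn_eqF ?mulr0 //; lia | lia | lia].
  have [|x ex'] := mf_onto H (b := l); first exact: long_gt0.
  by exists x; split=> //= k; rewrite ex' hl.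
exists n.-1, p; have en : n.-1.+2 = n.+1 by lia.
rewrite en; split=> //.
- by move=> x; have [] := hp x.
- move=> x y e; apply: (mf_inj H); apply: co_inj => k.
  by have [_ ->] := hp x; have [_ ->] := hp y; rewrite e.
move=> x y; apply/idP/idP => [|/andP[h1 h2]]; first exact: spec_le (hp x) (hp y).
have [lx cx] := hp x; have [ly cy] := hp y.
have [z ez] : exists z, p z = ((p x).1, (p y).2) by apply: onto; lia.
have [lz cz] := hp z; rewrite ez /= in lz cz.
apply: (@le_trans _ _ z).
  have [e|ne] := eqVneq (p x).2 (p y).2.
    suff -> : x = z by [].
    by apply: (mf_inj H); apply: co_inj => k; rewrite cx cz e.
  have lt2 : ((p x).2 < (p y).2)%N by rewrite ltn_neqAle ne.
  have [|g pg hg] := sh_diff (i := (p x).2.-1) (j := (p y).2.-1); first by lia.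
  apply: (stp _ _ g pg) => k; rewrite cx cz hg.
  case: (p x).2 (p y).2 lx ly lt2 => [|a] [|b] //= *; ring.
have [e|ne] := eqVneq (p x).1 (p y).1.
  suff -> : z = y by [].
  by apply: (mf_inj H); apply: co_inj => k; rewrite cy cz e.
have lt1 : ((p x).1 < (p y).1)%N by rewrite ltn_neqAle ne.
case e1 : (p x).1 lt1 cz => [|a] lt1 cz; case e2 : (p y).1 ly cy lt1 => [|b] //= ly cy lt1.
  apply: (stp _ _ (sh b)); last by move=> k; rewrite cy cz /=; ring.
  by apply: (@pos_witness _ _ d); apply: short_gt0; apply: sh_short; lia.
have [|g pg hg] := sh_diff (i := a) (j := b); first by lia.
by apply: (stp _ _ g pg) => k; rewrite cy cz hg /=; ring.
Qed.

End OrthStaircase.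

(** * Chains *)

Section Chain.
Variables (disp : Order.disp_t) (M : finPOrderType disp).
Hypothesis chain : forall x y : M, (x >=< y)%O.
Implicit Types (x y : M) (A B l a b n : {set M}) (T : {ffun M -> nat}).

Lemma chain_antichain A : is_antichain A -> (#|A| <= 1)%N.
Proof.
move=> hA; rewrite leqNgt; apply/negP => /card_gt1P[x [y [xA yA ne]]].
by have := hA _ _ xA yA; have := hA _ _ yA xA; case: (comparable_ltgtP (chain x y)) ne.
Qed.

(** If [n :\: l] has a single element, that element is isolated and lies in exactly one of [a] and
    [b]. Otherwise [n :\: l] has 0 or 2 elements, and the bound on antichains fixes all
    cardinals. *)
Lemma chain_square l a b n : growth_square l a b n -> (#|l| + #|n| = #|a| + #|b|)%N.
Proof.
case=> _ _ _ _ la lb an bn /chain_antichain A1 /chain_antichain A2 /chain_antichain A3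
  /chain_antichain A4 hi _.
have cd A B : A \subset B -> #|B| = (#|A| + #|B :\: A|)%N.
  by move=> AB; rewrite -(cardsID A B) (setIidPr AB).
have e1 := cd _ _ la; have e2 := cd _ _ an; have e3 := cd _ _ lb; have e4 := cd _ _ bn.
have ln := cd _ _ (subset_trans la an).
have [/eqP/cards1P[x ex]|ne] := eqVneq #|n :\: l| 1%N;
  last by clear -e1 e2 e3 e4 A1 A2 A3 A4 ln ne; lia.
have xb : (x \in b) = (x \notin a).
  have xD : x \in n :\: l by rewrite ex set11.
  by apply: hi => // y; rewrite ex inE => /eqP ->; rewrite /hasse_adj /covers ltxx.
have /setP/(_ x) := ex; rewrite !inE eqxx => /andP[xl xn].
have c1 A : x \in A -> (0 < #|A :\: l|)%N.
  by move=> xA; apply/card_gt0P; exists x; rewrite inE xl.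
have c2 A : x \notin A -> (0 < #|n :\: A|)%N.
  by move=> xA; apply/card_gt0P; exists x; rewrite inE xA.
case xa : (x \in a) xb => /= xb.
  have a1 : #|a :\: l| = 1%N by apply/eqP; rewrite eqn_leq A1 c1.
  have b1 : #|n :\: b| = 1%N by apply/eqP; rewrite eqn_leq A4 c2 ?xb.
  by rewrite e4 e1 a1 b1; ring.
have b1 : #|b :\: l| = 1%N by apply/eqP; rewrite eqn_leq A3 c1.
have a1 : #|n :\: a| = 1%N by apply/eqP; rewrite eqn_leq A2 c2 ?xa.
by rewrite e2 e3 a1 b1; ring.
Qed.

Lemma chain_ideal A B : is_ideal A -> is_ideal B -> #|A| = #|B| -> A = B.
Proof.
move=> hA hB e; have [AB|/subsetPn[x xA xB]] := boolP (A \subset B).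
  by apply/eqP; rewrite eqEcard AB e leqnn.
apply/eqP; rewrite eq_sym eqEcard e leqnn andbT; apply/subsetP => y yB.
have /orP[xy|yx] := chain x y; last exact: hA yx xA.
by rewrite (hB _ _ xy yB) in xB.
Qed.

Variables (q : nat) (T : {ffun M -> nat}).
Hypotheses (q0 : (0 < q)%N) (hT : increasing_tableau q T).
Let c i j := #|sublevel (iter i (Kpromotion q) T) j|.

(** Promotion shifts the increments of the cardinals of the sublevel sets cyclically by one place,
    and there are [q] increments. *)
Lemma chain_promotion : iter q (Kpromotion q) T = T.
Proof.
have hi i := iter_Kpromotion_increasing i q0 hT.
have c0 i : c i 0 = 0%N by rewrite /c (sublevel0 (hi i)) cards0.
have cq i : c i q = c 0 q by rewrite /c (sublevel_height (hi i)) (sublevel_height hT).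
have step i j : (j < q)%N -> (c i.+1 j + c i 1 = c i j.+1)%N.
  elim: j => [|j IH] jq; first by rewrite c0.
  have := chain_square (Kpromotion_square (hi i) q0 jq); have := IH (ltnW jq).
  by rewrite /c /=; lia.
have main i j : (i <= q)%N -> (j <= q)%N -> (c i j + c 0 i =
    if i + j <= q then c 0 (i + j) else c 0 q + c 0 (i + j - q))%N.
  elim: i j => [|i IH] j iq jq; first by rewrite jq c0 addn0.
  have := IH 1%N (ltnW iq) q0; rewrite addn1 iq => e1.
  have [jq'|jq'] := ltnP j q.
    by have := step i j jq'; have := IH j.+1 (ltnW iq) jq'; rewrite addnS addSn; lia.
  have -> : j = q by lia.
  by rewrite cq ifN ?addnK //; lia.
apply/ffunP => x.
have e j : (j <= q)%N -> (iter q (Kpromotion q) T x <= j)%N = (T x <= j)%N.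
  move=> jq; suff : sublevel (iter q (Kpromotion q) T) j = sublevel T j.
    by move/setP/(_ x); rewrite !inE.
  apply: chain_ideal; [exact: (sublevel_ideal (hi q))|exact: (sublevel_ideal hT)|].
  have := main q j (leqnn q) jq; rewrite -/(c q j) -/(c 0 j); case: (j) => [|k].
    by rewrite !c0.
  by rewrite ifN; [rewrite addKn; lia | lia].
apply/eqP; rewrite eqn_leq e ?(tableau_le hT) // leqnn /= -e ?(tableau_le (hi q)) //.
Qed.

End Chain.

(** * Case distinction on root lengths *)

Theorem theorem4p1 (disp : Order.disp_t) (M : finPOrderType disp) (q : nat)
    (T : {ffun M -> nat}) :
  minuscule_poset M -> (0 < q)%N -> increasing_tableau q T ->
  {in doubletree M, forall x, T x = iter q (Kpromotion q) T x}.
Proof.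
move=> /minuscule_poset_frame[R [d [f H]]] q0 hT; have Hn := mf_nrm H.
have tight (R' : root_frame) (d' : rk R') (f' : M -> ri R') : tight_poset d' f' ->
    {in doubletree M, forall x, T x = iter q (Kpromotion q) T x}.
  by move=> ht; have [g [gi [hg hneg]]] := exists_longest d'; exact: (tight_promotion ht hg hneg q0 hT).
have [/forallP h1|] := boolP [forall b : ri R, (0 < co d b) ==> (co d b == 1)].
  by apply: tight; apply: (tight_of_short Hn H) => b hb; apply/eqP/(implyP (h1 b)).
rewrite negb_forall => /existsP[l1]; rewrite negb_imply => /andP[l0 l1n1].
have ll1 : long d l1 by case: (h_le2 Hn l0) l1n1 => // ->.
have [/existsP[a0 /existsP[b0 /and3P[/eqP sa /eqP sb /eqP ab]]]|no] :=
  boolP [exists a0, exists b0, [&& co d a0 == 1, co d b0 == 1 & rn a0 b0 == 1]].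
  by move=> x _; rewrite chain_promotion //; apply: (nonorth_chain Hn ll1 sa sb ab H).
have orth a b : short d a -> short d b -> a <> b -> rn a b = 0.
  move=> sa sb ne; have [_ [//|ab|//]] := short_short Hn sa sb.
  case/existsP: no; exists a; apply/existsP; exists b.
  by rewrite ab; move: sa sb; rewrite /short => -> ->; rewrite !eqxx.
have [m' [p hp]] := orth_staircase H ll1 orth.
by have [f' ht] := staircase_tight hp; apply: tight ht.
Qed.
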